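(* Let $M$ be a connected CW-complex with finite $1$-skeleton. Then there exists a finitely generated, two-step nilpotent, torsion-free group $G$ such that $\mathcal{R}^1_k(M)=\mathcal{R}^1_k(G)$ for all $k>0$, under a suitable linear isomorphism $H^1(G,\mathbb{C})\cong H^1(M,\mathbb{C})$ (the same one for all $k$).
   Context: For a connected CW-complex $M$ with finite $1$-skeleton and $z\in H^1(M,\mathbb{C})$, let $\mu_z$ denote left multiplication by $z$ on $H^\bullet(M,\mathbb{C})$; since $z^2=0$, $(H^\bullet(M,\mathbb{C}),\mu_z)$ is a cochain complex. The resonance varieties are $$\mathcal{R}^i_k(M)=\{z\in H^1(M,\mathbb{C})\mid\dim_{\mathbb{C}}H^i(H^\bullet(M,\mathbb{C}),\mu_z)\ge k\},\qquad i,k>0.$$ For a finitely generated group $G$, $\mathcal{R}^i_k(G)$ is defined as $\mathcal{R}^i_k(K(G,1))$. Two-step nilpotent means $\Gamma_3G=\{1\}$, where $\Gamma_1G=G$ and $\Gamma_jG=(G,\Gamma_{j-1}G)$ is the lower central series. *)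

(* Defs.v *)
From HB Require Import structures.
From mathcomp Require Import all_boot all_order all_algebra.
From mathcomp Require Import generic_quotient ring_quotient.
From mathcomp Require Import complex zify ring.
From mathcomp Require Import all_classical all_reals all_analysis.

Set Implicit Arguments.
Unset Strict Implicit.
Unset Printing Implicit Defensive.

Import Order.TTheory GRing.Theory Num.Theory.
Import numFieldNormedType.Exports.

Local Open Scope classical_set_scope.
Local Open Scope quotient_scope.
Local Open Scope ring_scope.

(* The quotient of a module by a submodule: [Quotient.quot] only provides the
   additive group. *)
Section LmodQuotient.
Variables (K : nzRingType) (V : lmodType K) (U : zmodClosed V).
Hypothesis UZ : forall (a : K) (x : V), x \in U -> a *: x \in U.

Definition lmod_quot of (forall (a : K) (x : V), x \in U -> a *: x \in U) :=
  Quotient.quot U.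
Local Notation Q := (lmod_quot UZ).

HB.instance Definition _ := GRing.Zmodule.on Q.

Definition lmod_proj (x : V) : Q := \pi_(Quotient.quot U) x.
Definition lmod_repr (q : Q) : V := repr (q : Quotient.quot U).

Lemma lmod_reprK q : lmod_proj (lmod_repr q) = q.
Proof. exact: reprK. Qed.

Lemma lmod_projP x y : lmod_proj x = lmod_proj y <-> x - y \in U.
Proof.
rewrite /lmod_proj; split => [/eqP|h]; first by rewrite -Quotient.idealrBE.
by apply/eqP; rewrite -Quotient.idealrBE.
Qed.

Definition lmod_quot_scale (a : K) (q : Q) : Q := lmod_proj (a *: lmod_repr q).

Lemma lmod_projD x y : lmod_proj (x + y) = lmod_proj x + lmod_proj y.
Proof. exact: (raddfD (\pi_(Quotient.quot U))). Qed.

Lemma lmod_projZ a x : lmod_proj (a *: x) = lmod_quot_scale a (lmod_proj x).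
Proof.
apply/lmod_projP; rewrite -scalerBr; apply: UZ.
by apply/lmod_projP; rewrite lmod_reprK.
Qed.

Fact lmod_quot_scaleA a b q :
  lmod_quot_scale a (lmod_quot_scale b q) = lmod_quot_scale (a * b) q.
Proof. by rewrite -[q]lmod_reprK -!lmod_projZ scalerA. Qed.

Fact lmod_quot_scale1 : left_id 1 lmod_quot_scale.
Proof. by move=> q; rewrite -[q]lmod_reprK -lmod_projZ scale1r. Qed.

Fact lmod_quot_scaleDr : right_distributive lmod_quot_scale +%R.
Proof.
move=> a q r; rewrite -[q]lmod_reprK -[r]lmod_reprK.
by rewrite -lmod_projD -!lmod_projZ scalerDr lmod_projD.
Qed.

Fact lmod_quot_scaleDl q : {morph lmod_quot_scale^~ q : a b / a + b}.
Proof.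
move=> a b; rewrite -[q]lmod_reprK -!lmod_projZ.
by rewrite scalerDl lmod_projD.
Qed.

HB.instance Definition _ := GRing.Zmodule_isLmodule.Build K Q
  lmod_quot_scaleA lmod_quot_scale1 lmod_quot_scaleDr lmod_quot_scaleDl.

Fact lmod_proj_linear : linear lmod_proj.
Proof. by move=> a x y; rewrite lmod_projD lmod_projZ. Qed.

HB.instance Definition _ := GRing.isLinear.Build K V Q *:%R lmod_proj
  lmod_proj_linear.

End LmodQuotient.

Record cochain_complex (K : fieldType) := CochainComplex {
  cochains :> nat -> lmodType K;
  coboundary : forall n, {linear cochains n -> cochains n.+1};
  coboundaryK : forall n (x : cochains n), coboundary n.+1 (coboundary n x) = 0
}.

Section Cohomology.
Variables (K : fieldType) (E : cochain_complex K) (n : nat).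

Definition is_cocycle : {pred E n} := fun x => coboundary E n x == 0.

Fact is_cocycle_submod : submod_closed is_cocycle.
Proof.
split=> [|a x y]; rewrite !unfold_in ?linear0 // => /eqP dx /eqP dy.
by rewrite linearP dx dy scaler0 addr0.
Qed.

HB.instance Definition _ := GRing.isSubmodClosed.Build K (E n) is_cocycle
  is_cocycle_submod.

Definition cocycle := {x : E n | x \in is_cocycle}.
HB.instance Definition _ := [isSub of cocycle for sval].
HB.instance Definition _ := [Choice of cocycle by <:].
HB.instance Definition _ := [SubChoice_isSubLmodule of cocycle by <:].

(* Nothing is a coboundary in degree 0 but 0: complexes start in degree 0. *)
Definition coboundaries : set (E n) :=
  (if n is m.+1 as k return set (E k) then range (coboundary E m) else [set 0]).

Fact coboundaries_lin a x y :
  coboundaries x -> coboundaries y -> coboundaries (a *: x + y).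
Proof.
rewrite /coboundaries; case: (n) x y => [|m] x y.
  by move=> -> ->; rewrite scaler0 addr0.
by move=> [u _ <-] [v _ <-]; exists (a *: u + v) => //; rewrite linearP.
Qed.

Fact coboundaries0 : coboundaries 0.
Proof. by rewrite /coboundaries; case: (n) => [//|m]; exists 0; rewrite ?linear0. Qed.

Definition is_coboundary : {pred cocycle} := fun x => `[< coboundaries (val x) >].

Fact is_coboundary_submod : submod_closed is_coboundary.
Proof.
split=> [|a x y]; rewrite !unfold_in.
  by apply/asboolP; rewrite raddf0; exact: coboundaries0.
move=> /asboolP bx /asboolP by_; apply/asboolP.
by rewrite linearP; exact: coboundaries_lin.
Qed.

HB.instance Definition _ := GRing.isSubmodClosed.Build K cocycle is_coboundary
  is_coboundary_submod.
Fact is_coboundaryZ a x : x \in is_coboundary -> a *: x \in is_coboundary.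
Proof. exact: rpredZ. Qed.

Definition cohomology := lmod_quot is_coboundaryZ.
HB.instance Definition _ := GRing.Lmodule.on cohomology.

End Cohomology.

Section CohomologyClasses.
Variables (K : fieldType) (E : cochain_complex K) (n : nat).

Definition cocycle_class (x : cocycle E n) : cohomology E n := lmod_proj (@is_coboundaryZ K E n) x.
Definition cocycle_repr (u : cohomology E n) : cocycle E n :=
  @lmod_repr _ _ _ (@is_coboundaryZ K E n) u.

Fact cocycle_class_linear : linear cocycle_class.
Proof. by move=> a x y; rewrite /cocycle_class linearP. Qed.

HB.instance Definition _ := GRing.isLinear.Build K (cocycle E n)
  (cohomology E n) *:%R cocycle_class cocycle_class_linear.

Lemma cocycle_reprK u : cocycle_class (cocycle_repr u) = u.
Proof. exact: lmod_reprK. Qed.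

Lemma cocycle_classP x y :
  cocycle_class x = cocycle_class y <-> coboundaries (val x - val y).
Proof.
rewrite /cocycle_class lmod_projP unfold_in -raddfB.
by split=> /asboolP.
Qed.

End CohomologyClasses.

Section StandardSimplex.
Variable R : realType.

Definition std_simplex n : set 'rV[R]_n.+1 :=
  [set t | (forall i, 0 <= t ord0 i) /\ \sum_i t ord0 i = 1].

(* The affine map sending the vertex i to the vertex theta i. *)
Definition affine_map m n (theta : 'I_m.+1 -> 'I_n.+1) (t : 'rV[R]_m.+1) :
  'rV[R]_n.+1 := \row_j \sum_(i | theta i == j) t ord0 i.

Fact affine_map_simplex m n (theta : 'I_m.+1 -> 'I_n.+1)
  (t : set_type (std_simplex (n := m))) :
  affine_map theta (set_val t) \in std_simplex (n := n).
Proof.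
have [t0 t1] := set_valP t; apply/mem_set; split=> [j|].
  by rewrite mxE sumr_ge0.
rewrite -[RHS]t1 (partition_big theta xpredT)//=.
by apply: eq_bigr => j _; rewrite mxE.
Qed.

Definition simplex_map m n (theta : 'I_m.+1 -> 'I_n.+1)
  (t : set_type (std_simplex (n := m))) : set_type (std_simplex (n := n)) :=
  exist _ (affine_map theta (set_val t)) (affine_map_simplex theta t).

Fact simplex_map_continuous m n (theta : 'I_m.+1 -> 'I_n.+1) :
  continuous (simplex_map theta).
Proof.
pose f (u : set_type (std_simplex (n := m))) := affine_map theta (set_val u).
apply: (@continuous_comp_initial _ _ _ _ (simplex_map theta)).
suff cf : continuous f by [].
move=> t; have FF : Filter (nbhs t) := nbhs_filter t.
apply/cvg_ballP => e e0.
have cvj j : f u ord0 j @[u --> t] -->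
    f t ord0 j.
  under eq_cvg do rewrite /f mxE.
  rewrite /f mxE; apply: cvg_big => [|i _]; first exact: add_continuous.
  apply: (@continuous_comp _ _ _ set_val (fun u : 'rV[R]_m.+1 => u ord0 i)).
    exact: initial_continuous.
  exact: coord_continuous.
have : \forall u \near t, forall j,
    ball (f t ord0 j) e (f u ord0 j).
  apply: (@filter_forall _ _ (fun j u => ball (f t ord0 j) e (f u ord0 j)) _ FF).
  by move=> j; have /cvg_ballP := cvj j; exact.
by apply: filterS => u tu; split=> // i j; rewrite (ord1 i); exact: tu.
Qed.

HB.instance Definition _ m n (theta : 'I_m.+1 -> 'I_n.+1) :=
  @isContinuous.Build _ _ (simplex_map theta) (@simplex_map_continuous m n theta).

Lemma simplex_map_comp m n p (theta : 'I_m.+1 -> 'I_n.+1)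
  (eta : 'I_n.+1 -> 'I_p.+1) :
  simplex_map eta \o simplex_map theta = simplex_map (eta \o theta).
Proof.
apply/funext => t; apply: val_inj; apply/rowP => k; rewrite !mxE /=.
rewrite (partition_big theta (fun j => eta j == k))//=.
apply: eq_bigr => j /eqP jk; rewrite mxE; apply: eq_bigl => i.
by case: eqP => [->|]; rewrite ?andbF// jk eqxx.
Qed.

End StandardSimplex.

Arguments std_simplex R n : clear implicits.

Section SingularCochains.
Variables (R : realType) (X : topologicalType).
Local Notation C := R[i].

Definition singular_simplex n := continuousType (set_type (std_simplex R n)) X.

Definition restrict m n (theta : 'I_m.+1 -> 'I_n.+1) (s : singular_simplex n) :
  singular_simplex m := s \o simplex_map theta.

Definition singular_cochain n := singular_simplex n -> C^o.
HB.instance Definition _ n := GRing.Lmodule.on (singular_cochain n).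

(* [lift i] is the increasing map missing i, i.e., the i-th face. *)
Definition singular_coboundary n (f : singular_cochain n) :
  singular_cochain n.+1 :=
  fun s => \sum_(i < n.+2) (-1) ^+ i * f (restrict (lift i) s).

Definition front p q (i : 'I_p.+1) : 'I_(p + q).+1 := inord i.
Definition back p q (i : 'I_q.+1) : 'I_(p + q).+1 := inord (p + i).

(* Alexander-Whitney: f on the face [0 .. p] times g on the face [p .. p+q]. *)
Definition cup p q (f : singular_cochain p) (g : singular_cochain q) :
  singular_cochain (p + q) :=
  fun s => f (restrict (@front p q) s) * g (restrict (@back p q) s).

Lemma restrict_comp m n p (theta : 'I_m.+1 -> 'I_n.+1)
  (eta : 'I_n.+1 -> 'I_p.+1) (s : singular_simplex p) :
  restrict theta (restrict eta s) = restrict (eta \o theta) s.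
Proof. by apply/continuousEP => t /=; rewrite -simplex_map_comp. Qed.

Fact singular_coboundary_linear n : linear (@singular_coboundary n).
Proof.
move=> a f g; apply/funext => s.
rewrite /singular_coboundary !fctE scaler_sumr -big_split/=.
by apply: eq_bigr => i _; rewrite mulrDr -scalerAr.
Qed.

HB.instance Definition _ n := GRing.isLinear.Build C _ _ *:%R
  (@singular_coboundary n) (@singular_coboundary_linear n).

Fact singular_coboundaryK n (f : singular_cochain n) :
  singular_coboundary (singular_coboundary f) = 0.
Proof.
apply/funext => s; rewrite /singular_coboundary.
pose F (i : 'I_n.+3) (j : 'I_n.+2) : C :=
  (-1) ^+ (i + j) * f (restrict (lift i \o lift j) s).
transitivity (\sum_(i < n.+3) \sum_(j < n.+2) F i j).
  apply: eq_bigr => i _; rewrite mulr_sumr; apply: eq_bigr => j _.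
  by rewrite restrict_comp mulrA -exprD.
rewrite pair_big/= (bigID (fun u : 'I_n.+3 * 'I_n.+2 => (u.2 < u.1)%N))/=.
rewrite addrC; apply/eqP; rewrite addr_eq0 -sumrN; apply/eqP.
have [h hE] : exists h : 'I_n.+3 * 'I_n.+2 -> 'I_n.+3 * 'I_n.+2,
    forall u, ((h u).1 = u.2 :> nat) * ((h u).2 = u.1.-1 :> nat).
  exists (fun u : 'I_n.+3 * 'I_n.+2 => (inord u.2, inord u.1.-1)) => u.
  by have [? ?] := (ltn_ord u.1, ltn_ord u.2); split; rewrite /= inordK//; lia.
have [h' h'E] : exists h' : 'I_n.+3 * 'I_n.+2 -> 'I_n.+3 * 'I_n.+2, forall u,
    ((h' u).1 = u.2.+1 :> nat) * ((u.1 <= u.2)%N -> (h' u).2 = u.1 :> nat).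
  exists (fun u : 'I_n.+3 * 'I_n.+2 => (inord u.2.+1, inord u.1)) => u.
  have [? ?] := (ltn_ord u.1, ltn_ord u.2).
  by split=> [|?]; rewrite /= inordK//; lia.
have ord_pairE (u v : 'I_n.+3 * 'I_n.+2) :
    u = v <-> u.1 = v.1 :> nat /\ u.2 = v.2 :> nat.
  split=> [->//|]; case: u v => [i j] [i' j'] /= [/val_inj -> /val_inj ->] //.
rewrite (reindex_onto h h') => [|u]; last first.
  rewrite -leqNgt => u12; apply/ord_pairE.
  by rewrite !hE !h'E.
apply: eq_big => [u|u].
  rewrite -leqNgt !hE; apply/idP/idP => [/andP[u12 /eqP/ord_pairE]|u12].
    by rewrite h'E !hE; lia.
  apply/andP; split; first lia.
  by apply/eqP/ord_pairE; rewrite !h'E !hE; lia.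
rewrite -leqNgt => /andP[u12 /eqP/ord_pairE[]].
rewrite h'E hE => u1 _; rewrite !hE in u12 *.
rewrite /F -mulNr; congr (_ * f (restrict _ s)).
  by rewrite !hE -[in RHS]u1 addSn addnC exprS mulN1r opprK.
apply/funext => k; apply: val_inj; rewrite /= /bump !hE/=; lia.
Qed.

Definition singular_complex : cochain_complex C :=
  @CochainComplex C singular_cochain (fun n => @singular_coboundary n)
    (fun n f => singular_coboundaryK f).

Fact front_val p q (i : 'I_p.+1) : front q i = i :> nat.
Proof. by rewrite /front inordK//; have := ltn_ord i; lia. Qed.

Fact back_val p q (i : 'I_q.+1) : back p i = (p + i)%N :> nat.
Proof. by rewrite /back inordK//; have := ltn_ord i; lia. Qed.

Fact cup_linearr p q (f : singular_cochain p) : linear (@cup p q f).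
Proof.
move=> a g g'; apply/funext => s; rewrite /cup !fctE mulrDr.
by rewrite -scalerAr.
Qed.

Fact cup0l p q (g : singular_cochain q) : cup (0 : singular_cochain p) g = 0.
Proof. by apply/funext => s; exact: mul0r. Qed.

Fact cup0r p q (f : singular_cochain p) : cup f (0 : singular_cochain q) = 0.
Proof. by apply/funext => s; exact: mulr0. Qed.

Fact cupBB p q (f f' : singular_cochain p) (g g' : singular_cochain q) :
  cup f' g' - cup f g = 1 *: cup (f' - f) g' + cup f (g' - g).
Proof.
rewrite scale1r; apply/funext => s; rewrite /cup !fctE .
by rewrite mulrBl mulrBr addrA subrK.
Qed.

Local Ltac face :=
  apply/funext => -[? ?]; apply: val_inj; rewrite /= /bump/=;
  rewrite ?(front_val (p := 0)) ?(front_val (p := 1)) ?(front_val (p := 2));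
  rewrite ?(back_val 0) ?(back_val 1) ?(back_val 2) /= /bump/=;
  rewrite ?(front_val (p := 0)) ?(front_val (p := 1)) ?(front_val (p := 2));
  rewrite ?(back_val 0) ?(back_val 1) ?(back_val 2) /=;
  lia.

Fact cupA1 n (f g : singular_cochain 1) (h : singular_cochain n) :
  (cup f (cup g h : singular_cochain n.+1) : singular_cochain n.+2) =
  (cup (cup f g : singular_cochain 2) h : singular_cochain n.+2).
Proof.
apply/funext => s; rewrite /cup !restrict_comp mulrA.
have -> : @front 2 n \o @front 1 1 = @front 1 n.+1 by face.
have -> : @front 2 n \o @back 1 1 = @back 1 n.+1 \o @front 1 n by face.
by have -> : @back 1 n.+1 \o @back 1 n = @back 2 n by face.
Qed.

Fact cup_sqr (f : singular_cochain 1) : singular_coboundary f = 0 ->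
  (cup f f : singular_cochain 2) =
  singular_coboundary (fun s => - (2%:R^-1) * f s ^+ 2).
Proof.
move=> df; apply/funext => s; have := congr1 (fun g => g s) df.
rewrite /cup /singular_coboundary !big_ord_recl !big_ord0.
have -> : @front 1 1 = lift (lift ord0 (lift ord0 ord0)) by face.
have -> : @back 1 1 = lift ord0 by face.
move: (f (restrict (lift ord0) s) : C) => a.
move: (f (restrict (lift (lift ord0 ord0)) s) : C) => b.
move: (f (restrict (lift (lift ord0 (lift ord0 ord0))) s) : C) => c abc.
have {abc}-> : b = a + c.
  apply/eqP; rewrite -subr_eq0 -oppr_eq0; apply/eqP; rewrite -[RHS]abc.
  by rewrite /= /bump/=; ring.
by rewrite /= /bump/=; field.
Qed.

Fact cup_coboundary0 n (f : singular_cochain 0) (g : singular_cochain n) :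
  singular_coboundary (cup f g : singular_cochain n) =
  (cup (singular_coboundary f) g : singular_cochain n.+1) +
  (cup f (singular_coboundary g) : singular_cochain n.+1).
Proof.
apply/funext => s; rewrite !fctE /cup /singular_coboundary.
rewrite mulr_suml mulr_sumr big_ord_recl [in RHS]big_ord_recl.
rewrite [X in _ = _ + X + _]big_ord_recl big_ord0 [X in _ = _ + X]big_ord_recl.
rewrite /= !expr0 !expr1 !mul1r !addr0 !restrict_comp.
have -> : lift ord0 \o @front 0 n = @front 1 n \o lift ord0 by face.
have -> : lift ord0 \o @back 0 n = @back 1 n by face.
have -> : @front 1 n \o lift (lift ord0 ord0) = @front 0 n.+1 by face.
have -> : @back 0 n.+1 \o lift ord0 = @back 1 n by face.
rewrite mulN1r mulNr addrA subrK; congr (_ + _).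
apply: eq_bigr => i _; rewrite !restrict_comp mulrCA.
have -> : lift (lift ord0 i) \o @front 0 n = @front 0 n.+1 by face.
by have -> : lift (lift ord0 i) \o @back 0 n = @back 0 n.+1 \o lift (lift ord0 i)
  by face.
Qed.

Fact cup_coboundary1 n (f : singular_cochain 1) (g : singular_cochain n) :
  singular_coboundary (cup f g : singular_cochain n.+1) =
  (cup (singular_coboundary f) g : singular_cochain n.+2) -
  (cup f (singular_coboundary g) : singular_cochain n.+2).
Proof.
apply/funext => s; rewrite !fctE /cup /singular_coboundary.
rewrite 2!big_ord_recl [in RHS]big_ord_recl [X in _ = (_ + X) * _ - _]big_ord_recl.
rewrite [X in _ = (_ + (_ + X)) * _ - _]big_ord_recl big_ord0.
rewrite [X in _ = _ - _ * X]big_ord_recl.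
rewrite /= /bump/= !expr0 !expr1 -signr_odd/= expr0 !mul1r !addr0 !restrict_comp.
have -> : lift ord0 \o @front 1 n = @front 2 n \o lift ord0 by face.
have -> : lift ord0 \o @back 1 n = @back 2 n by face.
have -> : lift (lift ord0 ord0) \o @front 1 n = @front 2 n \o lift (lift ord0 ord0).
  by face.
have -> : lift (lift ord0 ord0) \o @back 1 n = @back 2 n by face.
have -> : @front 2 n \o lift (lift ord0 (lift ord0 ord0)) = @front 1 n.+1 by face.
have -> : @back 1 n.+1 \o lift ord0 = @back 2 n by face.
rewrite mulrDl mulrDl mulrDr opprD !mulN1r !mulNr -!addrA; congr (_ + (_ + _)).
rewrite addrA subrr add0r mulr_sumr -sumrN; apply: eq_bigr => i _.
rewrite !restrict_comp.
have -> : lift (lift ord0 (lift ord0 i)) \o @front 1 n = @front 1 n.+1 by face.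
have -> : lift (lift ord0 (lift ord0 i)) \o @back 1 n =
    @back 1 n.+1 \o lift (lift ord0 i) by face.
by rewrite !add1n exprS mulN1r mulNr [in RHS]mulrCA.
Qed.

End SingularCochains.

Section LeftMultiplication.
Variables (R : realType) (X : topologicalType).
Local Notation E := (singular_complex R X).

Definition singular_cohomology n : lmodType R[i] := cohomology E n.
Local Notation H := singular_cohomology.

Fact cup_cocycle n (z : cocycle E 1) (x : cocycle E n) :
  (cup (val z) (val x) : E n.+1) \in @is_cocycle R[i] E n.+1.
Proof.
rewrite unfold_in /=; apply/eqP.
have /eqP /= dz := valP z; have /eqP /= dx := valP x.
by rewrite cup_coboundary1 dz dx cup0l cup0r subr0.
Qed.

Definition cocycle_cup n (z : cocycle E 1) (x : cocycle E n) : cocycle E n.+1 :=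
  exist _ (cup (val z) (val x) : E n.+1) (cup_cocycle z x).

(* Left multiplication by a class of degree 1 in the cohomology ring; it is
   independent of the chosen cocycles by [left_mulE]. Note that 1 + n and n.+1
   are convertible. *)
Definition left_mul n (z : H 1) (x : H n) : H n.+1 :=
  cocycle_class (cocycle_cup (cocycle_repr z) (cocycle_repr x)).

Lemma left_mulE n (z : cocycle E 1) (x : cocycle E n) :
  left_mul (cocycle_class z) (cocycle_class x) = cocycle_class (cocycle_cup z x).
Proof.
rewrite /left_mul.
have /cocycle_classP := cocycle_reprK (cocycle_class z).
have /cocycle_classP := cocycle_reprK (cocycle_class x).
move: (cocycle_repr _) (cocycle_repr _) => z' x' bx bz.
apply/cocycle_classP.
have [h hz] : exists h : E 0, coboundary E 0 h = val z' - val z.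
  by case: bz => h _ <-; exists h.
have -> : val (cocycle_cup z' x') - val (cocycle_cup z x) =
    1 *: (cup (val z' - val z) (val x') : E n.+1) + cup (val z) (val x' - val x).
  exact: (@cupBB R X 1 n (val z) (val z') (val x) (val x')).
apply: (@coboundaries_lin _ E n.+1).
  exists (cup h (val x') : E n) => //=; rewrite cup_coboundary0 -hz.
  by have /eqP /= -> := valP x'; rewrite cup0r addr0.
have /eqP /= dz := valP z.
case: (n) x x' bx => [|m] x x' bx.
  by rewrite bx cup0r; exists 0 => //; rewrite linear0.
case: bx => y _ <-; exists (- (cup (val z) y : E m.+1)) => //.
by rewrite linearN/= cup_coboundary1 dz cup0l sub0r opprK.
Qed.

Fact left_mul_linear n (z : H 1) : linear (@left_mul n z).
Proof.
move=> a x y; rewrite -[z]cocycle_reprK -[x]cocycle_reprK -[y]cocycle_reprK.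
rewrite -linearP !left_mulE -linearP.
move: (cocycle_repr z) (cocycle_repr x) (cocycle_repr y) => z' x' y'.
congr cocycle_class; apply: val_inj.
exact: (cup_linearr (val z') a (val x') (val y')).
Qed.

HB.instance Definition _ n z := GRing.isLinear.Build R[i] (H n) (H n.+1) *:%R
  (@left_mul n z) (@left_mul_linear n z).

Fact left_mulK (z : H 1) n (x : H n) : left_mul z (left_mul z x) = 0.
Proof.
rewrite -[z]cocycle_reprK -[x]cocycle_reprK.
move: (cocycle_repr z) (cocycle_repr x) => {}z {}x.
rewrite (left_mulE z x) left_mulE.
rewrite -(linear0 (@cocycle_class _ E _)).
apply/cocycle_classP; rewrite subr0 /=.
have /eqP /= dz := valP z; have /eqP /= dx := valP x.
pose h : singular_cochain R X 1 := fun s => - (2%:R^-1) * val z s ^+ 2.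
exists (cup h (val x) : E n.+1) => //=.
by rewrite cup_coboundary1 dx cup0r subr0 -cup_sqr// cupA1.
Qed.

Definition left_mul_complex (z : H 1) : cochain_complex R[i] :=
  @CochainComplex R[i] H (fun n => @left_mul n z) (left_mulK z).

End LeftMultiplication.

(* The dimension of V, possibly infinite, is at least k. *)
Definition dim_ge (K : fieldType) (V : lmodType K) (k : nat) : Prop :=
  exists v : 'I_k -> V,
    forall a : 'I_k -> K, \sum_i a i *: v i = 0 -> forall i, a i = 0.

Definition resonance (R : realType) (X : topologicalType) (i k : nat) :
    set (singular_cohomology R X 1) :=
  [set z | dim_ge (cohomology (left_mul_complex z) i : lmodType _) k].

Section CWComplexes.
Variable R : realType.

Definition closed_disk n : set 'rV[R]_n :=
  [set x | \sum_i x ord0 i ^+ 2 <= 1].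
Definition open_disk n : set 'rV[R]_n :=
  [set x | \sum_i x ord0 i ^+ 2 < 1].
Definition sphere n : set 'rV[R]_n :=
  [set x | \sum_i x ord0 i ^+ 2 = 1].

(* Cell decompositions in the sense of J.H.C. Whitehead: closure-finite, with
   the weak topology. The values of [char_map e] off the closed disk are
   irrelevant. *)
Record cw_structure (X : topologicalType) := CWStructure {
  cell : nat -> Type;
  char_map : forall n, cell n -> 'rV[R]_n -> X;
  cw_hausdorff : hausdorff_space X;
  char_map_continuous : forall n (e : cell n),
    {within closed_disk (n := n), continuous (char_map e)};
  char_map_homeo : forall n (e : cell n), exists g : X -> 'rV[R]_n,
    {within char_map e @` open_disk (n := n), continuous g} /\
    {in open_disk (n := n), cancel (char_map e) g};
  cells_disjoint : forall n m (e : cell n) (e' : cell m),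
    char_map e @` open_disk (n := n) `&`
      char_map e' @` open_disk (n := m) !=set0 ->
    existT cell n e = existT cell m e';
  cells_cover : forall x, exists n (e : cell n),
    (char_map e @` open_disk (n := n)) x;
  closure_finite : forall n (e : cell n), exists F : set {m & cell m},
    [/\ finite_set F, forall c, F c -> (projT1 c < n)%N &
        char_map e @` sphere (n := n) `<=`
          \bigcup_(c in F) char_map (projT2 c) @` open_disk (n := projT1 c)];
  weak_topology : forall A : set X, closed A <->
    forall n (e : cell n), closed (closed_disk (n := n) `&` char_map e @^-1` A)
}.

Definition finite_1skeleton (X : topologicalType) (S : cw_structure X) : Prop :=
  finite_set [set: cell S 0] /\ finite_set [set: cell S 1].

End CWComplexes.

Definition connected_space (X : topologicalType) : Prop :=
  [set: X] !=set0 /\ connected [set: X].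

Section HomotopyGroups.
Variables (R : realType) (X : topologicalType) (x0 : X).

Definition cube n : set 'rV[R]_n := [set t | forall i, 0 <= t ord0 i <= 1].
Definition cube_boundary n : set 'rV[R]_n :=
  [set t | cube t /\ exists i, t ord0 i = 0 \/ t ord0 i = 1].

(* Representatives of elements of the n-th homotopy group: only the values of
   [f] on the cube matter. *)
Definition spheroid n (f : 'rV[R]_n -> X) : Prop :=
  {within cube (n := n), continuous f} /\
  forall t, cube_boundary t -> f t = x0.

Definition spheroid_homotopic n (f g : 'rV[R]_n -> X) : Prop :=
  exists H : R * 'rV[R]_n -> X,
    [/\ {within `[0, 1]%classic `*` cube (n := n), continuous H},
        forall t, cube t -> H (0, t) = f t /\ H (1, t) = g t &
        forall s t, 0 <= s <= 1 -> cube_boundary t -> H (s, t) = x0].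

Definition loop_concat (f g : 'rV[R]_1 -> X) (t : 'rV[R]_1) : X :=
  if t ord0 ord0 <= 2%:R^-1 then f (2%:R *: t) else g (2%:R *: t - const_mx 1).

(* [h] induces a group isomorphism from the fundamental group of (X, x0),
   i.e., loops modulo homotopy under concatenation, onto [G]. *)
Definition pi1_isomorphic (G : groupType) : Prop :=
  exists h : ('rV[R]_1 -> X) -> G,
    [/\ forall f g, spheroid f -> spheroid g ->
          (h f = h g <-> spheroid_homotopic f g),
        forall a, exists2 f, spheroid f & h f = a &
        forall f g, spheroid f -> spheroid g ->
          h (loop_concat f g) = (h f * h g)%g].

Definition pi_trivial n : Prop :=
  forall f : 'rV[R]_n -> X, spheroid f -> spheroid_homotopic f (cst x0).

End HomotopyGroups.

(* X is a K(G,1). *)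
Definition eilenberg_maclane1 (R : realType) (G : groupType)
    (X : topologicalType) : Prop :=
  [/\ inhabited (cw_structure R X), connected_space X &
      exists x0 : X, pi1_isomorphic R x0 G /\
        forall n, (2 <= n)%N -> pi_trivial R x0 n].

Section Groups.
Variable G : groupType.
Local Open Scope group_scope.

Definition is_subgroup (H : set G) : Prop :=
  H 1 /\ forall x y, H x -> H y -> H (x * y^-1).

Definition generated (A : set G) : set G :=
  [set x | forall H, is_subgroup H -> A `<=` H -> H x].

Definition finitely_generated : Prop :=
  exists2 A : set G, finite_set A & generated A = [set: G].

(* [lower_central j] is the j-th term of the lower central series, which starts
   with the whole group at j = 1. *)
Definition lower_central (j : nat) : set G :=
  iter j.-1 (fun H => generated [set [~ x, y] | x in [set: G] & y in H]) [set: G].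

Definition two_step_nilpotent : Prop := lower_central 3 = [set 1].

Definition torsion_free : Prop :=
  forall (x : G) (n : nat), (0 < n)%N -> x ^+ n = 1 -> x = 1.

End Groups.

Arguments singular_cohomology R X n : clear implicits.
Arguments resonance R X i k : clear implicits.

(* Main.v *)
(* The first resonance varieties of a path-connected space X only depend on H^1(X) and on the
   matrices A such that the cup product relation sum_ij A_ij x_i x_j vanishes in H^2(X), where
   (x_i) is a basis of H^1(X).  Symmetric matrices always give relations.

   On the CW complex M, a closed 1-cochain that vanishes on the finitely many edges is exact: its
   primitive is built cell by cell, and it is compared with the values of the cochain on arbitrary
   paths by means of a flow that pushes points radially outwards through the cells and deforms
   short paths into a single cell.  Hence H^1(M) is finite-dimensional, and Q-linear functionals on
   the complex numbers show that it has a basis of rational-valued cocycles, whose antisymmetric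
   relations are spanned by a family B of linearly independent integral matrices.

   Let G be the central extension of Z^n by Z^m with cocycle B.  As the matrices of B are
   independent, Hom(G, C) = C^n, and the bilinear 2-cocycle A on G is a coboundary exactly when the
   antisymmetric part of A is a combination of the matrices of B.  On a space N with fundamental
   group G, the holonomy map from paths to G identifies closed 1-cochains, up to exact ones, with
   Hom(G, C), and cup product relations on N with coboundaries on G. *)

From HB Require Import structures.
From mathcomp Require Import all_boot all_order all_algebra.
From mathcomp Require Import complex zify ring lra.
From mathcomp Require Import all_classical all_reals all_analysis.
Require Import Defs.

Set Implicit Arguments.
Unset Strict Implicit.
Unset Printing Implicit Defensive.

Import Order.TTheory GRing.Theory Num.Theory.
Import numFieldNormedType.Exports.

Local Open Scope classical_set_scope.
Local Open Scope ring_scope.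

(** * Affine singular simplices *)

(** In degree 1, resonance sees H^2 only through the vanishing of products of classes of degree 1,
    so G has to reproduce H^1 and the kernel of the cup product, nothing more. Commutators in G are
    given by the form 2B, so the relations must be encoded by antisymmetric matrices; the group law
    needs integral entries, whereas the relations of M are given over the complex numbers, and this
    is why a rational structure is needed. The topological obstacle is that a path in M may pass
    between cells infinitely often, so that it cannot be cut into finitely many pieces that each lie
    in a cell. For a closed cochain, though, the value on the initial part of a path is a function
    of the end parameter, and local information about this function suffices. Cochains are evaluated
    throughout on [seg F a b] and [tri F a b c], the images of affine simplices of a normed space
    under one continuous map [F]: all singular simplices of dimension 1 and 2 have this form, and
    coboundaries and cup products become formulas in the vertices. *)

Section ContinuousMaps.
Context {T U : topologicalType}.

Definition continuous_map (f : T -> U) (cf : continuous f) : continuousType T U :=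
  HB.pack_for (continuousType T U) f (isContinuous.Build T U f cf).

End ContinuousMaps.

Section AffineSimplices.
Variables (R : realType) (X : topologicalType).

Section Def.
Variable V : normedModType R.

Definition affine_simplex_fun n (F : V -> X) (a : 'I_n.+1 -> V)
  (t : set_type (std_simplex R n)) : X := F (\sum_i set_val t ord0 i *: a i).

Fact affine_simplex_continuous n (F : continuousType V X) (a : 'I_n.+1 -> V) :
  continuous (affine_simplex_fun F a).
Proof.
move=> t; have FF : Filter (nbhs t) := nbhs_filter t.
apply: (@continuous_comp _ _ _
  (fun t : set_type (std_simplex R n) => \sum_i set_val t ord0 i *: a i) F).
  apply: cvg_big => [|i _]; first exact: add_continuous.
  apply: cvgZr_tmp.
  apply: (@continuous_comp _ _ _ set_val (fun u : 'rV[R]_n.+1 => u ord0 i)).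
    exact: initial_continuous.
  exact: coord_continuous.
exact: cts_fun.
Qed.

(** Since [F] is kept apart from the vertices, taking a face is a mere relabelling of the vertices,
    as [restrict_affine] shows. *)
Definition affine_simplex n (F : continuousType V X) (a : 'I_n.+1 -> V) :
  singular_simplex R X n := continuous_map (@affine_simplex_continuous n F a).

Lemma restrict_affine m n (theta : 'I_m.+1 -> 'I_n.+1) (F : continuousType V X)
    (a : 'I_n.+1 -> V) :
  restrict theta (affine_simplex F a) = affine_simplex F (a \o theta).
Proof.
apply/continuousEP => t /=; rewrite /affine_simplex_fun; congr (F _).
rewrite [RHS](partition_big theta xpredT)//=.
apply: eq_bigr => j _; rewrite mxE scaler_suml.
by apply: eq_bigr => i /eqP ->.
Qed.

End Def.

Lemma eq_affine_simplex (V W : normedModType R) n (F : continuousType V X)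
    (G : continuousType W X) (a : 'I_n.+1 -> V) (b : 'I_n.+1 -> W) :
  (forall t : 'I_n.+1 -> R, (forall i, 0 <= t i) -> \sum_i t i = 1 ->
     F (\sum_i t i *: a i) = G (\sum_i t i *: b i)) ->
  affine_simplex F a = affine_simplex G b.
Proof.
move=> FG; apply/continuousEP => t; have [t0 t1] := set_valP t.
exact: (FG (fun i => set_val t ord0 i)).
Qed.

End AffineSimplices.

Lemma cvg_rV (R : realType) (T : topologicalType) n (f : T -> 'rV[R]_n) (x : T) :
  (forall j, f y ord0 j @[y --> x] --> f x ord0 j) -> {for x, continuous f}.
Proof.
move=> cf; have FF : Filter (nbhs x) := nbhs_filter x.
apply/cvg_ballP => e e0.
have : \forall y \near x, forall j, ball (f x ord0 j) e (f y ord0 j).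
  apply: (@filter_forall _ _ (fun j y => ball (f x ord0 j) e (f y ord0 j)) _ FF).
  by move=> j; have /cvg_ballP := cf j; exact.
by apply: filterS => y xy; split=> // i j; rewrite (ord1 i); exact: xy.
Qed.

(** * Simplices of dimension 1 and 2 as segments and triangles *)

Section Edges.
Variables (R : realType) (X : topologicalType).
Local Notation C := R[i].

Definition seg (V : normedModType R) (F : continuousType V X) (a b : V) :
    singular_simplex R X 1 :=
  affine_simplex F (fun i : 'I_2 => if val i == 0%N then a else b).

Definition tri (V : normedModType R) (F : continuousType V X) (a b c : V) :
    singular_simplex R X 2 :=
  affine_simplex F
    (fun i : 'I_3 => if val i == 0%N then a else if val i == 1%N then b else c).

Lemma coboundary_tri (V : normedModType R) (F : continuousType V X)
    (h : singular_cochain R X 1) (a b c : V) :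
  singular_coboundary h (tri F a b c) =
  h (seg F b c) - h (seg F a c) + h (seg F a b).
Proof.
rewrite /singular_coboundary !big_ord_recl big_ord0 /= /bump /= !restrict_affine.
rewrite expr0 expr1 expr2 mulN1r mulrN1 opprK !mul1r addr0 addrA.
congr (h _ - h _ + h _); congr affine_simplex; apply/funext => -[[|[|//]] ?] //=.
Qed.

Lemma cup_tri (V : normedModType R) (F : continuousType V X)
    (f g : singular_cochain R X 1) (a b c : V) :
  cup f g (tri F a b c) = f (seg F a b) * g (seg F b c).
Proof.
rewrite /cup !restrict_affine; congr (f _ * g _); congr affine_simplex.
  by apply/funext => -[[|[|//]] ?] /=; rewrite (front_val (p := 1)).
by apply/funext => -[[|[|//]] ?] /=; rewrite (back_val 1).
Qed.

Lemma eq_seg (V W : normedModType R) (F : continuousType V X)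
    (G : continuousType W X) a b a' b' :
  (forall t, 0 <= t <= 1 ->
    F ((1 - t) *: a + t *: b) = G ((1 - t) *: a' + t *: b')) ->
  seg F a b = seg G a' b'.
Proof.
move=> FG; apply: eq_affine_simplex => t t0.
rewrite !big_ord_recl !big_ord0 /= !addr0 => t1.
move: (t0 ord0) (t0 (lift ord0 ord0)) t1.
move: (t ord0) (t (lift ord0 ord0)) => x y x0 y0 xy.
have -> : x = 1 - y by lra.
by apply: FG; lra.
Qed.

Fact simplex1_ret_proof (x : R) :
  (\row_(i < 2) (if val i == 0%N then 1 - Num.max 0 (Num.min 1 x)
    else Num.max 0 (Num.min 1 x))) \in std_simplex R 1.
Proof.
apply/mem_set; split=> [i|]; rewrite ?big_ord_recl ?big_ord0 !mxE /=; last first.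
  by rewrite addr0 subrK.
have: 0 <= Num.max 0 (Num.min 1 x) <= 1.
  by rewrite le_max lexx /= ge_max ler01 ge_min lexx.
by case: ifP => _; lra.
Qed.

Definition simplex1_ret (x : R) : set_type (std_simplex R 1) :=
  exist (fun t => t \in std_simplex R 1) _ (simplex1_ret_proof x).

(** These are the barycentric coordinates of (x', y') in the triangle 0 <= y <= x <= 1 with vertices
    (0, 0), (1, 0), (1, 1). Clamping x first and then y retracts the plane onto this triangle. *)
Fact simplex2_ret_proof (x y : R) :
  let x' := Num.max 0 (Num.min 1 x) in
  let y' := Num.max 0 (Num.min x' y) in
  (\row_(i < 3) (if val i == 0%N then 1 - x' else if val i == 1%N then x' - y'
    else y')) \in std_simplex R 2.
Proof.
cbv zeta; set x' := Num.max 0 (Num.min 1 x); set y' := Num.max 0 (Num.min x' y).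
have x'01 : 0 <= x' <= 1.
  by rewrite le_max lexx /= ge_max ler01 ge_min lexx.
have y'0 : 0 <= y' <= x'.
  by rewrite le_max lexx /= ge_max ge_min lexx; lra.
apply: mem_set; split=> [i|]; rewrite ?big_ord_recl ?big_ord0 !mxE /=; last first.
  by lra.
by do 2?case: ifP => _; lra.
Qed.

Definition simplex2_ret (u : R * R) : set_type (std_simplex R 2) :=
  exist (fun t => t \in std_simplex R 2) _ (simplex2_ret_proof u.1 u.2).

Let clamp_continuous (T : topologicalType) (f g : T -> R^o) (x : T) :
  {for x, continuous f} -> {for x, continuous g} ->
  {for x, continuous (fun y => Num.max 0 (Num.min (f y) (g y)) : R^o)}.
Proof.
move=> cf cg; have FF : Filter (nbhs x) := nbhs_filter x.
apply: (@continuous_max _ _ (fun=> 0)); first exact: cst_continuous.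
exact: continuous_min.
Qed.

Lemma simplex1_ret_continuous : continuous (simplex1_ret : R^o -> _).
Proof.
apply: continuous_comp_initial => x.
have cx : {for x, continuous (fun y : R^o => Num.max 0 (Num.min 1 y) : R^o)}.
  by apply: clamp_continuous; [exact: cst_continuous|exact: cvg_id].
have c1 := continuousB (@cst_continuous _ R^o 1 x) cx.
apply: (@cvg_rV R) => j /=; rewrite mxE; under eq_cvg do rewrite /= mxE.
by case: ifP => _; [exact: c1|exact: cx].
Qed.

Lemma simplex2_ret_continuous : continuous (simplex2_ret : R^o * R^o -> _).
Proof.
apply: continuous_comp_initial => x.
have c1 : {for x, continuous (fst : R^o * R^o -> R^o)} by exact: cvg_fst.
have c2 : {for x, continuous (snd : R^o * R^o -> R^o)} by exact: cvg_snd.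
have cx : {for x, continuous (fun y : R^o * R^o => Num.max 0 (Num.min 1 y.1) : R^o)}.
  by apply: clamp_continuous => //; exact: cst_continuous.
have cy := clamp_continuous cx c2.
have c3 := continuousB (@cst_continuous _ R^o 1 x) cx.
have c4 := continuousB cx cy.
apply: (@cvg_rV R) => j /=; rewrite mxE; under eq_cvg do rewrite /= mxE.
case: ifP => _; first exact: c3.
by case: ifP => _; [exact: c4|exact: cy].
Qed.

(** The retraction onto the simplex yields a map on the whole line, so that no continuity on a
    subset has to be handled; [tri_map] does the same on the plane. By [seg_pathE] and [tri_mapE],
    identities of cochains need checking on segments and triangles only. *)
Definition seg_path (s : singular_simplex R X 1) : continuousType R^o X :=
  s \o continuous_map simplex1_ret_continuous.

Definition tri_map (s : singular_simplex R X 2) : continuousType (R^o * R^o)%type X :=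
  s \o continuous_map simplex2_ret_continuous.

Lemma seg_pathE s : seg (seg_path s) 0 1 = s.
Proof.
apply/continuousEP => t; have [t0 t1] := set_valP t.
rewrite /= /affine_simplex_fun /=; congr (s _); apply: val_inj => /=.
apply/rowP => i; rewrite !mxE; move: t1; rewrite !big_ord_recl !big_ord0 /=.
move: (t0 ord0) (t0 (lift ord0 ord0)); rewrite !addr0 scaler0 add0r.
rewrite -[_ *: 1]/(_ * 1) mulr1 => u0 u1 t1.
rewrite min_r ?max_r//; last lra.
case: i => [[|[|//]] ?]; rewrite /=; [rewrite -t1 addrK|]; congr (set_val t _ _);
  exact: val_inj.
Qed.

Lemma tri_mapE s : tri (tri_map s) (0, 0) (1, 0) (1, 1) = s.
Proof.
apply/continuousEP => t; have [t0 t1] := set_valP t.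
rewrite /= /affine_simplex_fun /=; congr (s _); apply: val_inj => /=.
move: t1; rewrite !big_ord_recl !big_ord0 /=.
move: (t0 ord0) (t0 (lift ord0 ord0)) (t0 (lift ord0 (lift ord0 ord0))).
rewrite !addr0 /= => u0 u1 u2 t1.
rewrite !scaler0 !add0r -![_ *: 1]/(_ * 1) !mulr1.
rewrite (@min_r _ R 1); last lra.
rewrite (@max_r _ R 0 (_ + _)); last lra.
rewrite (@min_r _ R (_ + _)); last lra.
rewrite (@max_r _ R 0) //.
apply/rowP => i; rewrite !mxE.
case: i => [[|[|[|//]]] ?]; rewrite /= ?addrK -?t1 ?addrK;
  congr (set_val t _ _); exact: val_inj.
Qed.

End Edges.

(** * Closed cochains along paths *)

Section Cocycles.
Variables (R : realType) (X : topologicalType).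
Local Notation C := R[i].
Local Notation cochain := (singular_cochain R X).

Definition const_seg (x : X) : singular_simplex R X 1 :=
  seg (cst x : continuousType R^o X) 0 0.

Lemma seg_const (V : normedModType R) (F : continuousType V X) a b :
  (forall t, 0 <= t <= 1 -> F ((1 - t) *: a + t *: b) = F a) ->
  seg F a b = const_seg (F a).
Proof. by move=> Fa; apply: (@eq_seg _ _ _ R^o) => t /Fa ->. Qed.

Lemma seg_refl (V : normedModType R) (F : continuousType V X) a :
  seg F a a = const_seg (F a).
Proof. by apply: seg_const => t _; rewrite -scalerDl subrK scale1r. Qed.

(* Holds for closed cochains and for primitives of cup products of closed cochains. *)
Definition normalized (h : cochain 1) :=
  forall (V : normedModType R) (F : continuousType V X) a b c,
    (seg F a b = const_seg (F a)) \/ (seg F b c = const_seg (F b)) ->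
    singular_coboundary h (tri F a b c) = 0.

Lemma normalized_const h x : normalized h -> h (const_seg x) = 0.
Proof.
move=> /(_ R^o (cst x) 0 0 0); rewrite coboundary_tri !seg_refl subrr add0r.
by apply; left.
Qed.

Lemma closed_normalized f : singular_coboundary f = 0 -> normalized f.
Proof. by move=> df V F a b c _; rewrite df. Qed.

Lemma closed_seg f (V : normedModType R) (F : continuousType V X) a b c :
  singular_coboundary f = 0 ->
  f (seg F a b) + f (seg F b c) = f (seg F a c).
Proof.
move=> df; have := coboundary_tri F f a b c; rewrite df => /esym/eqP.
by rewrite addrAC subr_eq0 addrC => /eqP.
Qed.

Lemma closedP f :
  singular_coboundary f = 0 <->
  forall (F : continuousType (R^o * R^o)%type X) a b c,
    f (seg F a b) + f (seg F b c) = f (seg F a c).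
Proof.
split=> [df *|fF]; first exact: closed_seg.
apply/funext => s; rewrite -(tri_mapE s) coboundary_tri.
by rewrite -[X in _ - X](fF _ _ (1, 0)) opprD addrCA subrr addr0 addNr.
Qed.

Definition path_homotopic (p q : continuousType R^o X) :=
  exists K : continuousType (R^o * R^o)%type X,
    (forall t, 0 <= t <= 1 -> K (0, t) = p t /\ K (1, t) = q t) /\
    (forall s, 0 <= s <= 1 -> K (s, 0) = p 0 /\ K (s, 1) = p 1).

(** The diagonal cuts the square of the homotopy into two triangles, each of which has a constant
    side because the ends are fixed. So [normalized] is enough, and the lemma also covers primitives
    of cup products, which are not closed. *)
Lemma homotopic_seg h p q : normalized h -> path_homotopic p q ->
  h (seg p 0 1) = h (seg q 0 1).
Proof.
move=> nh [K [Kt Ks]].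
have Kp : seg K (0, 0) (0, 1) = seg p 0 1.
  apply: eq_seg => t t01; rewrite !scaler0 !add0r -[RHS](Kt _ _).1 //.
    by congr (K (_, _)); rewrite /= ?scaler0 ?addr0.
  by rewrite -[_ *: 1]/(_ * 1) mulr1.
have Kq : seg K (1, 0) (1, 1) = seg q 0 1.
  apply: eq_seg => t t01; rewrite !scaler0 !add0r -[RHS](Kt _ _).2 //.
    by congr (K (_, _)); rewrite /= ?scaler0 ?add0r // -!scalerDl addrNK scale1r.
  by rewrite -[_ *: 1]/(_ * 1) mulr1.
have K0 : seg K (0, 0) (1, 0) = const_seg (K (0, 0)).
  apply: seg_const => t t01; rewrite (Ks 0 _).1 ?lexx ?ler01// -(Ks t t01).1.
  by congr (K (_, _)); rewrite /= !scaler0 ?add0r //; exact: mulr1.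
have K1 : seg K (0, 1) (1, 1) = const_seg (K (0, 1)).
  apply: seg_const => t t01; rewrite (Ks 0 _).2 ?lexx ?ler01// -(Ks t t01).2.
  congr (K (_, _)); rewrite /= ?scaler0 ?add0r; first exact: mulr1.
  by rewrite -!scalerDl addrNK; exact: mulr1.
have := nh _ K (0, 0) (1, 0) (1, 1) (or_introl K0).
have := nh _ K (0, 0) (0, 1) (1, 1) (or_intror K1).
rewrite !coboundary_tri K0 K1 Kp Kq !normalized_const// addr0 sub0r addrC => /eqP.
by rewrite subr_eq0 => /eqP -> /eqP; rewrite subr_eq0 => /eqP.
Qed.

Lemma line_homotopy (V : normedModType R) (F : continuousType V X)
    (c c' : continuousType R^o V) :
  c 0 = c' 0 -> c 1 = c' 1 -> path_homotopic (F \o c) (F \o c').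
Proof.
move=> c0 c1.
have cK : continuous (fun u : R^o * R^o => (1 - u.1) *: c u.2 + u.1 *: c' u.2 : V).
  move=> u; have u1 : {for u, continuous (fst : R^o * R^o -> R^o)} by exact: cvg_fst.
  have u2 : {for u, continuous (snd : R^o * R^o -> R^o)} by exact: cvg_snd.
  have cu (d : continuousType R^o V) : {for u, continuous (fun u => d u.2 : V)}.
    by apply: (continuous_comp u2); exact: cts_fun.
  apply: cvgD; apply: cvgZ; [|exact: cu|exact: u1|exact: cu].
  exact: (continuousB (@cst_continuous _ R^o 1 u) u1).
exists (F \o continuous_map cK); split=> t t01 /=.
  by rewrite subrr !scale0r scale1r subr0 scale1r addr0 add0r.
by rewrite -c0 -c1 -!scalerDl addrNK !scale1r.
Qed.

Definition line_map (V : normedModType R) (a b : V) (t : R^o) : V :=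
  (1 - t) *: a + t *: b.

Lemma line_map_continuous (V : normedModType R) (a b : V) : continuous (line_map a b).
Proof.
move=> t; apply: cvgD; apply: cvgZr_tmp; last exact: cvg_id.
exact: (continuousB (@cst_continuous _ R^o 1 t) cvg_id).
Qed.

(** In a normed space, [c] is homotopic to the straight segment between its ends. *)
Lemma closed_path f (V : normedModType R) (F : continuousType V X)
    (c : continuousType R^o V) : singular_coboundary f = 0 ->
  f (seg (F \o c) 0 1) = f (seg F (c 0) (c 1)).
Proof.
move=> df; rewrite (homotopic_seg (closed_normalized df) (@line_homotopy _ F c
  (continuous_map (@line_map_continuous V (c 0) (c 1))) _ _)).
- congr (f _); apply: eq_seg => t _; rewrite scaler0 add0r /= /line_map.
  by rewrite -[_ *: 1]/(_ * 1) mulr1.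
- by rewrite /= /line_map subr0 scale1r scale0r addr0.
- by rewrite /= /line_map subrr scale1r scale0r add0r.
Qed.

Definition point (x : X) : singular_simplex R X 0 := cst x.

Lemma coboundary_seg (g : cochain 0) (V : normedModType R) (F : continuousType V X)
    a b : singular_coboundary g (seg F a b) = g (point (F b)) - g (point (F a)).
Proof.
rewrite /singular_coboundary !big_ord_recl big_ord0 /= expr0 expr1 mulN1r mul1r addr0.
have pt (b' : 'I_1 -> V) : affine_simplex F b' = point (F (b' ord0)).
  apply/continuousEP => t; have [t0 t1] := set_valP t.
  rewrite /= /affine_simplex_fun; move: t1; rewrite !big_ord_recl !big_ord0 /= !addr0.
  by move=> ->; rewrite scale1r.
by rewrite !restrict_affine !pt.
Qed.

Fact vertex0_proof : (\row_(i < 1) 1 : 'rV[R]_1) \in std_simplex R 0.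
Proof. by apply: mem_set; split=> [i|]; rewrite ?big_ord_recl ?big_ord0 mxE ?addr0. Qed.

Definition vertex0 : set_type (std_simplex R 0) :=
  exist (fun t => t \in std_simplex R 0) _ vertex0_proof.

Lemma pointE (s : singular_simplex R X 0) : point (s vertex0) = s.
Proof.
apply/continuousEP => t /=; congr (s _); apply: val_inj; apply/rowP => i.
have [t0] := set_valP t; rewrite /= !big_ord_recl !big_ord0 mxE addr0 => <-.
by rewrite (ord1 i).
Qed.

Definition cochain0 (u : X -> C) : cochain 0 := fun s => u (s vertex0).

Lemma coboundary_cochain0 (u : X -> C) (V : normedModType R) (F : continuousType V X) a b :
  singular_coboundary (cochain0 u) (seg F a b) = u (F b) - u (F a).
Proof. by rewrite coboundary_seg. Qed.

Lemma cochain0P (g : cochain 0) : g = cochain0 (g \o point).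
Proof. by apply/funext => s; rewrite /cochain0 /= pointE. Qed.

Lemma exactP (f : cochain 1) (u : X -> C) :
  (forall p : continuousType R^o X, f (seg p 0 1) = u (p 1) - u (p 0)) ->
  singular_coboundary (cochain0 u) = f.
Proof.
by move=> fu; apply/funext => s; rewrite -(seg_pathE s) fu coboundary_cochain0.
Qed.

End Cocycles.

(** * Euclidean disks *)

Section Euclidean.
Variable R : realType.

Definition enorm n (p : 'rV[R]_n) : R := Num.sqrt (\sum_i p ord0 i ^+ 2).

Lemma enorm_ge0 n (p : 'rV[R]_n) : 0 <= enorm p.
Proof. exact: sqrtr_ge0. Qed.

Let sumsq_ge0 n (p : 'rV[R]_n) : 0 <= \sum_i p ord0 i ^+ 2.
Proof. by apply: sumr_ge0 => i _; exact: sqr_ge0. Qed.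

Lemma closed_diskE n (p : 'rV[R]_n) : closed_disk p <-> enorm p <= 1.
Proof. by rewrite /closed_disk /enorm /= -{2}(@sqrtr1 R) ler_sqrt. Qed.

Lemma open_diskE n (p : 'rV[R]_n) : open_disk p <-> enorm p < 1.
Proof. by rewrite /open_disk /enorm /= -{2}(@sqrtr1 R) ltr_sqrt. Qed.

Lemma sphereE n (p : 'rV[R]_n) : sphere p <-> enorm p = 1.
Proof.
rewrite /sphere /enorm /=; split=> [->|p1]; first exact: sqrtr1.
by have := sqr_sqrtr (sumsq_ge0 p); rewrite p1 expr1n.
Qed.

Lemma enormZ n a (p : 'rV[R]_n) : enorm (a *: p) = `|a| * enorm p.
Proof.
rewrite /enorm -sqrtr_sqr -sqrtrM ?sqr_ge0// mulr_sumr; congr Num.sqrt.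
by apply: eq_bigr => i _; rewrite mxE exprMn.
Qed.

Lemma enorm_eq0 n (p : 'rV[R]_n) : (enorm p == 0) = (p == 0).
Proof.
apply/idP/eqP => [|->]; last first.
  by rewrite /enorm big1 ?sqrtr0// => i _; rewrite mxE expr0n.
rewrite sqrtr_eq0 => p0; apply/rowP => i; rewrite mxE; apply/eqP.
have : \sum_i p ord0 i ^+ 2 == 0 by rewrite eq_le p0 sumsq_ge0.
rewrite psumr_eq0 => [/allP/(_ i)|j _]; last exact: sqr_ge0.
by rewrite mem_index_enum sqrf_eq0; apply.
Qed.

Lemma enorm_continuous n : continuous (@enorm n : _ -> R^o).
Proof.
move=> p; have FF : Filter (nbhs p) := nbhs_filter p.
apply: (@continuous_comp _ _ _ (fun p : 'rV[R]_n => \sum_i p ord0 i ^+ 2 : R^o)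
  (@Num.sqrt R : R^o -> R^o)); last exact: sqrt_continuous.
rewrite /prop_for /continuous_at.
apply: cvg_big => [|i _]; first exact: add_continuous.
rewrite expr2; under eq_cvg do rewrite expr2.
apply: cvgM; exact: coord_continuous.
Qed.

Definition disk_ret n (p : 'rV[R]_n) : 'rV[R]_n := (Num.max 1 (enorm p))^-1 *: p.

Lemma disk_ret_id n (p : 'rV[R]_n) : enorm p <= 1 -> disk_ret p = p.
Proof. by move=> p1; rewrite /disk_ret max_l// invr1 scale1r. Qed.

Lemma enorm_disk_ret n (p : 'rV[R]_n) : enorm (disk_ret p) <= 1.
Proof.
have m0 : 0 < Num.max 1 (enorm p) by rewrite lt_max ltr01.
rewrite enormZ ger0_norm; last by rewrite invr_ge0 ltW.
rewrite mulrC ler_pdivrMr// mul1r.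
by rewrite le_max lexx orbT.
Qed.

Lemma disk_ret_continuous n : continuous (@disk_ret n).
Proof.
move=> p; have FF : Filter (nbhs p) := nbhs_filter p.
have cm : {for p, continuous (fun p => Num.max 1 (enorm p) : R^o)}.
  apply: (@continuous_max _ _ (fun=> 1)); first exact: cst_continuous.
  exact: enorm_continuous.
have cV : {for p, continuous (fun p => (Num.max 1 (enorm p))^-1 : R^o)}.
  by apply: (@cvgV R _ (nbhs p) FF _ _ _ cm); rewrite gt_eqF// lt_max ltr01.
exact: (cvgZ cV cvg_id).
Qed.

(* The value at [0] is an arbitrary unit vector. *)
Definition sphere_proj n (p : 'rV[R]_n) : 'rV[R]_n :=
  if p == 0 then \row_(i < n) (val i == 0%N)%:R else (enorm p)^-1 *: p.

Lemma enorm_e0 n : enorm (\row_(i < n.+1) (val i == 0%N)%:R : 'rV[R]_n.+1) = 1.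
Proof.
rewrite /enorm big_ord_recl big1 ?mxE /=; first by rewrite expr1n addr0 sqrtr1.
by move=> i _; rewrite mxE /= expr0n.
Qed.

Lemma enorm_sphere_proj n (p : 'rV[R]_n) : (0 < n)%N -> enorm (sphere_proj p) = 1.
Proof.
rewrite /sphere_proj; case: eqVneq => [_|p0 _]; last first.
  by rewrite enormZ normfV ger0_norm ?enorm_ge0// mulVf// enorm_eq0.
by case: n p => // n p _; exact: enorm_e0.
Qed.

Lemma sphere_proj_id n (p : 'rV[R]_n) : enorm p = 1 -> sphere_proj p = p.
Proof.
move=> p1; rewrite /sphere_proj p1 invr1 scale1r; case: eqP => // p0.
by move/eqP: p1; rewrite p0 (eqP (_ : enorm 0 == 0)) ?enorm_eq0// eq_sym oner_eq0.
Qed.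

Lemma enorm_sphere_projK n (p : 'rV[R]_n) : enorm p *: sphere_proj p = p.
Proof.
rewrite /sphere_proj; case: eqVneq => [->|p0]; last first.
  by rewrite scalerA mulfV ?scale1r// enorm_eq0.
by rewrite (eqP (_ : enorm 0 == 0)) ?enorm_eq0// scale0r.
Qed.

Lemma sphere_projZ n a (p : 'rV[R]_n) : p != 0 -> 0 < a -> sphere_proj (a *: p) = sphere_proj p.
Proof.
move=> p0 a0; rewrite /sphere_proj scaler_eq0 (gt_eqF a0) /= (negbTE p0).
rewrite enormZ gtr0_norm// scalerA invfM mulrAC mulVf ?gt_eqF// mul1r //.
Qed.

Lemma sphere_proj_cvg n (p : 'rV[R]_n) : p != 0 ->
  {for p, continuous (@sphere_proj n)}.
Proof.
move=> p0; have : {for p, continuous (fun q => (enorm q)^-1 *: q)}.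
  have FF : Filter (nbhs p) := nbhs_filter p.
  have cV : {for p, continuous (fun p => (enorm p)^-1 : R^o)}.
    by apply: (@cvgV R _ (nbhs p) FF); rewrite ?enorm_eq0//; exact: enorm_continuous.
  exact: (cvgZ cV cvg_id).
move=> c; rewrite /prop_for /continuous_at {2}/sphere_proj (negbTE p0).
apply: cvg_trans c; apply: (@near_eq_cvg _ _ (nbhs p) (nbhs_filter p)).
have : \forall q \near p, 0 < enorm q.
  apply: (@cvgr_gt _ _ (nbhs p) (nbhs_filter p) (@enorm n) (enorm p)).
    exact: enorm_continuous.
  by rewrite lt_neqAle enorm_ge0 eq_sym enorm_eq0 p0.
apply: filterS => q q0; rewrite /sphere_proj.
by rewrite -enorm_eq0 gt_eqF.
Qed.

End Euclidean.

(** * Pasting continuous maps *)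

Section Pasting.
Context {R : realType} {T U : topologicalType}.

(** Each branch has to be continuous on its own side only: in the flow below, the second branch
    involves [sphere_proj], which has no limit at the centre of a cell. *)
Lemma paste_continuous (r : T -> R) (g1 g2 : T -> U) (c : R) (x : T) :
  {for x, continuous (r : T -> R^o)} ->
  (r x <= c -> {for x, continuous g1}) ->
  (c <= r x -> {for x, continuous g2}) ->
  (r x = c -> g1 x = g2 x) ->
  {for x, continuous (fun y => if r y <= c then g1 y else g2 y)}.
Proof.
move=> cr c1 c2 g12; case: (ltgtP (r x) c) => [rx|rx|rx].
- rewrite /prop_for /continuous_at (ltW rx).
  apply: cvg_trans (c1 (ltW rx)); apply: (@near_eq_cvg _ _ (nbhs x) (nbhs_filter x)).
  have : \forall y \near x, r y < c by apply: (@cvgr_lt _ _ (nbhs x) (nbhs_filter x) r (r x)).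
  by apply: filterS => y /ltW ->.
- rewrite /prop_for /continuous_at leNgt rx /=.
  apply: cvg_trans (c2 (ltW rx)); apply: (@near_eq_cvg _ _ (nbhs x) (nbhs_filter x)).
  have : \forall y \near x, c < r y by apply: (@cvgr_gt _ _ (nbhs x) (nbhs_filter x) r (r x)).
  by apply: filterS => y; rewrite leNgt => ->.
- rewrite /prop_for /continuous_at rx lexx => A gA.
  have g1A : nbhs x (g1 @^-1` A) by apply: c1; rewrite ?rx.
  have g2A : nbhs x (g2 @^-1` A) by apply: c2; rewrite ?rx// -g12.
  apply: (@filterS _ (nbhs x) (nbhs_filter x)) (@filterI _ (nbhs x) (nbhs_filter x) _ _ g1A g2A).
  by move=> y [/= ? ?]; case: ifP.
Qed.

Lemma continuous_pair (V : topologicalType) (f : T -> U) (g : T -> V) (x : T) :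
  {for x, continuous f} -> {for x, continuous g} ->
  {for x, continuous (fun y => (f y, g y))}.
Proof.
move=> cf cg; exact: (@cvg_pair _ _ _ (nbhs x) (nbhs (f x)) (nbhs (g x))
  (nbhs_filter _) (nbhs_filter _) (nbhs_filter _) f g cf cg).
Qed.

Lemma within_continuous_comp (V : topologicalType) (A : set T) (f : T -> U)
    (g : V -> T) (x : V) :
  {within A, continuous f} -> {for x, continuous g} -> (forall y, A (g y)) ->
  {for x, continuous (f \o g)}.
Proof.
move=> cf cg Ag B fB.
have : nbhs_subspace (g x : subspace A) (f @^-1` B) := cf (g x) B fB.
rewrite -nbhs_subspace_in//= => /cg.
by apply: (@filterS _ (nbhs x) (nbhs_filter x)) => y /(_ (Ag y)).
Qed.

End Pasting.

(** * Cells *)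

Section Cells.
Variables (R : realType) (M : topologicalType) (S : cw_structure R M).

Definition Cell := {n & cell S n}.
Definition dim (e : Cell) : nat := projT1 e.

(* The characteristic map extended to the whole space by the radial retraction onto the
   closed disk, so that it is continuous everywhere. *)
Definition chi (e : Cell) (p : 'rV[R]_(dim e)) : M := char_map (projT2 e) (disk_ret p).

Lemma chiE e p : enorm p <= 1 -> chi (e := e) p = char_map (projT2 e) p.
Proof. by move=> p1; rewrite /chi disk_ret_id. Qed.

Lemma chi_ret e p : chi (e := e) (disk_ret p) = chi p.
Proof. by rewrite /chi (disk_ret_id (enorm_disk_ret p)). Qed.

Lemma chi_continuous e : continuous (@chi e).
Proof.
move=> p; apply: (within_continuous_comp (@char_map_continuous _ _ S _ (projT2 e))).
  exact: disk_ret_continuous.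
by move=> q; apply/closed_diskE; exact: enorm_disk_ret.
Qed.

Lemma chi_cover x : exists y : {e : Cell & 'rV[R]_(dim e)},
  enorm (projT2 y) < 1 /\ chi (projT2 y) = x.
Proof.
have [n [e [p /open_diskE p1 <-]]] := cells_cover S x.
by exists (existT _ (existT _ n e) p); rewrite /= chiE ?ltW.
Qed.

Definition cell_coord x := projT1 (cid (chi_cover x)).

Lemma cell_coordP x :
  enorm (projT2 (cell_coord x)) < 1 /\ chi (projT2 (cell_coord x)) = x.
Proof. exact: (projT2 (cid (chi_cover x))). Qed.

Lemma cell_coordE (e : Cell) (p : 'rV[R]_(dim e)) : enorm p < 1 ->
  cell_coord (chi p) = existT _ e p.
Proof.
move=> p1; have [] := cell_coordP (chi p).
case: (cell_coord (chi p)) => e' q /= q1 qp.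
have ee' : e' = e.
  case: e e' p p1 q q1 qp => [n e] [n' e'] p p1 q q1 qp.
  apply: (cells_disjoint (c := S)); exists (chi p); split.
    by exists q; [exact/open_diskE|rewrite -(@chiE (existT _ n' e')) ?qp// ltW].
  by exists p; [exact/open_diskE|rewrite -(@chiE (existT _ n e))// ltW].
subst e'; congr existT; have [g [_ gK]] := char_map_homeo (projT2 e).
rewrite -[q]gK; last by apply/mem_set/open_diskE.
rewrite -[p in RHS]gK; last by apply/mem_set/open_diskE.
by rewrite -!chiE ?ltW// qp.
Qed.

Definition cell_dim (x : M) : nat := dim (projT1 (cell_coord x)).

Lemma cell_dim_open e p : enorm p < 1 -> cell_dim (chi (e := e) p) = dim e.
Proof. by move=> p1; rewrite /cell_dim cell_coordE. Qed.

Lemma cell_dim_sphere e p : enorm p = 1 -> (cell_dim (chi (e := e) p) < dim e)%N.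
Proof.
move=> p1; have [F [_ Fd Fs]] := closure_finite (projT2 e).
have [c Fc [q /open_diskE q1 qp]] := Fs (char_map (projT2 e) p)
  (ex_intro2 _ _ p ((sphereE p).2 p1) erefl).
rewrite chiE ?p1// -qp -(@chiE (existT _ (projT1 c) (projT2 c))) ?ltW//.
by rewrite cell_dim_open//; exact: (Fd c Fc).
Qed.

Lemma cell_dim_closed e p : enorm p <= 1 -> (cell_dim (chi (e := e) p) <= dim e)%N.
Proof.
rewrite le_eqVlt => /orP[/eqP p1|p1]; first exact/ltnW/cell_dim_sphere.
by rewrite cell_dim_open.
Qed.

Lemma cell_dim_chi e p : (cell_dim (chi (e := e) p) <= dim e)%N.
Proof. by rewrite -chi_ret cell_dim_closed// enorm_disk_ret. Qed.

Lemma cell_ind (Q : M -> Prop) :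
  (forall e p, enorm p < 1 -> (forall y, (cell_dim y < dim e)%N -> Q y) ->
    Q (chi (e := e) p)) ->
  forall x, Q x.
Proof.
move=> IH x; have [n] := ubnP (cell_dim x); elim: n x => // n IHn x.
have [p1 px] := cell_coordP x; move: p1 px.
case: (cell_coord x) => e p /= p1 <-; rewrite cell_dim_open// => en.
by apply: IH => // y ye; apply: IHn; exact: leq_trans ye _.
Qed.

Lemma closed_cell (e : Cell) : compact (@closed_disk R (dim e)).
Proof.
apply: bounded_closed_compact.
  exists 1; split=> [|x x1 p /closed_diskE p1]; first exact: num_real.
  apply: le_trans (ltW x1).
  rewrite [leLHS](mx_normrE p); apply: bigmax_le => // -[i j] _ /=.
  rewrite -sqrtr_sqr; apply: le_trans p1; rewrite ler_sqrt.
    by rewrite (bigD1 j)//= (ord1 i) lerDl sumr_ge0// => k _; exact: sqr_ge0.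
  by rewrite sumr_ge0// => k _; exact: sqr_ge0.
have -> : closed_disk (n := dim e) = (@enorm R _ : _ -> R^o) @^-1` [set x | x <= 1].
  by apply/seteqP; split=> p /closed_diskE.
apply: closed_comp; last exact: closed_le.
by move=> p _; exact: enorm_continuous.
Qed.

Lemma open_cells (A : set M) : (forall e : Cell, open (@chi e @^-1` A)) -> open A.
Proof.
move=> oA; rewrite -[A]setCK; apply: closed_openC; apply/(weak_topology S) => n e.
have cD := compact_closed (@norm_hausdorff _ _) (@closed_cell (existT _ n e)).
rewrite (_ : _ `&` _ = closed_disk (n := n) `&` (@chi (existT _ n e) @^-1` (~` A))).
  apply: closedI => //; rewrite preimage_setC; apply: open_closedC.
  exact: (oA (existT _ n e)).
by apply/seteqP; split=> p [Dp] /=; move: (Dp) => /closed_diskE p1;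
  rewrite (@chiE (existT _ n e)).
Qed.

(** [P] is an initial segment of dimensions, so A lies in a skeleton and is tested on the cells of
    that skeleton only. In a higher cell, the preimage of A lies over the boundary, which meets
    finitely many open cells; the part of A in each of them is contained in the compact subset [B c]
    of A. *)
Lemma closed_cells (P : pred nat) (A : set M) :
  (forall m n, (m <= n)%N -> P n -> P m) ->
  (forall x, A x -> P (cell_dim x)) ->
  (forall e : Cell, P (dim e) -> closed (@chi e @^-1` A)) -> closed A.
Proof.
move=> Pd AP cA; rewrite -[A]setCK; apply: open_closedC; apply: open_cells => e.
rewrite preimage_setC; apply: closed_openC.
have [|Pe] := boolP (P (dim e)); first exact: cA.
have [F [Ff Fd Fs]] := closure_finite (projT2 e).
pose B (c : Cell) := @chi c @` (closed_disk (n := dim c) `&` @chi c @^-1` A).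
rewrite [X in closed X](_ : _ =
    \bigcup_(c in F `&` [set c | P (dim c)]) (@chi e @^-1` (B c))); last first.
  apply/seteqP; split=> p /=; last first.
    by move=> [c _ [q [_ Aq] qp]]; rewrite /= -qp.
  move=> Ap; rewrite -chi_ret in Ap; have := enorm_disk_ret p.
  rewrite le_eqVlt => /orP[/eqP p1|p1]; last first.
    by have := AP _ Ap; rewrite (cell_dim_open p1) => Pe'; rewrite Pe' in Pe.
  have [c Fc [q /open_diskE q1 qp]] := Fs (char_map (projT2 e) (disk_ret p))
    (ex_intro2 _ _ _ ((sphereE _).2 p1) erefl).
  have qp' : chi (e := existT _ (projT1 c) (projT2 c)) q = chi (disk_ret p).
    by rewrite chiE ?ltW// qp chiE ?p1.
  have cc : c = existT _ (projT1 c) (projT2 c) by case: (c).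
  exists c; rewrite /=.
    by split=> //; have := AP _ Ap; rewrite -qp' (cell_dim_open q1).
  rewrite cc; exists q; last by rewrite qp' chi_ret.
  by split; [apply/closed_diskE/ltW|rewrite /= qp'].
apply: (@closed_bigcup _ {classic Cell}).
  by apply: sub_finite_set Ff => c [].
move=> c [_ Pc]; apply: closed_comp => [q _|]; first exact: chi_continuous.
apply: compact_closed; first exact: cw_hausdorff S.
apply: continuous_compact; first exact/continuous_subspaceT/chi_continuous.
apply: compact_closedI; [exact: closed_cell|exact: cA].
Qed.

End Cells.

(** * Functions defined by recursion on cells, and their continuity *)

Section CellRecursion.
Variables (R : realType) (M : topologicalType) (S : cw_structure R M).
Local Notation Cell := (Cell S).
Local Notation cell_dim := (cell_dim S).

(** The value at p depends on the value at the radial projection of p to the boundary, which lies in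
    cells of smaller dimension. The k-th iterate of the equation is therefore stable on cells of
    dimension at most k, and the diagonal of the iterates is a solution. Continuity is a separate
    matter, settled for each use. *)
Lemma cell_recursion (Y : Type) (d : nat) (base : M -> Y)
    (step : forall e : Cell, 'rV[R]_(dim e) -> Y -> Y) :
  exists F : M -> Y,
    (forall x, (cell_dim x <= d)%N -> F x = base x) /\
    (forall e p, (d < dim e)%N -> enorm p < 1 ->
      F (chi (e := e) p) = step e p (F (chi (sphere_proj p)))).
Proof.
pose G (F : M -> Y) x := let: existT e p := cell_coord S x in
  if (d < dim e)%N then step e p (F (chi (sphere_proj p))) else base x.
pose Fk k := iter k G base.
have Fbase k x : (cell_dim x <= d)%N -> Fk k x = base x.
  case: k => [//|k] xd; rewrite /Fk /= /G; move: xd; rewrite /cell_dim.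
  by case: cell_coord => e p /=; rewrite leqNgt => /negbTE ->.
have FkE k (e : Cell) (p : 'rV[R]_(dim e)) : (d < dim e)%N -> enorm p < 1 ->
    Fk k.+1 (chi p) = step e p (Fk k (chi (sphere_proj p))).
  by move=> de p1; rewrite /Fk /= {1}/G cell_coordE// de.
have Fstab k x : (cell_dim x <= k)%N -> Fk k x = Fk (cell_dim x) x.
  elim/(@cell_ind _ _ S): x k => e p p1 IH k; rewrite cell_dim_open// => ek.
  have [de|ed] := ltnP d (dim e); last by rewrite !Fbase// cell_dim_open.
  have e0 : (0 < dim e)%N by exact: leq_ltn_trans de.
  have sp1 := cell_dim_sphere (enorm_sphere_proj p e0).
  case: k ek => [|k] ek; first by move: e0; rewrite ltnNge ek.
  have -> : Fk (dim e) (chi p) = Fk (dim e).-1.+1 (chi p) by rewrite prednK.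
  rewrite !FkE//; congr step; rewrite IH//; first rewrite [RHS]IH//.
    by rewrite -ltnS prednK.
  by rewrite -ltnS; exact: leq_trans sp1 ek.
exists (fun x => Fk (cell_dim x) x); split=> [x|e p de p1]; first exact: Fbase.
rewrite cell_dim_open//.
have e0 : (0 < dim e)%N by exact: leq_ltn_trans de.
have sp1 := cell_dim_sphere (enorm_sphere_proj p e0).
have -> : Fk (dim e) (chi p) = Fk (dim e).-1.+1 (chi p) by rewrite prednK.
by rewrite FkE// Fstab// -ltnS prednK.
Qed.

(** In essence, the product of a skeleton with the line has the weak topology of its cells, because
    the line is locally compact. The maps [g] and [tau] on a space [T] allow for sources that are
    mapped into the skeleton near [y0], such as a cell projected to its boundary. *)
Lemma cellwise_continuous (P : pred nat) (Y : topologicalType) (F : M -> R -> Y) :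
  (forall m n, (m <= n)%N -> P n -> P m) ->
  (forall e : Cell, P (dim e) ->
     continuous (fun u : 'rV[R]_(dim e) * R^o => F (chi u.1) u.2)) ->
  forall (T : topologicalType) (g : T -> M) (tau : T -> R) (y0 : T),
    {for y0, continuous g} -> {for y0, continuous (tau : T -> R^o)} ->
    (\forall y \near y0, P (cell_dim (g y))) ->
    {for y0, continuous (fun y => F (g y) (tau y))}.
Proof.
move=> Pd cF T g tau y0 cg ctau gP; rewrite /prop_for /continuous_at => B.
rewrite nbhsE => -[W [oW W0] WB].
have Py0 : P (cell_dim (g y0)) by exact: (nbhs_singleton gP).
have [eps eps0 Jeps] : exists2 eps : R, 0 < eps &
    forall t, `|t - tau y0| <= eps -> W (F (g y0) t).
  have [p1 px] := cell_coordP S (g y0); move: Py0 p1 px; rewrite /cell_dim.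
  case: cell_coord => e p /= Pe p1 px.
  have cpt : {for tau y0 : R^o, continuous (fun t : R^o => F (g y0) t)}.
    rewrite -px; have FF : Filter (nbhs (tau y0 : R^o)) := nbhs_filter _.
    have cp : {for tau y0 : R^o, continuous (fun t : R^o => (p, t))}.
      by apply: continuous_pair; [exact: cst_continuous|exact: cvg_id].
    exact: (continuous_comp cp (cF e Pe (p, tau y0))).
  have : nbhs (tau y0 : R^o) (fun t => W (F (g y0) t)).
    by apply: cpt; exact: open_nbhs_nbhs.
  move=> /nbhs_ballP[r /= r0 rW]; exists (r / 2); first by rewrite divr_gt0.
  move=> t tr; apply: rW; rewrite /ball /= distrC (le_lt_trans tr)//.
  by rewrite gtr_pMr// invf_lt1// ltr1n.
(* [J] is a compact neighbourhood of the time [tau y0] during which [g y0] stays in [W]; [A]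
   collects the points of the skeleton that are outside [W] at some time in [J]. *)
pose J := `[tau y0 - eps, tau y0 + eps]%classic : set R^o.
have JE t : J t <-> `|t - tau y0| <= eps.
  by rewrite /J /= in_itv /= ler_distl.
pose A := [set x | P (cell_dim x) /\ exists2 t, J t & ~ W (F x t)].
have cA : closed A.
  apply: (closed_cells (S := S) Pd) => [x []//|e Pe].
  rewrite -[X in closed X]setCK; apply: open_closedC; rewrite openE => p.
  move=> /= nAp.
  (* Tube lemma: as [J] is compact, all points near p stay in [W] during the whole of [J]. *)
  have := (compact_near_coveringP J).1 (@segment_compact _ _ _) _ (nbhs p)
    (fun p t => W (F (chi p) t)) (nbhs_filter p).
  have /[swap]/[apply] : forall t, J t -> \forall x \near t & p' \near p, W (F (chi p') x).
    move=> t Jt.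
    have Opt : W (F (chi p) t).
      apply: contrapT => nO; apply: nAp; split; last by exists t.
      by apply: Pd Pe; exact: cell_dim_chi.
    have := cF e Pe (p, t) _ (open_nbhs_nbhs (conj oW Opt)).
    move=> [[/= B1 B2] [b1 b2] B12]; exists (B2, B1) => //= -[t' p'] [/= ? ?].
    exact: (B12 (p', t')).
  apply: filterS => p' Jp' /= -[_ [t /Jp' ?]]; exact.
have nA : nbhs y0 (g @^-1` (~` A)).
  apply: cg; apply: open_nbhs_nbhs; split; first exact: closed_openC.
  by move=> [_ [t /JE/Jeps ?]].
have nJ : nbhs y0 (tau @^-1` J).
  apply: ctau; apply/nbhs_ballP; exists eps => //= t.
  by rewrite /ball /= distrC => /ltW/JE.
have FF : Filter (nbhs y0) := nbhs_filter y0.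
apply: filterS (filterI gP (filterI nA nJ)) => y [Py [/= nAy Jy]].
apply: WB; apply: contrapT => nO; apply: nAy; split=> //.
by exists (tau y).
Qed.

End CellRecursion.

(** * The radial flow of a CW complex *)

Section Flow.
Variables (R : realType) (M : topologicalType) (S : cw_structure R M) (d : nat).
Local Notation Cell := (Cell S).
Local Notation cell_dim := (cell_dim S).

(* The points move radially outwards through the cells of dimension > d. A point that leaves
   a cell at its boundary goes on along the trajectory of the boundary point. *)
Definition flow_spec (H : M -> R -> M) :=
  (forall x, (cell_dim x <= d)%N -> H x = cst x) /\
  (forall (e : Cell) (p : 'rV[R]_(dim e)), (d < dim e)%N -> enorm p <= 1 ->
    forall t, H (chi p) t = if (1 + `|t|) * enorm p <= 1 then chi ((1 + `|t|) *: p)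
                            else H (chi (sphere_proj p)) ((1 + `|t|) * enorm p - 1)).

(** The clock is multiplicative: a point of radius r that leaves its cell has the time t' left with
    1 + t' = (1 + t) r. The centre of a cell does not move. The absolute value gives a meaning to
    negative times, so that the flow is defined on the whole line. *)
Lemma flow_exists : exists2 H, flow_spec H & forall x, H x 0 = x.
Proof.
pose step (e : Cell) (p : 'rV[R]_(dim e)) (y : R -> M) (t : R) :=
  if (1 + `|t|) * enorm p <= 1 then chi ((1 + `|t|) *: p)
  else y ((1 + `|t|) * enorm p - 1).
have [H [Hb He]] := @cell_recursion _ _ S (R -> M) d cst step.
have H0 x : H x 0 = x.
  have [xd|dx] := leqP (cell_dim x) d; first by rewrite Hb.
  have [p1 px] := cell_coordP S x; move: dx p1 px; rewrite /cell_dim.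
  case: cell_coord => e p /= de p1 <-.
  by rewrite He// /step normr0 addr0 mul1r (ltW p1) scale1r.
have Hn x t : H x `|t| = H x t.
  have [xd|dx] := leqP (cell_dim x) d; first by rewrite Hb.
  have [p1 px] := cell_coordP S x; move: dx p1 px; rewrite /cell_dim.
  case: cell_coord => e p /= de p1 <-.
  by rewrite He// /step normr_id.
(* The recursion equation holds on open cells. For a boundary point, the equation of [flow_spec]
   reduces to [H x 0 = x] when t = 0, and otherwise to the evenness of [H x]. *)
exists H => //; split=> // e p de; rewrite le_eqVlt => /orP[/eqP p1|p1] t.
  rewrite sphere_proj_id// p1 mulr1; case: ifP => t1.
    have -> : t = 0.
      by apply/eqP; rewrite -normr_le0; lra.
    by rewrite normr0 addr0 scale1r H0.
  by rewrite [1 + _]addrC addrK Hn.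
by rewrite He.
Qed.

Variable H : M -> R -> M.
Hypotheses (HP : flow_spec H) (H0 : forall x, H x 0 = x).

(** Induction on the dimension. Trajectories still inside the cell and those that have left it are
    pasted where (1 + |t|) |p| = 1. The latter factor through the boundary sphere, whose image lies
    in a smaller skeleton, where [cellwise_continuous] applies. *)
Lemma flow_cell_continuous (e : Cell) :
  continuous (fun u : 'rV[R]_(dim e) * R^o => H (chi (e := e) u.1) u.2).
Proof.
have [n] := ubnP (dim e); elim: n e => // n IH e en.
have [de|ed] := ltnP d (dim e); last first.
  rewrite (_ : (fun _ => _) = @chi _ _ S e \o fst).
    move=> u; apply: continuous_comp; [exact: cvg_fst|exact: chi_continuous].
  by apply/funext => u; rewrite HP.1// (leq_trans (cell_dim_chi _)).
move=> u.
pose q (v : 'rV[R]_(dim e) * R^o) := (1 + `|v.2|) *: disk_ret v.1.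
pose r (v : 'rV[R]_(dim e) * R^o) := (1 + `|v.2|) * enorm (disk_ret v.1).
have c1 : {for u, continuous (fun v : 'rV[R]_(dim e) * R^o => disk_ret v.1)}.
  by apply: continuous_comp; [exact: cvg_fst|exact: disk_ret_continuous].
have c2 : {for u, continuous (fun v : 'rV[R]_(dim e) * R^o => 1 + `|v.2| : R^o)}.
  apply: (@continuousD _ R^o); first exact: cst_continuous.
  by apply: (@continuous_comp _ _ _ snd (Num.norm : R^o -> R^o)); [exact: cvg_snd|
    exact: norm_continuous].
have cq : {for u, continuous q} by exact: (cvgZ c2 c1).
have cr : {for u, continuous (r : _ -> R^o)}.
  apply: (cvgM c2); apply: (continuous_comp c1); exact: enorm_continuous.
rewrite (_ : (fun _ => _) = fun v => if r v <= 1 then chi (q v) else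
    H (chi (sphere_proj (disk_ret v.1))) (r v - 1)); last first.
  apply/funext => v; rewrite -chi_ret HP.2//; exact: enorm_disk_ret.
have e0 : (0 < dim e)%N by exact: leq_ltn_trans de.
have D0 (v : 'rV[R]_(dim e) * R^o) : 1 <= r v -> disk_ret v.1 != 0.
  rewrite -enorm_eq0; apply: contraTneq => h; rewrite /r h mulr0.
  by rewrite -ltNge ltr01.
apply: paste_continuous => // [_|ru|ru].
- by apply: (continuous_comp cq); exact: chi_continuous.
- apply: (@cellwise_continuous _ _ S (fun k => (k < dim e)%N)).
  + by move=> m k mk; exact: leq_ltn_trans.
  + by move=> c ce; apply: IH; exact: leq_trans ce _.
  + apply: (@continuous_comp _ _ _ (fun v => sphere_proj (disk_ret v.1))); last first.
      exact: chi_continuous.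
    by apply: (continuous_comp c1); apply: sphere_proj_cvg; exact: D0.
  + exact: (@continuousB _ R^o _ _ _ _ cr (@cst_continuous _ R^o 1 u)).
  + by apply: (@filterE _ (nbhs u) (nbhs_filter u)) => v; apply: cell_dim_sphere;
    exact: enorm_sphere_proj.
- rewrite ru subrr H0; congr chi.
  have p0 : disk_ret u.1 != 0 by apply: D0; rewrite ru.
  rewrite -[LHS]enorm_sphere_projK enormZ ger0_norm ?addr_ge0// -/(r u) ru scale1r.
  by rewrite sphere_projZ// (lt_le_trans ltr01)// lerDl.
Qed.

Lemma flow_continuous (T : topologicalType) (g : T -> M) (tau : T -> R) y :
  {for y, continuous g} -> {for y, continuous (tau : T -> R^o)} ->
  {for y, continuous (fun y => H (g y) (tau y))}.
Proof.
move=> cg ct; apply: (@cellwise_continuous _ _ S xpredT) => //.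
  by move=> e _; exact: flow_cell_continuous.
exact: (@filterE _ (nbhs y) (nbhs_filter y)).
Qed.

(* [(h x)^-1 - 1] is the time at which the trajectory of x enters the d-skeleton. *)
Lemma flow_reaches : exists h : M -> R,
  [/\ continuous (h : M -> R^o),
      forall x, (cell_dim x <= d)%N -> h x = 1 &
      forall x t, 1 <= (1 + `|t|) * h x -> (cell_dim (H x t) <= d)%N].
Proof.
(* As the clock is multiplicative, [h x] is the product of the radius of x and of the radii of its
   successive boundary projections, down to the d-skeleton. It vanishes at the centre of a cell,
   which never gets there. *)
have [h [hb he]] := @cell_recursion _ _ S R d (fun=> 1) (fun e p y => enorm p * y).
have h01 x : 0 <= h x <= 1.
  elim/(@cell_ind _ _ S): x => e p p1 IH.
  have [de|ed] := ltnP d (dim e); last by rewrite hb ?cell_dim_open// ler01 lexx.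
  have e0 : (0 < dim e)%N by exact: leq_ltn_trans de.
  have /andP[s0 s1] := IH _ (cell_dim_sphere (enorm_sphere_proj p e0)).
  by rewrite he// mulr_ge0 ?enorm_ge0//= mulr_ile1 ?enorm_ge0// ltW.
have he' (e : Cell) (p : 'rV[R]_(dim e)) : (d < dim e)%N -> enorm p <= 1 ->
    h (chi p) = enorm p * h (chi (sphere_proj p)).
  move=> de; rewrite le_eqVlt => /orP[/eqP p1|p1]; last exact: he.
  by rewrite p1 mul1r sphere_proj_id.
have hc (e : Cell) : continuous (fun u : 'rV[R]_(dim e) * R^o => h (chi u.1) : R^o).
  have [n] := ubnP (dim e); elim: n e => // n IH e en.
  have [de|ed] := ltnP d (dim e); last first.
    rewrite (_ : (fun _ => _) = cst 1); first exact: cst_continuous.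
    by apply/funext => u; rewrite hb// (leq_trans (cell_dim_chi _)).
  move=> u.
  rewrite (_ : (fun _ => _) = fun v : 'rV[R]_(dim e) * R^o =>
    enorm (disk_ret v.1) * h (chi (sphere_proj (disk_ret v.1)))); last first.
    by apply/funext => v; rewrite -chi_ret he' ?enorm_disk_ret.
  have c1 : {for u, continuous (fun v : 'rV[R]_(dim e) * R^o => disk_ret v.1)}.
    by apply: continuous_comp; [exact: cvg_fst|exact: disk_ret_continuous].
  have c2 : {for u, continuous (fun v : 'rV[R]_(dim e) * R^o => enorm (disk_ret v.1) : R^o)}.
    by apply: (continuous_comp c1); exact: enorm_continuous.
  have FF : Filter (nbhs u) := nbhs_filter u.
  have e0 : (0 < dim e)%N by exact: leq_ltn_trans de.
  (* [sphere_proj] is discontinuous at the centre, but [h] lies between 0 and the radius there. *)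
  have [p0|p0] := eqVneq (disk_ret u.1) 0.
    rewrite /prop_for /continuous_at p0.
    have n0 : enorm (0 : 'rV[R]_(dim e)) = 0 by apply/eqP; rewrite enorm_eq0.
    rewrite n0 mul0r; apply: (@squeeze_cvgr _ _ _ _ (fun=> 0) (fun v => enorm (disk_ret v.1))).
    + apply: (@filterE _ (nbhs u) (nbhs_filter u)) => v; set y := h _.
      have /andP[y0 y1] := h01 (chi (sphere_proj (disk_ret v.1))).
      by rewrite mulr_ge0 ?enorm_ge0//= ler_piMr ?enorm_ge0.
    + exact: cvg_cst.
    + by move: c2; rewrite /prop_for /continuous_at p0 n0.
  apply: (@cvgM _ _ _ _ _ _ _ _ c2).
  apply: (@cellwise_continuous _ _ S (fun k => (k < dim e)%N) _
      (fun x _ => h x : R^o) _ _ _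
      (fun v : 'rV[R]_(dim e) * R^o => chi (sphere_proj (disk_ret v.1))) (fun=> 0)).
  + by move=> m k mk; exact: leq_ltn_trans.
  + by move=> c ce; apply: IH; exact: leq_trans ce _.
  + apply: (@continuous_comp _ _ _ (fun v => sphere_proj (disk_ret v.1))); last first.
      exact: chi_continuous.
    by apply: (continuous_comp c1); exact: sphere_proj_cvg.
  + exact: cst_continuous.
  + by apply: (@filterE _ (nbhs u) (nbhs_filter u)) => v; apply: cell_dim_sphere;
    exact: enorm_sphere_proj.
exists h; split=> //.
  move=> x; have FF : Filter (nbhs x) := nbhs_filter x.
  apply: (@cellwise_continuous _ _ S xpredT _ (fun x _ => h x : R^o) _ _ _ id (fun=> 0)) => //.
  + exact: cst_continuous.
  + exact: (@filterE _ (nbhs x) (nbhs_filter x)).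
move=> x; elim/(@cell_ind _ _ S): x => e p p1 IH t.
have [de|ed] := ltnP d (dim e); last by rewrite HP.1 cell_dim_open.
have e0 : (0 < dim e)%N by exact: leq_ltn_trans de.
have sp1 := cell_dim_sphere (enorm_sphere_proj p e0).
rewrite he// HP.2 ?(ltW p1)// => th.
have /andP[s0 s1] := h01 (chi (sphere_proj p)).
have q1 : 1 <= (1 + `|t|) * enorm p.
  apply: le_trans th _; rewrite mulrA ler_piMr//.
  by rewrite mulr_ge0 ?enorm_ge0 ?addr_ge0.
case: ifPn => [q1'|_]; last first.
  apply: IH => //; rewrite ger0_norm ?subr_ge0// addrC subrK -mulrA //.
(* Borderline case: the boundary is reached with no time left, so the induction hypothesis is
   applied to the boundary point at time 0. *)
have qE : (1 + `|t|) * enorm p = 1 by apply/eqP; rewrite eq_le q1 q1'.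
have -> : (1 + `|t|) *: p = sphere_proj p.
  by rewrite -[in LHS](enorm_sphere_projK p) scalerA qE scale1r.
rewrite -[chi _]H0; apply: IH => //.
by rewrite normr0 addr0 mul1r; move: th; rewrite mulrA qE mul1r.
Qed.

End Flow.

(** * Cocycles on a CW complex *)

Section LocallyVanishing.
Variables (R : realType) (X : topologicalType).

(** By additivity on segments, the set of the t with [f (seg s 0 t) = 0] is open and closed in the
    connected line. This takes the place of a subdivision of the path. *)
Lemma locally_zero_path (f : singular_cochain R X 1) (s : continuousType R^o X) :
  singular_coboundary f = 0 ->
  (forall t : R^o, \forall a \near t, f (seg s t a) = 0) ->
  f (seg s 0 1) = 0.
Proof.
move=> df loc; pose A := [set t : R | f (seg s 0 t) = 0].
have fE a b : f (seg s a b) = f (seg s 0 b) - f (seg s 0 a).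
  by rewrite -(closed_seg s 0 a b df) addrAC subrr add0r.
have oA : open A.
  rewrite openE => t At; have FF : Filter (nbhs (t : R^o)) := nbhs_filter _.
  apply: (@filterS _ (nbhs (t : R^o)) FF _ _ _ (loc t)) => a /=.
  by rewrite fE At subr0.
have oAC : open (~` A).
  rewrite openE => t At; have FF : Filter (nbhs (t : R^o)) := nbhs_filter _.
  apply: (@filterS _ (nbhs (t : R^o)) FF _ _ _ (loc t)) => a /=.
  rewrite fE => /eqP; rewrite subr_eq0 => /eqP fat; rewrite /A /= fat; exact: At.
have cT : connected [set: R] by apply/connected_intervalP.
have AT : A = setT.
  apply: cT; first by exists 0; rewrite /A /= seg_refl normalized_const//;
    exact: closed_normalized.
    by exists A => //; rewrite setTI.
  by exists A; rewrite ?setTI// -[A]setCK; exact: open_closedC.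
by have : A 1 by rewrite AT.
Qed.

Lemma seg_path_in (V : normedModType R) (F : continuousType V X) a b (A : set X) :
  (forall t, 0 <= t <= 1 -> A (F ((1 - t) *: a + t *: b))) ->
  forall t, A (seg_path (seg F a b) t).
Proof.
move=> FA t; rewrite /= /affine_simplex_fun /= !big_ord_recl big_ord0 addr0 !mxE /=.
by apply: FA; rewrite le_max lexx /= ge_max ler01 ge_min lexx.
Qed.

End LocallyVanishing.

Section CellCocycles.
Variables (R : realType) (M : topologicalType) (S : cw_structure R M).
Local Notation Cell := (Cell S).
Local Notation cell_dim := (cell_dim S).
Local Notation C := R[i].

Definition chic (e : Cell) : continuousType 'rV[R]_(dim e) M :=
  continuous_map (@chi_continuous _ _ _ e).

Section Vanishing.
Variables (P : pred nat) (f : singular_cochain R M 1).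
Hypotheses (Pd : forall m n, (m <= n)%N -> P n -> P m)
  (df : singular_coboundary f = 0)
  (f0 : forall e : Cell, P (dim e) -> forall a b, enorm a <= 1 -> enorm b <= 1 ->
     f (seg (chic e) a b) = 0).

Lemma track_continuous d (H : M -> R -> M) : flow_spec S d H -> (forall x, H x 0 = x) ->
  forall x, continuous (H x : R^o -> M).
Proof.
move=> HP H0 x t; apply: (flow_continuous HP H0 (T := R^o) (g := fun=> x) (tau := id)).
  exact: cst_continuous.
exact: cvg_id.
Qed.

(** Until it leaves its cell, a trajectory is a radial segment, on which [f] vanishes by [f0]. From
    then on it is the trajectory of a boundary point, to which the induction hypothesis applies. *)
Lemma track_zero d H (HP : flow_spec S d H) (H0 : forall x, H x 0 = x) x (T : R) :
  P (cell_dim x) -> 0 <= T ->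
  f (seg (continuous_map (@track_continuous d H HP H0 x)) 0 T) = 0.
Proof.
elim/(@cell_ind _ _ S): x T => e p p1 IH T; rewrite cell_dim_open// => Pe T0.
set Hx := continuous_map _.
have [de|ed] := ltnP d (dim e); last first.
  rewrite (seg_const (F := Hx)) ?normalized_const//; first exact: closed_normalized.
  by move=> t _ /=; rewrite HP.1 // cell_dim_open.
have e0 : (0 < dim e)%N by exact: leq_ltn_trans de.
have sp1 := enorm_sphere_proj p e0.
have sd := cell_dim_sphere sp1.
have short t : 0 <= t -> (1 + t) * enorm p <= 1 -> f (seg Hx 0 t) = 0.
  move=> t0 tp; rewrite (_ : seg Hx 0 t = seg (chic e) p ((1 + t) *: p)).
    by apply: f0 => //; rewrite ?(ltW p1)// enormZ ger0_norm// addr_ge0.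
  apply: eq_seg => r r01; rewrite scaler0 add0r -[_ *: t]/(r * t) /=.
  have rt : 0 <= r * t by rewrite mulr_ge0//; lra.
  rewrite HP.2 ?(ltW p1)// (ger0_norm rt) ifT.
    by rewrite scalerA -scalerDl; congr (chi (_ *: _)); ring.
  apply: le_trans tp; rewrite ler_wpM2r ?enorm_ge0// lerD2l ler_piMl//; lra.
have [Tp|pT] := leP ((1 + T) * enorm p) 1; first exact: short.
have p0 : 0 < enorm p.
  rewrite lt_neqAle enorm_ge0 eq_sym andbT; apply: contraTneq pT => ->.
  by rewrite mulr0 -leNgt ler01.
(* The time at which the trajectory reaches the boundary of the cell. *)
pose t := (enorm p)^-1 - 1.
have tp : (1 + t) * enorm p = 1 by rewrite /t addrC subrK mulVf// gt_eqF.
have t0 : 0 <= t by rewrite subr_ge0 invf_ge1// ltW.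
rewrite -(closed_seg Hx 0 t T df) short ?tp// add0r.
have tT : t <= T by rewrite -(lerD2l 1) -(ler_pM2r p0) tp ltW.
rewrite (_ : seg Hx t T = seg (continuous_map
  (@track_continuous d H HP H0 (chi (sphere_proj p)))) 0 ((1 + T) * enorm p - 1)).
  apply: IH => //; first by apply: Pd Pe; exact: ltnW.
  by rewrite subr_ge0 ltW.
apply: eq_seg => r r01; rewrite scaler0 add0r /=.
rewrite -[_ *: t]/(_ * _) -[_ *: T]/(_ * _) -[_ *: (_ - 1)]/(_ * _).
set u := (1 - r) * t + r * T.
have u0 : 0 <= u by rewrite addr_ge0 ?mulr_ge0//; lra.
have uE : (1 + u) * enorm p = 1 + r * ((1 + T) * enorm p - 1).
  rewrite /u -[X in _ = X + _]tp; move: tp; move: (enorm p) => y; nra.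
rewrite HP.2 ?(ltW p1)// (ger0_norm u0); case: ifP => up; last first.
  by rewrite uE addrAC subrr add0r.
have r0 : r * ((1 + T) * enorm p - 1) = 0.
  have a0 : 0 <= r * ((1 + T) * enorm p - 1) by rewrite mulr_ge0//; lra.
  by move: up; rewrite uE; lra.
by rewrite r0 H0 -[in LHS](enorm_sphere_projK p) scalerA uE r0 addr0 scale1r.
Qed.

(* Near x, the flow deforms a path into the open cell of x. *)
Lemma locally_zero_cell x : P (cell_dim x) -> exists W : set M,
  [/\ open W, W x & forall c : continuousType R^o M,
    (forall t, W (c t) /\ P (cell_dim (c t))) -> f (seg c 0 1) = 0].
Proof.
move=> Px; pose d := cell_dim x; pose e := projT1 (cell_coord S x).
have ed : dim e = d by [].
have [H HP H0] := flow_exists S d.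
have [h [hc h1 hr]] := flow_reaches HP H0.
(* The d-skeleton without the open cell of x. *)
pose bad := [set y | (cell_dim y <= d)%N /\ projT1 (cell_coord S y) <> e].
have cbad : closed bad.
  apply: (@closed_cells _ _ S (fun k => k <= d)%N) => [m n mn|y []//|e' e'd].
    exact: leq_trans.
  have [e'e|e'e] := pselect (e' = e); last first.
    rewrite (_ : _ @^-1` _ = setT); first exact: closedT.
    apply/seteqP; split=> // p _; split.
      by apply: leq_trans e'd; exact: cell_dim_chi.
    rewrite -chi_ret; have := enorm_disk_ret p.
    rewrite le_eqVlt => /orP[/eqP p1|p1]; last by rewrite cell_coordE.
    move=> eq_e; have := cell_dim_sphere p1.
    by rewrite /cell_dim eq_e ed ltnNge e'd.
  subst e'; rewrite (_ : _ @^-1` _ = (@enorm R _ : _ -> R^o) @^-1` [set x | 1 <= x]).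
    by apply: closed_comp => [p _|]; [exact: enorm_continuous|exact: closed_ge].
  apply/seteqP; split=> p /=.
    by move=> [_]; rewrite leNgt => ne; apply/negP => p1; apply: ne; rewrite cell_coordE.
  move=> p1; split; first exact: cell_dim_chi.
  have rp1 : enorm (disk_ret p) = 1.
    rewrite enormZ max_r// ger0_norm ?invr_ge0 ?enorm_ge0// mulVf// gt_eqF//.
    exact: lt_le_trans p1.
  move=> eq_e; have := cell_dim_sphere rp1.
  by rewrite chi_ret /cell_dim eq_e ltnn.
have cH1 : continuous (fun y => H y 1).
  move=> y; apply: (flow_continuous HP H0 (T := M) (g := id) (tau := fun=> 1)).
    exact: cvg_id.
  exact: cst_continuous.
(* At time 1 the clock factor is 2, so [h y > 1/2] ensures that y has entered the d-skeleton by
   then; avoiding [bad], it is in the open cell of x. *)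
pose W := ((h : M -> R^o) @^-1` [set r | 2^-1 < r]) `&` ((fun y => H y 1) @^-1` (~` bad)).
exists W; split.
- apply: openI; apply: open_comp => [y _|].
  + exact: hc.
  + exact: open_gt.
  + exact: cH1.
  + exact: closed_openC.
- split=> /=; first by rewrite h1// invf_lt1// ltr1n.
  by rewrite HP.1//= => -[_]; apply.
move=> c cW.
(* The square [K] has the sides [c], the trajectories of [c 0] and [c 1], and a path in the open
   cell of x. As [f] vanishes on the last three, it vanishes on [c]. *)
have cK : continuous (fun u : R^o * R^o => H (c u.2) u.1).
  move=> u; apply: (flow_continuous HP H0 (T := (R^o * R^o)%type) (g := fun u => c u.2)
    (tau := fun u => u.1)); last exact: cvg_fst.
  by apply: (@continuous_comp _ _ _ snd c); [exact: cvg_snd|exact: cts_fun].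
pose K := continuous_map cK.
have tr y : P (cell_dim (c y)) -> f (seg K (0, y) (1, y)) = 0.
  move=> Pc; rewrite -[RHS](track_zero HP H0 Pc ler01); congr f.
  apply: eq_seg => t _ /=; congr (H (c _) _).
  by rewrite -scalerDl subrK scale1r.
have c0 : seg K (0, 0) (0, 1) = seg c 0 1.
  by apply: eq_seg => t _ /=; rewrite !scaler0 !add0r H0.
have Kin t : cell_dim (H (c t) 1) = d /\ projT1 (cell_coord S (H (c t) 1)) = e.
  have [[/= hct nbad] _] := cW t.
  have cd : (cell_dim (H (c t) 1%R) <= d)%N.
    by apply: hr; rewrite normr1; move: hct; lra.
  have ce : projT1 (cell_coord S (H (c t) 1)) = e.
    by apply: contrapT => ne; exact: nbad.
  by split=> //; rewrite /cell_dim ce.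
have [g [gc gK]] := char_map_homeo (projT2 e).
have gE t : enorm (g (H (c t) 1)) < 1 /\ chi (e := e) (g (H (c t) 1)) = H (c t) 1.
  have [_ ce] := Kin t; have [p1 pH] := cell_coordP S (H (c t) 1).
  move: ce p1 pH; case: cell_coord => e' p /= e'e p1 <-; subst e'.
  by rewrite [X in g X]chiE ?(ltW p1)// gK//; apply/mem_set/open_diskE.
have cq : continuous (fun t : R^o => g (H (c t) 1)).
  move=> t; apply: (within_continuous_comp gc (g := fun t : R^o => H (c t) 1)).
    apply: (@continuous_comp _ _ _ c (fun y => H y 1)); [exact: cts_fun|exact: cH1].
  move=> y; exists (g (H (c y) 1)); first by apply/open_diskE; have [] := gE y.
  by rewrite -chiE ?(gE y).2// ltW// (gE y).1.
have c1 : f (seg K (1, 0) (1, 1)) = 0.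
  rewrite (_ : seg K (1, 0) (1, 1) = seg (chic e \o continuous_map cq) 0 1).
    rewrite closed_path//; apply: f0 => //; rewrite ltW//=; [exact: (gE 0).1|exact: (gE 1).1].
  apply: eq_seg => t _ /=; rewrite (gE _).2; congr (H (c _) _).
  by rewrite -scalerDl subrK scale1r.
have := closed_seg K (0, 0) (0, 1) (1, 1) df.
rewrite -(closed_seg K (0, 0) (1, 0) (1, 1) df) c0 c1 !tr ?addr0//; first by have [] := cW 0.
by have [] := cW 1.
Qed.

Lemma zero_path (s : continuousType R^o M) : (forall t, P (cell_dim (s t))) ->
  f (seg s 0 1) = 0.
Proof.
move=> sP; apply: locally_zero_path => // t.
have [W [oW Wst fW]] := locally_zero_cell (sP t).
have : nbhs t (s @^-1` W) by apply: (@cts_fun _ _ s); exact: open_nbhs_nbhs.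
move=> /nbhs_ballP[r /= r0 rW]; apply/nbhs_ballP; exists r => // a ta /=.
rewrite -(seg_pathE (seg s t a)); apply: fW => u.
apply: (seg_path_in (A := fun y => W y /\ P (cell_dim y))) => v v01; split; last exact: sP.
apply: rW; move: ta; rewrite /ball /= -[_ *: t]/(_ * _) -[_ *: a]/(_ * _) => ta.
have -> : t - ((1 - v) * t + v * a) = v * (t - a) by ring.
by rewrite normrM ger0_norm; [apply: le_lt_trans ta; rewrite ler_piMl//; lra|lra].
Qed.

End Vanishing.

End CellCocycles.

(** * Primitives of cocycles that vanish on the edges *)

Section Exactness.
Variables (R : realType) (M : topologicalType) (S : cw_structure R M).
Local Notation Cell := (Cell S).
Local Notation cell_dim := (cell_dim S).
Local Notation C := R[i].

(** The preimage of A in each cell is everything or empty, and the same holds for its complement, so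
    A is open and closed. *)
Lemma connected_cells (A : set M) : connected [set: M] -> A !=set0 ->
  (forall (e : Cell) p q, A (chi (e := e) p) -> A (chi (e := e) q)) -> A = setT.
Proof.
move=> cM A0 Ae.
have clopen_cell (B : set M) : (forall (e : Cell) p q, B (chi (e := e) p) -> B (chi (e := e) q)) ->
    open B.
  move=> Be; apply: (open_cells (S := S)) => e.
  have [[p Bp]|nB] := pselect (exists p, B (chi (e := e) p)).
    rewrite (_ : _ @^-1` _ = setT); first exact: openT.
    by apply/seteqP; split=> // q _; exact: Be Bp.
  rewrite (_ : _ @^-1` _ = set0); first exact: open0.
  by apply/seteqP; split=> // q Bq; apply: nB; exists q.
apply: cM => //; first by exists A; rewrite ?setTI//; exact: clopen_cell.
exists A; rewrite ?setTI// -[A]setCK; apply: open_closedC; apply: clopen_cell.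
by move=> e p q nAp Aq; apply: nAp; exact: Ae Aq.
Qed.

Lemma line_map_neq0 n (a b : 'rV[R]_n) (t : R) : enorm a = 1 -> enorm b = 1 ->
  b != - a -> line_map a b t != 0.
Proof.
move=> a1 b1; apply: contraNneq; rewrite /line_map => ab.
have {}ab : (1 - t) *: a = (- t) *: b.
  by apply/eqP; rewrite scaleNr -addr_eq0 ab.
have := congr1 (@enorm R n) ab; rewrite !enormZ a1 b1 !mulr1 normrN => tt.
have t2 : t = 2^-1.
  have [t0|t0] := leP 0 t; have [t1|t1] := leP 0 (1 - t); move: tt;
    rewrite ?(ger0_norm t0) ?(ltr0_norm t0) ?(ger0_norm t1) ?(ltr0_norm t1); lra.
have t0 : t != 0 by rewrite t2 invr_neq0// pnatr_eq0.
move: ab; rewrite (_ : 1 - t = t); last by rewrite t2; lra.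
rewrite scaleNr -scalerN => /(scalerI t0) ->; by rewrite opprK.
Qed.

(** Antipodal points of a sphere are joined by two arcs through [b]; the chord of each avoids the
    origin, so it projects to the sphere. *)
Lemma third_unit n (a : 'rV[R]_n) : (1 < n)%N ->
  exists b : 'rV[R]_n, [/\ enorm b = 1, b != - a & b != a].
Proof.
case: n a => [|[|n]]// a _.
pose e0 : 'rV[R]_n.+2 := \row_i (val i == 0%N)%:R.
pose e1 : 'rV[R]_n.+2 := \row_i (val i == 1%N)%:R.
have e01 (c : R) : e1 != c *: e0.
  apply/eqP => /rowP/(_ (Ordinal (isT : (1 < n.+2)%N))); rewrite !mxE /= mulr0.
  by apply/eqP; rewrite oner_eq0.
have n0 : enorm e0 = 1 by exact: enorm_e0.
have n1 : enorm e1 = 1.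
  rewrite /enorm 2!big_ord_recl big1 ?mxE /=.
    by rewrite expr0n expr1n add0r addr0 sqrtr1.
  by move=> i _; rewrite mxE /= expr0n.
have [ae|ae] := pselect (a = e0 \/ a = - e0).
  exists e1; split=> //; case: ae => ->; rewrite ?opprK.
  - by rewrite -scaleN1r.
  - by rewrite -[e0]scale1r.
  - by rewrite -[e0]scale1r.
  - by rewrite -scaleN1r.
exists e0; split=> //; apply/eqP => e0a; apply: ae; [right|by left].
by rewrite e0a opprK.
Qed.

Lemma seg_cobN (f : singular_cochain R M 1) (V : normedModType R)
    (F : continuousType V M) a b : singular_coboundary f = 0 ->
  f (seg F a b) = - f (seg F b a).
Proof.
move=> df; apply/eqP; rewrite -addr_eq0 closed_seg// seg_refl normalized_const//.
exact: closed_normalized.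
Qed.

Lemma exact_of_edges (f : singular_cochain R M 1) : singular_coboundary f = 0 ->
  (forall e : Cell, dim e = 1%N -> f (seg (chic e) (const_mx (-1)) (const_mx 1)) = 0) ->
  exists g : singular_cochain R M 0, singular_coboundary g = f.
Proof.
move=> df f1.
have fcst (V : normedModType R) (F : continuousType V M) a : f (seg F a a) = 0.
  by rewrite seg_refl normalized_const//; exact: closed_normalized.
(* The primitive is 0 at the vertices, consistently with [f1], and extends along the radius from the
   boundary point to p. A 0-cochain is an arbitrary function of the point, so the choice of a radius
   at the centre is harmless. *)
pose step (e : Cell) (p : 'rV[R]_(dim e)) (y : C) := y + f (seg (chic e) (sphere_proj p) p).
have [u [ub ue]] := @cell_recursion _ _ S C 0 (fun=> 0) step.
pose f' : singular_cochain R M 1 := f - singular_coboundary (cochain0 u).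
have df' : singular_coboundary f' = 0.
  have : singular_coboundary f' =
      singular_coboundary f - singular_coboundary (singular_coboundary (cochain0 u)).
    exact: (raddfB (@singular_coboundary R M 1)).
  by rewrite df singular_coboundaryK subrr.
have f'E (V : normedModType R) (F : continuousType V M) a b :
    f' (seg F a b) = f (seg F a b) - (u (F b) - u (F a)).
  by rewrite -coboundary_cochain0.
have f'cst (V : normedModType R) (F : continuousType V M) a : f' (seg F a a) = 0.
  by rewrite f'E fcst !subrr.
have f'zero (P : pred nat) : (forall m n, (m <= n)%N -> P n -> P m) ->
    (forall e : Cell, P (dim e) -> forall a b, enorm a <= 1 -> enorm b <= 1 ->
      f' (seg (chic e) a b) = 0) ->
    forall p : continuousType R^o M, (forall t, P (cell_dim (p t))) -> f' (seg p 0 1) = 0.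
  by move=> Pd fP; exact: zero_path.
have uproj (e : Cell) (a : 'rV[R]_(dim e)) : (0 < dim e)%N -> enorm a <= 1 ->
    f' (seg (chic e) (sphere_proj a) a) = 0.
  move=> e0; rewrite le_eqVlt => /orP[/eqP a1|a1].
    by rewrite sphere_proj_id// f'cst.
  by rewrite f'E /= ue// /step [X in _ - (X - _)]addrC addrK subrr.
(* Induction on the dimension. Radii are settled by [uproj], which leaves pairs of boundary points:
   for an edge these are its two ends, where [u] is 0; in higher dimension they are joined by arcs
   of the sphere, that is, by paths in a smaller skeleton, where [zero_path] applies. *)
have f'cell (e : Cell) a b : enorm a <= 1 -> enorm b <= 1 -> f' (seg (chic e) a b) = 0.
  have [n] := ubnP (dim e); elim: n e a b => // n IH e a b en a1 b1.
  have [e0|e0] := posnP (dim e).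
    rewrite (_ : a = b) ?f'cst//; apply/rowP => i.
    by have := ltn_ord i; rewrite {2}e0.
  suff sph (x y : 'rV[R]_(dim e)) : enorm x = 1 -> enorm y = 1 -> f' (seg (chic e) x y) = 0.
    rewrite -(closed_seg _ a (sphere_proj a) b df') (seg_cobN _ a)// uproj// oppr0 add0r.
    rewrite -(closed_seg _ _ (sphere_proj b) b df') uproj// addr0.
    by apply: sph; exact: enorm_sphere_proj.
  have [e1|e1] := eqVneq (dim e) 1%N.
    have unit1 (z : 'rV[R]_(dim e)) : enorm z = 1 -> z = const_mx 1 \/ z = const_mx (-1).
      move=> /sphereE; rewrite /sphere /= => z1.
      have zi i j : z ord0 i = z ord0 j.
        congr (z _ _); apply: val_inj; have := ltn_ord i; have := ltn_ord j.
        rewrite [X in (j < X)%N]e1 [X in (i < X)%N]e1 !ltnS !leqn0.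
        by move=> /eqP j0 /eqP i0; rewrite /= i0 j0.
      pose i0 : 'I_(dim e) := Ordinal e0.
      have : z ord0 i0 ^+ 2 = 1.
        rewrite -z1 (bigD1 i0)//= big1 ?addr0// => i /eqP; case; apply: val_inj.
        by have := ltn_ord i; rewrite [X in (_ < X)%N]e1 ltnS leqn0 => /eqP.
      move=> /eqP; rewrite sqrf_eq1 => /orP[]/eqP zi0; [left|right]; apply/rowP => i;
        by rewrite mxE (zi i i0).
    have u0 (z : 'rV[R]_(dim e)) : enorm z = 1 -> u (chi z) = 0.
      by move=> /cell_dim_sphere; rewrite e1 ltnS => zd; exact: ub.
    move=> x1 y1; rewrite f'E /= !u0// !subr0.
    have [->|->] := unit1 _ x1; have [->|->] := unit1 _ y1; rewrite ?fcst ?f1//.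
    by rewrite seg_cobN// f1// oppr0.
  have e2 : (1 < dim e)%N by rewrite ltn_neqAle eq_sym e1.
  have arc (v w : 'rV[R]_(dim e)) : enorm v = 1 -> enorm w = 1 -> w != - v ->
      f' (seg (chic e) v w) = 0.
    move=> v1 w1 wv.
    have cq : continuous (fun t : R^o => sphere_proj (line_map v w t)).
      move=> t; apply: (@continuous_comp _ _ _ (line_map v w)).
        exact: line_map_continuous.
      by apply: sphere_proj_cvg; exact: line_map_neq0.
    rewrite -[X in seg _ X _](_ : continuous_map cq 0 = v); last first.
      by rewrite /= /line_map subr0 scale1r scale0r addr0 sphere_proj_id.
    rewrite -[X in seg _ _ X](_ : continuous_map cq 1 = w); last first.
      by rewrite /= /line_map subrr scale0r scale1r add0r sphere_proj_id.
    rewrite -closed_path//.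
    apply: (f'zero (fun k => (k < dim e)%N)) => [m k mk|c ce p q|t].
    - exact: leq_ltn_trans.
    - by apply: IH; exact: leq_trans ce _.
    - by apply: cell_dim_sphere; exact: enorm_sphere_proj.
  move=> x1 y1; have [yx|] := eqVneq y (- x); last exact: arc.
  have [z [z1 zx zx']] := third_unit x e2.
  rewrite -(closed_seg _ x z y df') !arc ?addr0//.
  by rewrite yx eqr_opp eq_sym.
exists (cochain0 u); apply: exactP => p; apply/eqP; rewrite -subr_eq0 -f'E.
by apply/eqP/(f'zero xpredT) => // e _; exact: f'cell.
Qed.

End Exactness.

(** * Homotopy of paths *)

Section PathGroupoid.
Variables (R : realType) (X : topologicalType).
Local Notation path := (continuousType R^o X).
Local Notation homotopic := (@path_homotopic R X).
Implicit Types (p q r : path) (t : R).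

Definition clamp01 (t : R^o) : R^o := Num.max 0 (Num.min 1 t).

Lemma clamp01_continuous : continuous clamp01.
Proof.
move=> t; apply: (@continuous_max _ _ (fun=> 0)); first exact: cst_continuous.
by apply: (@continuous_min _ _ (fun=> 1)); [exact: cst_continuous|exact: cvg_id].
Qed.

Lemma clamp01_in t : 0 <= clamp01 t <= 1.
Proof. by rewrite le_max lexx /= ge_max ler01 ge_min lexx. Qed.

Lemma clamp01_id t : 0 <= t <= 1 -> clamp01 t = t.
Proof. by move=> t01; rewrite /clamp01 min_r ?max_r//; lra. Qed.

Fact path_cat_continuous (p q : path) : p 1 = q 0 ->
  continuous (fun t : R^o => if t <= 2^-1 then p (2 * t) else q (2 * t - 1)).
Proof.
move=> pq t.
have c2 : {for t, continuous (fun t : R^o => 2 * t : R^o)}.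
  by apply: (@cvgM _ _ _ _ (fun=> 2) id); [exact: cst_continuous|exact: cvg_id].
have c3 : {for t, continuous (fun t : R^o => 2 * t - 1 : R^o)}.
  exact: (continuousB c2 (@cst_continuous _ R^o 1 t)).
apply: (paste_continuous (r := id)) => [|_|_|/= ->]; first exact: cvg_id.
- by apply: (continuous_comp c2); exact: cts_fun.
- by apply: (continuous_comp c3); exact: cts_fun.
- by rewrite mulfV ?pnatr_eq0// subrr.
Qed.

(* Meaningful only when [p 1 = q 0]. *)
Definition path_cat (p q : path) : path :=
  match pselect (p 1 = q 0) with
  | left pq => continuous_map (path_cat_continuous pq)
  | right _ => p
  end.

Lemma path_catE p q t : p 1 = q 0 ->
  path_cat p q t = if t <= 2^-1 then p (2 * t) else q (2 * t - 1).
Proof. by rewrite /path_cat; case: pselect. Qed.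

Lemma path_cat0 p q : p 1 = q 0 -> path_cat p q 0 = p 0.
Proof. by move=> pq; rewrite path_catE// invr_ge0 ler0n mulr0. Qed.

Lemma path_cat1 p q : p 1 = q 0 -> path_cat p q 1 = q 1.
Proof.
move=> pq; rewrite path_catE// ifN; first by congr (q _); lra.
by rewrite -ltNge; lra.
Qed.

Lemma seg_catl p q : p 1 = q 0 -> seg (path_cat p q) 0 2^-1 = seg p 0 1.
Proof.
move=> pq; apply: eq_seg => t t01; rewrite !scaler0 !add0r path_catE//.
rewrite -[_ *: 2^-1]/(t * 2^-1) -[_ *: 1]/(t * 1) ifT; last lra.
by congr (p _); field.
Qed.

Lemma seg_catr p q : p 1 = q 0 -> seg (path_cat p q) 2^-1 1 = seg q 0 1.
Proof.
move=> pq; apply: eq_seg => t t01; rewrite scaler0 add0r path_catE//.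
rewrite -[_ *: 2^-1]/(_ * 2^-1) -![_ *: 1]/(t * 1); case: ifPn => [t2|_].
  have -> : t = 0 by lra.
  by rewrite (_ : 2 * _ = 1) ?pq; [congr (q _); lra|field].
by congr (q _); field.
Qed.

Fact path_rev_continuous (p : path) : continuous (fun t : R^o => p (1 - t)).
Proof.
move=> t; apply: (@continuous_comp _ _ _ (fun t : R^o => 1 - t : R^o) p).
  exact: (continuousB (@cst_continuous _ R^o 1 t) cvg_id).
exact: cts_fun.
Qed.

Definition path_rev (p : path) : path := continuous_map (@path_rev_continuous p).

Lemma path_rev0 p : path_rev p 0 = p 1. Proof. by rewrite /= subr0. Qed.
Lemma path_rev1 p : path_rev p 1 = p 0. Proof. by rewrite /= subrr. Qed.

Lemma homotopic_ext p q : (forall t, 0 <= t <= 1 -> p t = q t) -> homotopic p q.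
Proof.
move=> pq; have cK : continuous (fun u : R^o * R^o => p u.2).
  by move=> u; apply: (@continuous_comp _ _ _ snd p); [exact: cvg_snd|exact: cts_fun].
by exists (continuous_map cK); split=> t t01 //=; rewrite pq.
Qed.

Lemma homotopic_clamp p q : homotopic p q ->
  exists K : continuousType (R^o * R^o)%type X,
    [/\ forall t, K (0, t) = p (clamp01 t), forall t, K (1, t) = q (clamp01 t),
        forall s, K (s, 0) = p 0 & forall s, K (s, 1) = p 1].
Proof.
move=> [K [Kt Ks]].
have cc : continuous (fun u : R^o * R^o => K (clamp01 u.1, clamp01 u.2)).
  move=> u; apply: (@continuous_comp _ _ _ (fun u => (clamp01 u.1, clamp01 u.2)) K).
    apply: continuous_pair; apply: continuous_comp;
      by [exact: cvg_fst|exact: cvg_snd|exact: clamp01_continuous].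
  exact: cts_fun.
have i0 : 0 <= (0 : R) <= 1 by rewrite lexx ler01.
have i1 : 0 <= (1 : R) <= 1 by rewrite lexx ler01.
exists (continuous_map cc); split=> t /=.
- by rewrite (clamp01_id i0) (Kt _ (clamp01_in t)).1.
- by rewrite (clamp01_id i1) (Kt _ (clamp01_in t)).2.
- by rewrite (clamp01_id i0) (Ks _ (clamp01_in t)).1.
- by rewrite (clamp01_id i1) (Ks _ (clamp01_in t)).2.
Qed.

Lemma homotopic_ends p q : homotopic p q -> p 0 = q 0 /\ p 1 = q 1.
Proof.
move=> [K [Kt Ks]]; have i0 : 0 <= (0 : R) <= 1 by rewrite lexx ler01.
have i1 : 0 <= (1 : R) <= 1 by rewrite lexx ler01.
by rewrite -(Ks 1 i1).1 -(Ks 1 i1).2 (Kt 0 i0).2 (Kt 1 i1).2.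
Qed.

Lemma homotopic_sym p q : homotopic p q -> homotopic q p.
Proof.
move=> pq; have [p0 p1] := homotopic_ends pq; have [K [Kt Ks]] := pq.
have cK : continuous (fun u : R^o * R^o => K (1 - u.1, u.2)).
  move=> u; apply: (@continuous_comp _ _ _ (fun u : R^o * R^o => (1 - u.1 : R^o, u.2)) K).
    apply: continuous_pair; last exact: cvg_snd.
    by apply: (@continuousB _ R^o); [exact: cst_continuous|exact: cvg_fst].
  exact: cts_fun.
exists (continuous_map cK); split=> t t01 /=.
  by rewrite subr0 subrr; have [] := Kt t t01.
by rewrite -p0 -p1; apply: Ks; lra.
Qed.

Lemma homotopic_trans q p r : homotopic p q -> homotopic q r -> homotopic p r.
Proof.
move=> pq qr; have [pq0 pq1] := homotopic_ends pq.
have [K [K0 K1 Kl Kr]] := homotopic_clamp pq.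
have [L [L0 L1 Ll Lr]] := homotopic_clamp qr.
have cM : continuous (fun u : R^o * R^o =>
    if u.1 <= 2^-1 then K (2 * u.1, u.2) else L (2 * u.1 - 1, u.2)).
  move=> u; have c1 : {for u, continuous (fst : R^o * R^o -> R^o)} by exact: cvg_fst.
  have c2 : {for u, continuous (snd : R^o * R^o -> R^o)} by exact: cvg_snd.
  have cd : {for u, continuous (fun u : R^o * R^o => 2 * u.1 : R^o)}.
    by apply: (@cvgM _ _ _ _ (fun=> 2) fst); [exact: cst_continuous|exact: c1].
  have ce := continuousB cd (@cst_continuous _ R^o 1 u).
  apply: (paste_continuous (r := fst)) => // [_|_|u1].
  - by apply: (continuous_comp (continuous_pair cd c2)); exact: cts_fun.
  - by apply: (continuous_comp (continuous_pair ce c2)); exact: cts_fun.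
  - by rewrite u1 mulfV ?pnatr_eq0// subrr K1 L0.
have h0 : (0 : R) <= 2^-1 by rewrite invr_ge0 ler0n.
have h1 : ((1 : R) <= 2^-1) = false by apply/negbTE; rewrite -ltNge; lra.
exists (continuous_map cM); split=> t t01 /=.
  rewrite h0 h1 mulr0 mulr1 (_ : 2 - 1 = 1); last lra.
  by rewrite K0 L1 clamp01_id.
by case: ifP => _; rewrite ?Kl ?Kr// Ll Lr pq0 pq1.
Qed.

Lemma homotopic_cat p p' q q' : p 1 = q 0 -> homotopic p p' -> homotopic q q' ->
  homotopic (path_cat p q) (path_cat p' q').
Proof.
move=> pq pp' qq'; have [pp0 pp1] := homotopic_ends pp'.
have [qq0 qq1] := homotopic_ends qq'.
have [K [K0 K1 Kl Kr]] := homotopic_clamp pp'.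
have [L [L0 L1 Ll Lr]] := homotopic_clamp qq'.
have cM : continuous (fun u : R^o * R^o =>
    if u.2 <= 2^-1 then K (u.1, 2 * u.2) else L (u.1, 2 * u.2 - 1)).
  move=> u; have c1 : {for u, continuous (fst : R^o * R^o -> R^o)} by exact: cvg_fst.
  have c2 : {for u, continuous (snd : R^o * R^o -> R^o)} by exact: cvg_snd.
  have cd : {for u, continuous (fun u : R^o * R^o => 2 * u.2 : R^o)}.
    by apply: (@cvgM _ _ _ _ (fun=> 2) snd); [exact: cst_continuous|exact: c2].
  have ce := continuousB cd (@cst_continuous _ R^o 1 u).
  apply: (paste_continuous (r := snd)) => // [_|_|u1].
  - by apply: (continuous_comp (continuous_pair c1 cd)); exact: cts_fun.
  - by apply: (continuous_comp (continuous_pair c1 ce)); exact: cts_fun.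
  - by rewrite u1 mulfV ?pnatr_eq0// subrr Kr Ll.
have h0 : (0 : R) <= 2^-1 by rewrite invr_ge0 ler0n.
have h1 : ((1 : R) <= 2^-1) = false by apply/negbTE; rewrite -ltNge; lra.
have pq' : p' 1 = q' 0 by rewrite -pp1 -qq0.
exists (continuous_map cM); split=> t t01 /=.
  rewrite !path_catE// K0 K1 L0 L1; case: ifP => t2.
    by rewrite clamp01_id//; lra.
  by move/negbT: t2; rewrite -ltNge => t2; rewrite clamp01_id//; lra.
rewrite h0 h1 mulr0 mulr1 (_ : 2 - 1 = 1); last lra.
by rewrite Kl Lr path_cat0// path_cat1.
Qed.

Let max_map (f g : R^o -> R^o) (cf : continuous f) (cg : continuous g) :
  continuous (fun t => Num.max (f t) (g t) : R^o).
Proof. by move=> t; apply: continuous_max; [exact: cf|exact: cg]. Qed.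

Let affine_map1 (a b : R) : continuous (fun t : R^o => a * t + b : R^o).
Proof.
move=> t; apply: (@continuousD _ R^o); last exact: cst_continuous.
by apply: (@cvgM _ _ _ _ (fun=> a) id); [exact: cst_continuous|exact: cvg_id].
Qed.

(** Both paths run along [F] with parameters that agree at the ends, and the two parameters are
    joined by a straight-line homotopy in the line. *)
Lemma homotopic_reparam (p q : path) (c c' : R^o -> R^o) :
  continuous c -> continuous c' -> c 0 = c' 0 -> c 1 = c' 1 -> forall (F : path),
  (forall t, 0 <= t <= 1 -> p t = F (c t)) ->
  (forall t, 0 <= t <= 1 -> q t = F (c' t)) -> homotopic p q.
Proof.
move=> cc cc' c0 c1 F Fp Fq.
apply: (@homotopic_trans (F \o continuous_map cc)); first exact: homotopic_ext.
apply: (@homotopic_trans (F \o continuous_map cc')); first exact: line_homotopy.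
by apply: homotopic_ext => t t01; rewrite Fq.
Qed.

Lemma homotopic_catA p q r : p 1 = q 0 -> q 1 = r 0 ->
  homotopic (path_cat (path_cat p q) r) (path_cat p (path_cat q r)).
Proof.
move=> pq qr; have pqr : path_cat p q 1 = r 0 by rewrite path_cat1.
have pqr' : p 1 = path_cat q r 0 by rewrite path_cat0.
(* The maximum is the piecewise linear map that takes [0, 1/2], [1/2, 3/4], [3/4, 1] to [0, 1/4],
   [1/4, 1/2], [1/2, 1], from the schedule of the right-hand side to that of the left-hand side. *)
apply: (@homotopic_reparam _ _ (fun t => 1 * t + 0) (fun t => Num.max (2^-1 * t + 0)
  (Num.max (1 * t + - 4^-1) (2 * t + - 1))) _ _ _ _ (path_cat (path_cat p q) r)).
- exact: affine_map1.
- by do 2?[apply: max_map]; exact: affine_map1.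
- by rewrite !mulr0 !add0r max_l// ge_max; lra.
- rewrite (@max_r _ R (1 * 1 + - _)); last lra.
  by rewrite (@max_r _ R); lra.
- by move=> t _; rewrite mul1r addr0.
move=> t t01; rewrite path_catE//.
have [t2|t2] := leP t 2^-1.
  rewrite max_l ?ge_max; last lra.
  rewrite [RHS]path_catE// ifT; last lra.
  rewrite path_catE// ifT; last lra.
  by congr (p _); field.
rewrite path_catE//; have [t3|t3] := leP t (3 / 4).
  rewrite (@max_l _ R (1 * t + _)); last lra.
  rewrite (@max_r _ R); last lra.
  rewrite ifT; last lra.
  rewrite [RHS]path_catE// ifT; last lra.
  rewrite path_catE//; case: ifPn => [t4|_]; last by congr (q _); field.
  have -> : t = 2^-1 by lra.
  rewrite (_ : 2 * (2 * _) = 1) ?pq; last by field.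
  by congr (q _); field.
rewrite (@max_r _ R (1 * t + _)); last lra.
rewrite (@max_r _ R); last lra.
rewrite ifF; last by apply/negbTE; rewrite -ltNge; lra.
by rewrite [RHS]path_catE// ifF//; apply/negbTE; rewrite -ltNge; lra.
Qed.

Lemma homotopic_cat_rev p : homotopic (path_cat (path_rev p) p) (cst (p 1)).
Proof.
have pp : path_rev p 1 = p 0 by rewrite path_rev1.
(* The parameter is |2t - 1|, which equals 1 at both ends, like the constant 1. *)
apply: (@homotopic_reparam _ _ (fun t => Num.max (- 2 * t + 1) (2 * t + - 1))
  (fun=> 1) _ _ _ _ p) => //.
- by apply: max_map; exact: affine_map1.
- by move=> t; exact: cst_continuous.
- by rewrite !mulr0 !add0r max_l//; lra.
- by rewrite max_r; lra.
move=> t t01; rewrite path_catE//; case: (leP t 2^-1) => t2 /=.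
  by rewrite max_l; [congr (p _); ring|lra].
by rewrite max_r//; lra.
Qed.

Lemma homotopic_cat_cst q : homotopic (path_cat (cst (q 0)) q) q.
Proof.
apply: (@homotopic_reparam _ _ (fun t => Num.max (0 * t + 0) (2 * t + - 1))
  (fun t => 1 * t + 0) _ _ _ _ q).
- by apply: max_map; exact: affine_map1.
- exact: affine_map1.
- by rewrite !mulr0 !add0r max_l//; lra.
- by rewrite max_r; lra.
- move=> t t01; rewrite path_catE//; case: (leP t 2^-1) => t2 /=.
    by rewrite max_l; [rewrite mul0r addr0|lra].
  by rewrite max_r//; lra.
- by move=> t _; rewrite mul1r addr0.
Qed.

(** In the plane, the two legs of the triangle are joined to its hypotenuse by a straight-line
    homotopy, which [F] carries to X. *)
Lemma homotopic_tri (F : continuousType (R^o * R^o)%type X) (p q r : path) :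
  (forall t, 0 <= t <= 1 -> p t = F (t, 0)) ->
  (forall t, 0 <= t <= 1 -> q t = F (1, t)) ->
  (forall t, 0 <= t <= 1 -> r t = F (t, t)) ->
  homotopic (path_cat p q) r.
Proof.
move=> Fp Fq Fr.
have pq : p 1 = q 0 by rewrite Fp ?Fq// ?lexx ?ler01.
have c1 : continuous (fun t : R^o => Num.min 1 (2 * t + 0) : R^o).
  move=> t; apply: (@continuous_min R R^o (fun=> 1) (fun t => 2 * t + 0)).
    exact: cst_continuous.
  exact: affine_map1.
have c2 : continuous (fun t : R^o => Num.max (0 * t + 0) (2 * t + - 1) : R^o).
  by apply: max_map; exact: affine_map1.
have cc := fun t => continuous_pair (c1 t) (c2 t).
have cd : continuous (fun t : R^o => (t, t)).
  by move=> t; exact: (continuous_pair (f := id) (g := id) cvg_id cvg_id).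
apply: (@homotopic_trans (F \o continuous_map cc)).
  apply: homotopic_ext => t t01; rewrite path_catE//=.
  case: (leP t 2^-1) => t2 /=.
    rewrite min_r ?max_l; [|lra|lra].
    by rewrite mul0r !addr0 Fp//; lra.
  rewrite min_l ?max_r; [|lra|lra].
  by rewrite Fq//; lra.
apply: (@homotopic_trans (F \o continuous_map cd)).
  apply: line_homotopy => /=; congr (_, _).
  - by rewrite mulr0 addr0 min_r.
  - by rewrite !mulr0 !add0r max_l//; lra.
  - by rewrite min_l//; lra.
  - by rewrite max_r; lra.
by apply: homotopic_ext => t t01 /=; rewrite Fr.
Qed.

End PathGroupoid.

Lemma cw_path_connected (R : realType) (M : topologicalType) (S : cw_structure R M) :
  connected [set: M] ->
  forall x y : M, exists p : continuousType R^o M, p 0 = x /\ p 1 = y.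
Proof.
move=> cM x y; pose A := [set y | exists p : continuousType R^o M, p 0 = x /\ p 1 = y].
suff : A = setT by move=> AT; have : A y by rewrite AT.
apply: (connected_cells (S := S)) => //; first by exists x, (cst x).
move=> e a b [p [p0 p1]].
pose l := continuous_map (@line_map_continuous R 'rV[R]_(dim e) a b).
pose q : continuousType R^o M := chic e \o l.
have q0 : q 0 = chi a by rewrite /= /line_map subr0 scale1r scale0r addr0.
have q1 : q 1 = chi b by rewrite /= /line_map subrr scale1r scale0r add0r.
have pq : p 1 = q 0 by rewrite p1 q0.
by exists (path_cat p q); rewrite path_cat0// path_cat1.
Qed.

(** * From paths to the fundamental group *)

Section Holonomy.
Variables (R : realType) (X : topologicalType) (x0 : X) (G : groupType).
Hypothesis pathX : forall x y : X, exists p : continuousType R^o X, p 0 = x /\ p 1 = y.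
Local Notation path := (continuousType R^o X).
Local Notation homotopic := (@path_homotopic R X).
Local Notation C := R[i].
Implicit Types (p q r : path) (t : R).

Definition is_loop p := p 0 = x0 /\ p 1 = x0.

Lemma pi1_loops : pi1_isomorphic R x0 G -> exists hol : path -> G,
  [/\ forall p q, is_loop p -> is_loop q -> (hol p = hol q <-> homotopic p q),
      forall g, exists2 p, is_loop p & hol p = g &
      forall p q, is_loop p -> is_loop q -> hol (path_cat p q) = (hol p * hol q)%g].
Proof.
move=> [h [hE hS hM]]; pose lft p (v : 'rV[R]_1) : X := p (v ord0 ord0).
have cv : continuous (fun v : 'rV[R]_1 => v ord0 ord0 : R^o) by exact: coord_continuous.
have sph p : is_loop p -> spheroid x0 (lft p).
  move=> [p0 p1]; split.
    apply: continuous_subspaceT => v.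
    by apply: (@continuous_comp _ _ _ _ p); [exact: cv|exact: cts_fun].
  by move=> v [_ [j]]; rewrite (ord1 j) /lft => -[] ->.
have cv2 (u : R * 'rV[R]_1) :
    {for u, continuous (fun u : R * 'rV[R]_1 => u.2 ord0 ord0 : R^o)}.
  have c2 : {for u, continuous (snd : R * 'rV[R]_1 -> 'rV[R]_1)} by exact: cvg_snd.
  exact: (continuous_comp c2 (cv _)).
have i0 : 0 <= (0 : R) <= 1 by rewrite lexx ler01.
have i1 : 0 <= (1 : R) <= 1 by rewrite lexx ler01.
exists (h \o lft); split=> [p q lp lq|g|p q lp lq] /=.
- rewrite hE; [|exact: sph|exact: sph]; split=> [[K [cK Kt Ks]]|[K [Kt Ks]]].
    have cL : continuous (fun u : R^o * R^o => K (clamp01 u.1, const_mx (clamp01 u.2))).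
      move=> u.
      have c1 : {for u, continuous (fun u : R^o * R^o => clamp01 u.1)}.
        by apply: continuous_comp; [exact: cvg_fst|exact: clamp01_continuous].
      have c0 : {for u, continuous (fun u : R^o * R^o => clamp01 u.2)}.
        by apply: continuous_comp; [exact: cvg_snd|exact: clamp01_continuous].
      have c2 : {for u, continuous (fun u : R^o * R^o => const_mx (clamp01 u.2) : 'rV[R]_1)}.
        apply: cvg_rV => j; rewrite mxE; under eq_cvg do rewrite mxE.
        exact: c0.
      apply: (within_continuous_comp cK (continuous_pair c1 c2)).
      move=> v; split=> /=; first by rewrite in_itv /= clamp01_in.
      by move=> i; rewrite mxE clamp01_in.
    have cb t : 0 <= t <= 1 -> cube (const_mx t : 'rV[R]_1) by move=> t01 i; rewrite mxE.
    exists (continuous_map cL); split=> t t01 /=.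
      rewrite (clamp01_id i0) (clamp01_id i1) (clamp01_id t01).
      by have [-> ->] := Kt _ (cb _ t01); rewrite /lft !mxE.
    rewrite (clamp01_id i0) (clamp01_id i1) (clamp01_id t01).
    rewrite lp.1 lp.2 !Ks//; split; try exact: cb; exists ord0; rewrite mxE;
      by [left|right].
  exists (fun u : R * 'rV[R]_1 => K (u.1, u.2 ord0 ord0)); split.
  + apply: continuous_subspaceT => u.
    have c1 : {for u, continuous (fst : R * 'rV[R]_1 -> R^o)} by exact: cvg_fst.
    exact: (continuous_comp (continuous_pair c1 (cv2 u)) (@cts_fun _ _ K _)).
  + by move=> v /(_ ord0) v01 /=; exact: Kt.
  + move=> s v s01 [_ [j]]; rewrite (ord1 j) /= => -[] ->.
      by rewrite (Ks s s01).1 lp.1.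
    by rewrite (Ks s s01).2 lp.2.
- have [f [cf fb] fg] := hS g.
  have cp : continuous (fun t : R^o => f (const_mx (clamp01 t))).
    move=> t; apply: (within_continuous_comp cf
      (g := fun t : R^o => const_mx (clamp01 t) : 'rV[R]_1)).
      apply: cvg_rV => j; rewrite mxE; under eq_cvg do rewrite mxE.
      exact: clamp01_continuous.
    by move=> y i; rewrite mxE clamp01_in.
  have lp : is_loop (continuous_map cp).
    split; rewrite /= clamp01_id//; apply: fb; split=> [i|]; rewrite ?mxE//;
      exists ord0; rewrite mxE; by [left|right].
  exists (continuous_map cp) => //; rewrite -fg.
  apply/hE; [exact: sph|by split|].
  exists (fun u : R * 'rV[R]_1 => lft (continuous_map cp) u.2); split.
  + apply: continuous_subspaceT => u.
    exact: (continuous_comp (cv2 u) (@cts_fun _ _ (continuous_map cp) _)).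
  + move=> v v01; split=> //=; rewrite /lft /=; congr f.
    by apply/rowP => i; rewrite mxE (ord1 i) clamp01_id.
  + by move=> s v _ vb; exact: (sph _ lp).2.
- rewrite -hM; [|exact: sph|exact: sph]; congr h; apply/funext => v.
  have pq : p 1 = q 0 by rewrite lp.2 lq.1.
  by rewrite /lft /loop_concat path_catE// !mxE.
Qed.

Lemma seg_path_seg (V : normedModType R) (F : continuousType V X) a b t :
  0 <= t <= 1 -> seg_path (seg F a b) t = F ((1 - t) *: a + t *: b).
Proof.
move=> t01; rewrite /= /affine_simplex_fun /= !big_ord_recl big_ord0 addr0 !mxE /=.
by rewrite -[Num.max _ _]/(clamp01 t) clamp01_id.
Qed.

(** [rho] closes a path up to a loop at [x0] by means of chosen paths [gam] from [x0] to its ends;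
    [L] chooses a loop in each class. As [gam x0] is an arbitrary loop, [rho (L g)] is only a
    conjugate of g, whence the detour through additive [phi]. The last item is meant for primitives
    of cup products. *)
Lemma holonomy : pi1_isomorphic R x0 G ->
  exists (rho : singular_simplex R X 1 -> G) (L : G -> singular_simplex R X 1),
  [/\ forall (u : X -> C) g, singular_coboundary (cochain0 u) (L g) = 0,
      forall F : continuousType (R^o * R^o)%type X,
        rho (seg F (0, 0) (1, 1)) =
          (rho (seg F (0, 0) (1, 0))%R * rho (seg F (1, 0) (1, 1))%R)%g,
      forall f : singular_cochain R X 1, singular_coboundary f = 0 ->
        exists (phi : G -> C) (u : X -> C),
          (forall a b, phi (a * b)%g = phi a + phi b) /\
          f = (phi \o rho : singular_cochain R X 1) + singular_coboundary (cochain0 u),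
      forall phi : G -> C, (forall a b, phi (a * b)%g = phi a + phi b) ->
        forall g, phi (rho (L g)) = phi g &
      forall h : singular_cochain R X 1, normalized h -> forall a b,
        exists (F : path) (x y z : R^o),
          [/\ seg F x y = L a, seg F y z = L b & h (seg F x z) = h (L (a * b)%g)]].
Proof.
move=> /pi1_loops[hol [holE holS holM]].
have loop_cat p q : is_loop p -> is_loop q -> is_loop (path_cat p q).
  move=> [p0 p1] [q0 q1]; have pq : p 1 = q 0 by rewrite p1 q0.
  by split; rewrite ?(path_cat0 pq) ?(path_cat1 pq).
pose gam x := projT1 (cid (pathX x0 x)).
have gam0 x : gam x 0 = x0 by rewrite /gam; case: cid => p [].
have gam1 x : gam x 1 = x by rewrite /gam; case: cid => p [].
pose tail p := path_cat p (path_rev (gam (p 1))).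
pose whisk p := path_cat (gam (p 0)) (tail p).
have t1 p : p 1 = path_rev (gam (p 1)) 0 by rewrite path_rev0 gam1.
have t0 p : gam (p 0) 1 = tail p 0 by rewrite gam1 /tail path_cat0.
have te p : tail p 1 = x0 by rewrite /tail path_cat1// path_rev1 gam0.
have wl p : is_loop (whisk p) by split; rewrite /whisk ?(path_cat0 (t0 p)) ?(path_cat1 (t0 p)).
pose rh p := hol (whisk p).
have hrefl p : homotopic p p by exact: homotopic_ext.
have rhE p q : homotopic p q -> rh p = rh q.
  move=> pq; have [e0 e1] := homotopic_ends pq; apply/holE => //.
  have p1 : p 1 = path_rev (gam (q 1)) 0 by rewrite path_rev0 gam1.
  rewrite /whisk /tail e0 e1; apply: homotopic_cat => //.
    by rewrite path_cat0// gam1.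
  exact: homotopic_cat.
have rhM p q : p 1 = q 0 -> rh (path_cat p q) = (rh p * rh q)%g.
  move=> pq; rewrite /rh -holM//; apply/holE => //.
    exact: loop_cat.
  have pq0 : path_cat p q 0 = p 0 by rewrite path_cat0.
  have pq1 : path_cat p q 1 = q 1 by rewrite path_cat1.
  have wq : tail p 1 = whisk q 0 by rewrite te (wl q).1.
  have rg : path_rev (gam (p 1)) 1 = whisk q 0 by rewrite path_rev1 gam0 (wl q).1.
  have tq : path_rev (gam (p 1)) 1 = gam (q 0) 0 by rewrite path_rev1 !gam0.
  have pt : p 1 = tail q 0 by rewrite /tail path_cat0.
  (* After reassociation, the inner factors [path_rev (gam (p 1))] and [gam (q 0)] cancel. *)
  apply: homotopic_sym; apply: homotopic_trans (homotopic_catA _ _) _ => //.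
  rewrite {2}/whisk pq0; apply: homotopic_cat => //; first by rewrite path_cat0// t0.
  apply: homotopic_trans (homotopic_catA _ _) _ => //.
  apply: (@homotopic_trans _ _ (path_cat p (tail q))).
    apply: homotopic_cat => //; first by rewrite path_cat0// path_rev0 gam1.
    apply: homotopic_trans (homotopic_sym (homotopic_catA _ _)) _ => //.
    rewrite pq; apply: (@homotopic_trans _ _ (path_cat (cst (gam (q 0) 1)) (tail q))).
      apply: homotopic_cat => //; last exact: homotopic_cat_rev.
      by rewrite path_cat1 ?path_rev1.
    by rewrite t0; exact: homotopic_cat_cst.
  rewrite /tail pq1; apply: homotopic_sym; exact: homotopic_catA.
have sl p : homotopic (seg_path (seg p 0 1)) p.
  apply: homotopic_ext => t t01; rewrite seg_path_seg// scaler0 add0r.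
  by rewrite -[_ *: 1]/(_ * 1) mulr1.
pose lp g := projT1 (cid2 (holS g)).
have lpl g : is_loop (lp g) by rewrite /lp; case: cid2.
have lpE g : hol (lp g) = g by rewrite /lp; case: cid2.
have lpM a b : homotopic (path_cat (lp a) (lp b)) (lp (a * b)%g).
  have ab : lp a 1 = lp b 0 by rewrite (lpl a).2 (lpl b).1.
  apply/holE; rewrite ?lpE ?holM ?lpE//.
  exact: loop_cat.
exists (fun s => rh (seg_path s)), (fun g => seg (lp g) 0 1); split.
- by move=> u g; rewrite coboundary_cochain0 (lpl g).1 (lpl g).2 subrr.
- move=> F; rewrite -rhM.
    apply: rhE; apply: homotopic_sym; apply: (homotopic_tri (F := F)) => t t01;
      rewrite seg_path_seg//; congr (F (_, _)) => /=;
      rewrite -?[_ *: 0]/(_ * 0) -?[_ *: 1]/(_ * 1); ring.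
  by rewrite !seg_path_seg ?lexx ?ler01// subrr !scale0r !scale1r subr0 scale1r add0r addr0.
- move=> f df; pose fl p := f (seg p 0 1).
  have flE p q : homotopic p q -> fl p = fl q.
    by move=> pq; apply: homotopic_seg => //; exact: closed_normalized.
  have flM p q : p 1 = q 0 -> fl (path_cat p q) = fl p + fl q.
    by move=> pq; rewrite /fl -(closed_seg (path_cat p q) 0 (2^-1 : R^o) 1 df) seg_catl// seg_catr.
  have flc x : fl (cst x) = 0.
    by rewrite /fl seg_const ?normalized_const//; exact: closed_normalized.
  have flV p : fl (path_rev p) = - fl p.
    apply/eqP; rewrite -addr_eq0 -flM ?path_rev1// (flE _ _ (homotopic_cat_rev p)) flc//.
  (* On the closed-up path, f takes the value f(p) plus the value on [gam (p 0)] minus that on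
     [gam (p 1)]; the last two make up the coboundary. *)
  exists (fun g => fl (lp g)), (fun x => fl (gam x)); split.
    by move=> a b; rewrite -(flE _ _ (lpM a b)) flM// (lpl a).2 (lpl b).1.
  apply/funext => s; rewrite -(seg_pathE s); move: (seg_path s) => {s} p.
  change (fl p = fl (lp (rh (seg_path (seg p 0 1)))) +
    singular_coboundary (cochain0 (fun x => fl (gam x))) (seg p 0 1)).
  rewrite coboundary_cochain0 (rhE _ _ (sl p)).
  rewrite (flE (lp _) (whisk p)); last by apply/holE; rewrite ?lpE.
  rewrite /whisk flM// /tail flM// flV.
  by rewrite /= addrA -(addrA (fl (gam (p 0)))) subrK addrAC subrr add0r.
- move=> phi phiM g /=.
  have phi1 : phi 1%g = 0.
    by have := phiM 1%g 1%g; rewrite mulg1 => /eqP; rewrite -subr_eq0 opprD addNKr oppr_eq0 => /eqP.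
  rewrite (rhE _ _ (sl _)) /rh /whisk /tail (lpl g).1 (lpl g).2.
  have l0 : is_loop (gam x0) by split.
  have l1 : is_loop (path_rev (gam x0)) by split; rewrite ?path_rev0 ?path_rev1.
  have l2 : is_loop (path_cat (lp g) (path_rev (gam x0))) by exact: loop_cat.
  rewrite !holM// !phiM lpE.
  have lc : is_loop (cst x0) by split.
  have holc : hol (cst x0) = 1%g.
    have := holM _ _ lc lc.
    have -> : hol (path_cat (cst x0) (cst x0)) = hol (cst x0).
      apply/holE => //; last exact: (homotopic_cat_cst (cst x0)).
      exact: loop_cat.
    by move=> /(congr1 (fun y => y * (hol (cst x0))^-1)%g); rewrite mulgK mulgV.
  have inv : (hol (path_rev (gam x0)) * hol (gam x0))%g = 1%g.
    rewrite -holM// -holc; apply/holE => //.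
      exact: loop_cat.
    by have := homotopic_cat_rev (gam x0); rewrite gam1.
  by rewrite addrCA [X in _ + X]addrC -phiM inv phi1 addr0.
- move=> h nh a b; have ab : lp a 1 = lp b 0 by rewrite (lpl a).2 (lpl b).1.
  exists (path_cat (lp a) (lp b)), 0, 2^-1, 1; split; first exact: seg_catl.
    exact: seg_catr.
  by apply: homotopic_seg => //; exact: lpM.
Qed.

End Holonomy.

(** * Resonance *)

Section Resonance.
Variables (R : realType) (X : topologicalType).
Local Notation C := R[i].
Local Notation E := (singular_complex R X).
Local Notation H1 := (singular_cohomology R X 1).
Local Notation cochain := (singular_cochain R X).

Lemma cocycle_class_eq0 (z : cocycle E 1) :
  cocycle_class z = 0 <-> exists g : cochain 0, singular_coboundary g = val z.
Proof.
rewrite -(linear0 (@cocycle_class _ E 1)) cocycle_classP subr0.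
by split=> [[g _ gE]|[g gE]]; exists g.
Qed.

Lemma left_mul_eq0 (z x : cocycle E 1) :
  left_mul (cocycle_class z : H1) (cocycle_class x : H1) = 0 <->
  exists h : cochain 1, singular_coboundary h = cup (val z) (val x).
Proof.
rewrite left_mulE -(linear0 (@cocycle_class _ E 2)) cocycle_classP subr0.
by split=> [[g _ gE]|[g gE]]; exists g.
Qed.

Hypothesis pathX : forall x y : X, exists p : continuousType R^o X, p 0 = x /\ p 1 = y.

(** On a path-connected space the closed 0-cochains are constant, and multiplication by a constant
    scales z. *)
Lemma range_left_mul0 (x0 : X) (z : H1) :
  range (left_mul z : singular_cohomology R X 0 -> H1) = [set c *: z | c in [set: C]].
Proof.
rewrite -[z]cocycle_reprK; move: (cocycle_repr z) => {}z.
have zc (c : C) (g : cocycle E 0) : (forall x, val g (point R x) = c) ->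
    left_mul (cocycle_class z : H1) (cocycle_class g) = c *: cocycle_class z.
  move=> gc; rewrite left_mulE -linearZ; congr cocycle_class; apply: val_inj.
  apply/funext => s; rewrite /= /cup -[restrict (@back 1 0) _]pointE gc.
  rewrite -[RHS]/(c * (val z : cochain 1) s) mulrC; congr (_ * (val z : cochain 1) _).
  rewrite -[RHS](_ : restrict id s = s); last by apply/continuousEP => t /=; congr (s _);
    apply: val_inj; apply/rowP => i; rewrite mxE (bigD1 i)//= big1 ?addr0// => j /andP[/eqP ->];
    rewrite eqxx.
  by congr restrict; apply/funext => i; apply: val_inj; rewrite /= front_val.
apply/seteqP; split=> y [].
  move=> u _ <-; rewrite -[u]cocycle_reprK; move: (cocycle_repr u) => {}u.
  have /eqP /= du := valP u.
  exists (val u (point R x0)) => //; rewrite -(zc _ u)//.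
  move=> x; have [p [p0 p1]] := pathX x0 x.
  have := coboundary_seg (val u) p 0 1; rewrite du p0 p1 => /esym/eqP.
  by rewrite subr_eq0 => /eqP.
move=> c _ <-; pose g : cochain 0 := cochain0 (fun=> c).
have dg : (g : E 0) \in @is_cocycle C E 0.
  by apply/eqP; apply/funext => s; rewrite /= -(seg_pathE s) coboundary_cochain0 subrr.
by exists (cocycle_class (exist _ (g : E 0) dg)) => //; exact: zc.
Qed.

(** The coboundaries of degree 1 in [left_mul_complex z] are the multiples of z, so independence in
    cohomology means independence modulo z of vectors annihilated by z. *)
Lemma resonanceP (x0 : X) (k : nat) (z : H1) : resonance R X 1 k z <->
  exists v : 'I_k -> H1, (forall i, left_mul z (v i) = 0) /\
    forall (a : 'I_k -> C) b, \sum_i a i *: v i = b *: z -> forall i, a i = 0.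
Proof.
pose F := left_mul_complex z.
have sumE (a : 'I_k -> C) (y : 'I_k -> cocycle F 1) :
    \sum_i a i *: cocycle_class (y i) = 0 <->
    exists b, \sum_i a i *: val (y i) = b *: z.
  have -> : \sum_i a i *: cocycle_class (y i) = cocycle_class (\sum_i a i *: y i).
    by rewrite linear_sum; apply: eq_bigr => i _; rewrite linearZ.
  rewrite -(linear0 (@cocycle_class _ F 1)) cocycle_classP subr0.
  have -> : val (\sum_i a i *: y i) = \sum_i a i *: val (y i).
    by rewrite raddf_sum.
  have rE : range (coboundary F 0) = [set c *: z | c in [set: C]] := range_left_mul0 x0 z.
  rewrite -[coboundaries _]/(range (coboundary F 0) _) rE.
  by split=> [[b _ <-]|[b ->]]; exists b.
split=> [[w wi]|[v [vz vi]]].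
  exists (fun i => val (cocycle_repr (w i))); split=> [i|a b ab].
    by have /eqP := valP (cocycle_repr (w i)).
  apply: wi; under eq_bigr do rewrite -[w _]cocycle_reprK.
  by apply/sumE; exists b.
have vz' i : (v i : F 1) \in @is_cocycle C F 1 by apply/eqP; exact: vz.
exists (fun i => cocycle_class (exist _ (v i : F 1) (vz' i) : cocycle F 1)) => a /sumE[b].
exact: vi.
Qed.

End Resonance.

Lemma resonance_transport (R : realType) (X Y : topologicalType) (x0 : X) (y0 : Y)
    (phi : {linear singular_cohomology R X 1 -> singular_cohomology R Y 1}) :
  (forall x y : X, exists p : continuousType R^o X, p 0 = x /\ p 1 = y) ->
  (forall x y : Y, exists p : continuousType R^o Y, p 0 = x /\ p 1 = y) ->
  bijective phi ->
  (forall z x, left_mul z x = 0 <-> left_mul (phi z) (phi x) = 0) ->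
  forall k, phi @` resonance R X 1 k = resonance R Y 1 k.
Proof.
move=> pX pY [psi phiK psiK] phiM k; apply/seteqP; split=> [_ [z + <-]|z].
  move=> /(resonanceP pX x0)[v [vz vi]]; apply/(resonanceP pY y0).
  exists (phi \o v); split=> [i|a b ab]; first by apply/phiM.
  apply: (vi a b); apply: (can_inj phiK); rewrite linear_sum.
  transitivity (b *: phi z); last by rewrite linearZ.
  by rewrite -ab; apply: eq_bigr => i _; rewrite linearZ.
move=> /(resonanceP pY y0)[v [vz vi]]; exists (psi z); last exact: psiK.
apply/(resonanceP pX x0); exists (psi \o v); split=> [i|a b ab].
  by apply/phiM; rewrite /= !psiK.
apply: (vi a b); transitivity (phi (b *: psi z)); last by rewrite linearZ psiK.
by rewrite -ab linear_sum; apply: eq_bigr => i _; rewrite linearZ /= psiK.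
Qed.

(** * Linear algebra *)

Section Independence.
Variables (K : fieldType) (V : lmodType K).

Definition independent n (v : 'I_n -> V) :=
  forall a : 'I_n -> K, \sum_i a i *: v i = 0 -> forall i, a i = 0.

Definition in_span n (v : 'I_n -> V) (w : V) := exists a : 'I_n -> K, w = \sum_i a i *: v i.

Lemma in_span_comb n (v : 'I_n -> V) m (a : 'I_m -> K) (w : 'I_m -> V) :
  (forall j, in_span v (w j)) -> in_span v (\sum_j a j *: w j).
Proof.
move=> /choice[c wc]; exists (fun i => \sum_j a j * c j i).
under eq_bigr do rewrite wc scaler_sumr.
rewrite exchange_big /=; apply: eq_bigr => i _; rewrite scaler_suml.
by apply: eq_bigr => j _; rewrite scalerA.
Qed.

(** In the applications [P] is not a subspace: it holds of the classes of rational cocycles, or of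
    integral relations. The point is to span it over [K] by a family taken inside it. *)
Lemma maximal_independent (P : V -> Prop) (N : nat) :
  (forall n (v : 'I_n -> V), (forall i, P (v i)) -> independent v -> (n <= N)%N) ->
  exists n (v : 'I_n -> V),
    [/\ forall i, P (v i), independent v & forall w, P w -> in_span v w].
Proof.
move=> bound.
pose Q n := `[< exists v : 'I_n -> V, (forall i, P (v i)) /\ independent v >].
have Q0 : exists n, Q n by exists 0%N; apply/asboolP; exists (fun=> 0); split=> [[]|a _ []].
have QN n : Q n -> (n <= N)%N by move=> /asboolP[v [? ?]]; exact: bound.
have [n /asboolP[v [Pv iv]] nmax] := ex_maxnP Q0 QN.
exists n, v; split=> // w Pw.
pose v' (i : 'I_n.+1) := if unlift ord0 i is Some j then v j else w.
have v'0 : v' ord0 = w by rewrite /v' unlift_none.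
have v'S j : v' (lift ord0 j) = v j by rewrite /v' liftK.
have nv' : ~ independent v'.
  move=> iv'; suff : (n.+1 <= n)%N by rewrite ltnn.
  apply: nmax; apply/asboolP; exists v'; split=> // i.
  by rewrite /v'; case: unlift.
have [a [a0 [i ai]]] : exists a : 'I_n.+1 -> K,
    \sum_i a i *: v' i = 0 /\ exists i, a i != 0.
  apply: contrapT => h; apply: nv' => a a0 i; apply/eqP; apply: contrapT => /negP ai.
  by apply: h; exists a; split=> //; exists i.
rewrite big_ord_recl v'0 in a0.
have [a00|a00] := eqVneq (a ord0) 0.
  move: a0; rewrite a00 scale0r add0r; under eq_bigr do rewrite v'S.
  move=> /iv a0; case/eqP: ai; have [j ->|->] := unliftP ord0 i; [exact: a0|exact: a00].
exists (fun j => - (a ord0)^-1 * a (lift ord0 j)).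
have : (a ord0)^-1 *: (a ord0 *: w + \sum_j a (lift ord0 j) *: v' (lift ord0 j)) = 0.
  by rewrite a0 scaler0.
rewrite scalerDr scalerA mulVf// scale1r => /eqP; rewrite addr_eq0 => /eqP ->.
rewrite -scaleNr scaler_sumr; apply: eq_bigr => j _.
by rewrite v'S scalerA.
Qed.

End Independence.

Lemma independent_le (K : fieldType) N k (r : 'I_k -> 'rV[K]_N) : independent r -> (k <= N)%N.
Proof.
move=> ir; pose Y := \matrix_i r i.
have : row_free Y.
  apply: inj_row_free => a aY; apply/rowP => i; rewrite mxE; apply: (ir (fun i => a 0 i)).
  rewrite -[RHS]aY [RHS]mulmx_sum_row; apply: eq_bigr => j _.
  by rewrite rowK.
by rewrite /row_free => /eqP <-; exact: rank_leq_col.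
Qed.

Lemma basis_linear_bij (K : fieldType) (V W : lmodType K) n (v : 'I_n -> V) (w : 'I_n -> W) :
  independent v -> (forall x, in_span v x) -> independent w -> (forall y, in_span w y) ->
  exists phi : {linear V -> W}, bijective phi /\
    forall a : 'I_n -> K, phi (\sum_i a i *: v i) = \sum_i a i *: w i.
Proof.
move=> iv /choice[c vc] iw /choice[d wd].
have uniq (U : lmodType K) (u : 'I_n -> U) : independent u -> forall a b : 'I_n -> K,
    \sum_i a i *: u i = \sum_i b i *: u i -> forall i, a i = b i.
  move=> iu a b /eqP; rewrite -subr_eq0 -sumrB => /eqP ab i; apply/eqP; rewrite -subr_eq0.
  apply/eqP; apply: (iu (fun i => a i - b i)).
  by under eq_bigr do rewrite scalerBl.
pose f x := \sum_i c x i *: w i.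
have fE (a : 'I_n -> K) : f (\sum_i a i *: v i) = \sum_i a i *: w i.
  by apply: eq_bigr => i _; congr (_ *: _); apply: (uniq _ v iv); rewrite -vc.
have fl : linear f.
  move=> k x y; rewrite {2 3}/f scaler_sumr -big_split /=.
  rewrite [x in LHS]vc [y in LHS]vc scaler_sumr -big_split /=.
  transitivity (f (\sum_i (k * c x i + c y i) *: v i)).
    by congr f; apply: eq_bigr => i _; rewrite scalerDl scalerA.
  by rewrite fE; apply: eq_bigr => i _; rewrite scalerDl scalerA.
pose fL := GRing.isLinear.Build K V W *:%R f fl.
pose phi : {linear V -> W} := HB.pack f fL.
exists phi; split; last exact: fE.
exists (fun y => \sum_i d y i *: v i) => [x|y].
  rewrite [RHS]vc; apply: eq_bigr => i _; congr (_ *: _); apply: (uniq _ w iw).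
  by rewrite -wd.
by rewrite [LHS]fE -wd.
Qed.

(** * Rational functionals on a field of characteristic 0 *)

Section RationalFunctionals.
Variable F : numFieldType.

Definition rat_linear (l : F -> rat) :=
  forall q x y, l (ratr q * x + y) = q * l x + l y.

Lemma rat_linear0 l : rat_linear l -> l 0 = 0.
Proof.
by move=> ll; have := ll (- 1) 0 0; rewrite mulr0 addr0 mulN1r addNr.
Qed.

Lemma rat_functional (c : F) : c != 0 -> exists2 l, rat_linear l & l c = 1.
Proof.
move=> c0.
(* A maximal rational subspace A that avoids c is a complement of the line of c. *)
pose P (U : set F) := (forall q x y, U x -> U y -> U (ratr q * x + y)) /\ ~ U c.
have [A [[Al Ac] Amax]] : exists A, P A /\ forall B, A `<` B -> ~ P B.
  apply: Zorn_bigcup => D DP Dtot; split; last by move=> [U /DP[_ +]].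
  move=> q x y [U DU Ux] [W DW Wy].
  have [UW|WU] := Dtot _ _ DU DW.
    by exists W => //; apply: (DP _ DW).1 => //; exact: UW.
  by exists U => //; apply: (DP _ DU).1 => //; exact: WU.
(* The empty set satisfies [P], being the union of the empty chain, so it has to be excluded: the
   set {0} would be larger. *)
have A0 : A 0.
  apply: contrapT => nA0; apply: (Amax [set 0]).
    have A_empty x : ~ A x.
      by move=> Ax; apply: nA0; have := Al (- 1) x x Ax Ax; rewrite rmorphN1 mulN1r addNr.
    by split=> [x /A_empty//|/(_ 0 erefl)/A_empty].
  split=> [q x y -> ->|/= /eqP]; first by rewrite mulr0 addr0.
  exact/negP.
have AZ q x : A x -> A (ratr q * x) by move=> Ax; rewrite -[_ * _]addr0; exact: Al.
have AD x y : A x -> A y -> A (x + y).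
  by move=> Ax Ay; have := Al 1 x y Ax Ay; rewrite rmorph1 mul1r.
have decomp x : exists q, A (x - ratr q * c).
  have [Ax|nAx] := pselect (A x); first by exists 0; rewrite rmorph0 mul0r subr0.
  (* [B] is the sum of [A] and the rational line of x; by maximality it contains c, and this is
     solved for x. *)
  pose B := [set u | exists q, A (u - ratr q * x)].
  have AB : A `<` B.
    split=> [u Au|BA]; first by exists 0; rewrite rmorph0 mul0r subr0.
    by apply: nAx; apply: BA; exists 1; rewrite rmorph1 mul1r subrr.
  have : B c.
    apply: contrapT => nBc; apply: (Amax B AB); split=> // q u w [r Ar] [s As].
    exists (q * r + s); rewrite rmorphD rmorphM.
    have -> : ratr q * u + w - (ratr q * ratr r + ratr s) * x =
       ratr q * (u - ratr r * x) + (w - ratr s * x) by ring.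
    exact: Al.
  move=> [q Aq]; have q0 : q != 0.
    by apply: contra_notN Ac => /eqP q0; move: Aq; rewrite q0 rmorph0 mul0r subr0.
  exists q^-1; have -> : x - ratr q^-1 * c = ratr (- q^-1) * (c - ratr q * x).
    rewrite rmorphN mulNr mulrBr mulrA -rmorphM mulVf// rmorph1 mul1r opprB.
    by [].
  exact: AZ.
have [l lP] := choice decomp.
have lU x q : A (x - ratr q * c) -> l x = q.
  move=> Aq; apply/eqP; rewrite -subr_eq0; apply: contra_notT Ac => lq.
  have -> : c = ratr (l x - q)^-1 * (x - ratr q * c + ratr (-1) * (x - ratr (l x) * c)).
    rewrite [X in _ * X](_ : _ = ratr (l x - q) * c); last by rewrite rmorphN1 rmorphB; ring.
    by rewrite mulrA -rmorphM mulVf// rmorph1 mul1r.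
  by apply: (AZ _ _); apply: AD => //; apply: AZ; exact: lP.
exists l => [q x y|].
  apply: lU; rewrite rmorphD rmorphM.
  have -> : ratr q * x + y - (ratr q * ratr (l x) + ratr (l y)) * c =
     ratr q * (x - ratr (l x) * c) + (y - ratr (l y) * c) by ring.
  by apply: Al; exact: lP.
by apply: lU; rewrite rmorph1 mul1r subrr.
Qed.

(** Subtracting [l0 x] times [x0] is a rational projection that kills [x0], so induction applies to
    the image of the rest of the list. The functionals are defined on all of [F], because they will
    be applied to all the values of a cochain, not just to those in the list. *)
Lemma rational_coordinates (s : seq F) : exists m (b : nat -> F) (l : nat -> F -> rat),
  (forall i, rat_linear (l i)) /\
  forall x, x \in s -> x = \sum_(i < m) ratr (l i x) * b i.
Proof.
have [k] := ubnP (size s); elim: k s => // k IH [|x0 s] sk.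
  by exists 0%N, (fun=> 0), (fun _ _ => 0); split=> // i q x y; rewrite mulr0 addr0.
have [x00|x00] := eqVneq x0 0.
  have [m [b [l [ll sl]]]] := IH s sk; exists m, b, l; split=> // x.
  rewrite inE => /orP[/eqP ->|]; last exact: sl.
  by rewrite x00 big1// => i _; rewrite rat_linear0// rmorph0 mul0r.
have [l0 ll0 l01] := rat_functional x00.
pose r x := x - ratr (l0 x) * x0.
have [|m [b [l [ll sl]]]] := IH (map r s); first by rewrite size_map.
exists m.+1, (fun i => if i is j.+1 then b j else x0),
  (fun i => if i is j.+1 then l j \o r else l0); split=> [[//|i] q x y|x].
  rewrite /= -ll; congr (l i _); rewrite /r ll0 rmorphD rmorphM; ring.
rewrite inE big_ord_recl /= => /orP[/eqP ->|xs].
  rewrite l01 rmorph1 mul1r big1 ?addr0// => i _.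
  by rewrite /r l01 rmorph1 mul1r subrr rat_linear0// rmorph0 mul0r.
by rewrite -sl ?map_f// /r addrC subrK.
Qed.

End RationalFunctionals.

Lemma common_denominator (s : seq rat) : exists2 d : int, d != 0 &
  forall q, q \in s -> exists z : int, d%:~R * q = z%:~R.
Proof.
elim: s => [|q s [d d0 ds]]; first by exists 1.
exists (d * denq q); first by rewrite mulf_neq0.
move=> r; rewrite inE => /orP[/eqP ->|/ds[z zE]].
  exists (d * numq q); rewrite !rmorphM /= -mulrA; congr (_ * _).
  by rewrite mulrC -[X in X * _]divq_num_den mulfVK// intr_eq0 denq_neq0.
by exists (z * denq q); rewrite !rmorphM mulrAC zE.
Qed.

(** * Central extensions of free abelian groups *)

Section CentralExtension.
Variables (n m : nat) (B : 'I_m -> 'M[int]_n).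

Definition pairing (v v' : 'rV[int]_n) : 'rV[int]_m :=
  \row_l (v *m B l *m v'^T) ord0 ord0.

Lemma pairingE v v' l : pairing v v' ord0 l = (v *m B l *m v'^T) ord0 ord0.
Proof. by rewrite mxE. Qed.

Lemma pairingDl v v' w : pairing (v + v') w = pairing v w + pairing v' w.
Proof. by apply/rowP => l; rewrite [RHS]mxE !pairingE !mulmxDl mxE. Qed.

Lemma pairingDr v w w' : pairing v (w + w') = pairing v w + pairing v w'.
Proof. by apply/rowP => l; rewrite [RHS]mxE !pairingE linearD mulmxDr mxE. Qed.

Lemma pairing0l v : pairing 0 v = 0.
Proof. by apply: (addIr (pairing 0 v)); rewrite -pairingDl !add0r. Qed.

Lemma pairing0r v : pairing v 0 = 0.
Proof. by apply: (addIr (pairing v 0)); rewrite -pairingDr !add0r. Qed.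

Lemma pairingNl v w : pairing (- v) w = - pairing v w.
Proof. by apply/eqP; rewrite -addr_eq0 -pairingDl addNr pairing0l. Qed.

(* The carrier does not depend on [B], which only enters the group law. *)
Definition central_ext (_ : 'I_m -> 'M[int]_n) : Type := ('rV[int]_n * 'rV[int]_m)%type.
Local Notation G := (central_ext B).

HB.instance Definition _ := Choice.on G.

Definition ext_mul (g g' : G) : G :=
  (g.1 + g'.1, g.2 + g'.2 + pairing g.1 g'.1).
Definition ext_inv (g : G) : G :=
  (- g.1, - g.2 + pairing g.1 g.1).

Fact ext_mulA : associative ext_mul.
Proof.
move=> [a u] [b v] [c w]; rewrite /ext_mul /= pairingDl pairingDr; congr (_, _).
  by rewrite addrA.
rewrite -!addrA; congr (_ + (_ + _)); rewrite [RHS]addrCA; congr (_ + _).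
by rewrite addrC -addrA.
Qed.

Fact ext_mul1 : left_id ((0, 0) : G) ext_mul.
Proof. by move=> [a u]; rewrite /ext_mul /= pairing0l !add0r addr0. Qed.

Fact ext_mulr1 : right_id ((0, 0) : G) ext_mul.
Proof. by move=> [a u]; rewrite /ext_mul /= pairing0r !addr0. Qed.

Fact ext_mulV : left_inverse ((0, 0) : G) ext_inv ext_mul.
Proof.
move=> [a u]; rewrite /ext_mul /ext_inv /= pairingNl addNr; congr (_, _).
by rewrite -!addrA (addrCA _ u) addrA addNr add0r subrr.
Qed.

Fact ext_mulrV : right_inverse ((0, 0) : G) ext_inv ext_mul.
Proof.
move=> [a u]; rewrite /ext_mul /ext_inv /=; congr (_, _); first by rewrite subrr.
have -> : pairing a (- a) = - pairing a a.
  by apply/eqP; rewrite -addr_eq0 -pairingDr addNr pairing0r.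
by rewrite addrA subrr add0r subrr.
Qed.

HB.instance Definition _ := isGroup.Build G
  ext_mulA ext_mul1 ext_mulr1 ext_mulV ext_mulrV.

Lemma ext_mulE (g g' : G) :
  (g * g')%g = (g.1 + g'.1, g.2 + g'.2 + pairing g.1 g'.1).
Proof. by []. Qed.

Lemma ext_invE (g : G) : (g^-1)%g = (- g.1, - g.2 + pairing g.1 g.1).
Proof. by []. Qed.

Lemma row_int_ind k (P : 'rV[int]_k -> Prop) :
  P 0 -> (forall v w, P v -> P w -> P (v - w)) ->
  (forall i, P (delta_mx ord0 i)) -> forall v, P v.
Proof.
move=> P0 PB Pd v.
have PN w : P w -> P (- w) by move=> Pw; rewrite -sub0r; exact: PB.
have PD w w' : P w -> P w' -> P (w + w').
  by move=> Pw /PN Pw'; rewrite -[w']opprK; exact: PB.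
have PM w j : P w -> P (w *+ j).
  by move=> Pw; elim: j => [|j IH]; rewrite ?mulr0n// mulrS; exact: PD.
rewrite [v]row_sum_delta; apply: (big_ind P) => // i _.
have -> : v ord0 i *: delta_mx ord0 i = delta_mx ord0 i *~ v ord0 i :> 'rV[int]_k.
  by rewrite -scaler_int intz.
case: (v ord0 i) => j; first by rewrite -pmulrn; exact: PM.
by rewrite NegzE mulrNz -pmulrn; apply: PN; exact: PM.
Qed.

Lemma ext_finitely_generated : finitely_generated G.
Proof.
pose A : set G := [set ((delta_mx ord0 i, 0) : G) | i in [set: 'I_n]] `|`
  [set ((0, delta_mx ord0 l) : G) | l in [set: 'I_m]].
exists A.
  by rewrite finite_setU; split; apply: finite_image; exact: finite_finset.
apply/seteqP; split=> // g _ H [H1 HV] AH.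
have Hw w : H (0, w).
  apply: (row_int_ind (P := fun w => H (0, w))) => // [u v Hu Hv|l].
    have := HV _ _ Hu Hv.
    by rewrite ext_invE ext_mulE /= pairing0l oppr0 !addr0 pairing0l addr0.
  by apply: AH; right; exists l.
have Hv v : exists w, H (v, w).
  apply: (row_int_ind (P := fun v => exists w, H (v, w))) => [|u v' [w Hu] [w' Hv']|i].
  - by exists 0.
  - by have := HV _ _ Hu Hv'; rewrite ext_invE ext_mulE /= => ?; eexists; eassumption.
  - by exists 0; apply: AH; left; exists i.
case: g => v w; have [w0 Hw0] := Hv v.
have := HV _ _ Hw0 (Hw (w0 - w)).
rewrite ext_invE ext_mulE /= pairing0l oppr0 !addr0 pairing0r addr0.
by rewrite opprB addrC subrK.
Qed.

Lemma ext_torsion_free : torsion_free G.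
Proof.
move=> [v w] k k0 vk.
have e1 j (g : G) : (g ^+ j)%g.1 = g.1 *+ j.
  by elim: j => [|j IH]; rewrite ?expg0 ?mulr0n// expgS ext_mulE /= IH mulrS.
have row0 d (u : 'rV[int]_d) : u *+ k = 0 -> u = 0.
  move=> uk; apply/rowP => i; move: (congr1 (fun u : 'rV_d => u ord0 i) uk).
  rewrite mulmxnE !mxE => /eqP; rewrite mulrn_eq0 => /orP[/eqP k00|/eqP //].
  by rewrite k00 in k0.
have v0 : v = 0 by apply: row0; rewrite -(e1 k (v, w)) vk.
have e2 j : (((0, w) : G) ^+ j)%g = (0, w *+ j).
  elim: j => [|j IH]; rewrite ?expg0 ?mulr0n// expgS IH ext_mulE /= pairing0l.
  by rewrite !addr0 mulrS.
rewrite v0 e2 in vk *; case: vk => /row0 ->; by [].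
Qed.

Lemma ext_two_step : two_step_nilpotent G.
Proof.
pose Z : set G := [set g | g.1 = 0].
have Zsub : is_subgroup Z.
  by split=> // x y x0 y0; rewrite /Z /= x0 y0 subrr.
have comm1 (x y : G) : [~ x, y]%g.1 = 0.
  by rewrite /commg /conjg !ext_mulE !ext_invE /= [x.1 + y.1]addrC addKr addNr.
have Zc (x y : G) : Z y -> [~ x, y]%g = 1%g.
  move=> y0; have xy : (x * y = y * x)%g.
    by rewrite !ext_mulE y0 pairing0l pairing0r !addr0 !add0r [y.2 + _]addrC.
  by rewrite /commg /conjg xy mulKg mulVg.
pose H2 : set G :=
  generated [set [~ x, y]%g | x in [set: G] & y in [set: G]].
rewrite /two_step_nilpotent /lower_central /= -/H2.
have H2Z : H2 `<=` Z.
  by move=> g; apply; [exact: Zsub|move=> _ [x _ [y _ <-]]; exact: comm1].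
apply/seteqP; split=> [g|_ -> H []//]; apply=> [|_ [x _ [y /H2Z Zy <-]]]; last exact: Zc.
by split=> // x y -> ->; rewrite mulgV.
Qed.

End CentralExtension.

(** * Cohomology of the central extension in degrees 1 and 2 *)

Section CentralExtensionCohomology.
Variables (F : numFieldType) (n m : nat) (B : 'I_m -> 'M[int]_n).
Hypothesis Banti : forall l i j, B l j i = - B l i j.
Local Notation G := (central_ext B).
Local Notation BF := (fun l => map_mx intr (B l) : 'M[F]_n).

Lemma pairing_delta i j l : pairing B (delta_mx ord0 i) (delta_mx ord0 j) ord0 l = B l i j.
Proof. by rewrite pairingE -rowE trmx_delta -colE !mxE. Qed.

Lemma additive_row_int k (f : 'rV[int]_k -> F) : (forall v w, f (v + w) = f v + f w) ->
  forall v, f v = \sum_i f (delta_mx ord0 i) * (v ord0 i)%:~R.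
Proof.
move=> fD v.
have f0 : f 0 = 0 by apply: (addIr (f 0)); rewrite -fD !add0r.
have fB v' w : f (v' - w) = f v' - f w.
  by apply/eqP; rewrite eq_sym subr_eq -fD subrK.
apply: (row_int_ind (P := fun v => f v = \sum_i f (delta_mx ord0 i) * (v ord0 i)%:~R)).
- by rewrite f0 big1// => i _; rewrite mxE mulr0.
- move=> a b fa fb; rewrite fB fa fb -sumrB; apply: eq_bigr => i _.
  by rewrite !mxE rmorphB mulrBr.
- move=> j; rewrite (bigD1 j)//= big1 => [|i ij]; rewrite mxE /= ?eqxx ?mulr1 ?addr0//.
  by rewrite (negbTE ij) mulr0.
Qed.

(** An additive map takes the same value on the two products of lifts of the basis vectors i and j,
    which differ by the central element 2B(i, j). Its coefficients on the centre thus give a linear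
    relation between the matrices of [B], and so they vanish. *)
Lemma ext_hom (phi : G -> F) : independent BF ->
  (forall a b, phi (a * b)%g = phi a + phi b) ->
  exists a : 'I_n -> F, forall g : G, phi g = \sum_i a i * (g.1 ord0 i)%:~R.
Proof.
move=> Bi phiM.
have phi2D v w : phi (0, v + w) = phi (0, v) + phi (0, w).
  by rewrite -phiM ext_mulE /= pairing0l !addr0.
have split_phi v w : phi (v, w) = phi (v, 0) + phi (0, w).
  by rewrite -phiM ext_mulE /= pairing0r !addr0 add0r.
pose c l := phi (0, delta_mx ord0 l).
have phi2 w : phi (0, w) = \sum_l c l * (w ord0 l)%:~R := additive_row_int phi2D w.
have c0 : forall l, c l = 0.
  apply: Bi; apply/matrixP => i j; rewrite summxE mxE.
  have := phiM (delta_mx ord0 i, 0) (delta_mx ord0 j, 0).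
  rewrite [RHS]addrC -phiM !ext_mulE /= split_phi [RHS]split_phi !add0r.
  rewrite [delta_mx _ j + _]addrC => /addrI; rewrite !phi2.
  rewrite [in RHS](eq_bigr (fun l => - (c l * (B l i j)%:~R))); last first.
    by move=> l _; rewrite [X in X%:~R](pairing_delta j i) Banti rmorphN mulrN.
  rewrite sumrN (eq_bigr (fun l => c l * (B l i j)%:~R)); last first.
    by move=> l _; rewrite [X in X%:~R](pairing_delta i j).
  move=> /eqP; rewrite -subr_eq0 opprK -mulr2n mulrn_eq0 /= => /eqP h.
  by rewrite -[RHS]h; apply: eq_bigr => l _; rewrite !mxE.
have phi20 w : phi (0, w) = 0 by rewrite phi2 big1// => l _; rewrite c0 mul0r.
have phi1D v w : phi (v + w, 0) = phi (v, 0) + phi (w, 0).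
  by rewrite -phiM ext_mulE /= [RHS]split_phi phi20 addr0.
exists (fun i => phi (delta_mx ord0 i, 0)) => -[v w] /=.
by rewrite split_phi phi20 addr0 (additive_row_int phi1D).
Qed.

Definition formF (A : 'M[F]_n) (v w : 'rV[int]_n) : F :=
  \sum_i \sum_j A i j * (v ord0 i)%:~R * (w ord0 j)%:~R.

Lemma formF_Dl A v v' w : formF A (v + v') w = formF A v w + formF A v' w.
Proof.
rewrite -big_split; apply: eq_bigr => i _; rewrite -big_split; apply: eq_bigr => j _.
by rewrite mxE rmorphD mulrDr mulrDl.
Qed.

Lemma formF_Dr A v w w' : formF A v (w + w') = formF A v w + formF A v w'.
Proof.
rewrite -big_split; apply: eq_bigr => i _; rewrite -big_split; apply: eq_bigr => j _.
by rewrite mxE rmorphD mulrDr.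
Qed.

Lemma formF0r A v : formF A v 0 = 0.
Proof. by apply: (addIr (formF A v 0)); rewrite -formF_Dr !add0r. Qed.

Lemma formF_tr A v w : formF A^T v w = formF A w v.
Proof.
rewrite /formF exchange_big; apply: eq_bigr => i _; apply: eq_bigr => j _.
by rewrite mxE mulrAC.
Qed.

Lemma formF_delta A i j : formF A (delta_mx ord0 i) (delta_mx ord0 j) = A i j.
Proof.
rewrite /formF (bigD1 i)//= [X in _ + X]big1 ?addr0 => [|k ki]; last first.
  by rewrite big1// => l _; rewrite mxE (negbTE ki) andbF mulr0 mul0r.
rewrite (bigD1 j)//= big1 ?addr0 => [|l lj]; first by rewrite !mxE !eqxx !mulr1.
by rewrite [X in _ * X%:~R]mxE (negbTE lj) andbF mulr0.
Qed.

Lemma formF_comb (c : 'I_m -> F) v w :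
  formF (\sum_l c l *: BF l) v w = \sum_l c l * (pairing B v w ord0 l)%:~R.
Proof.
have -> : \sum_l c l * (pairing B v w ord0 l)%:~R = \sum_l c l * formF (BF l) v w.
  apply: eq_bigr => l _; congr (_ * _); rewrite mxE mxE rmorph_sum /= /formF exchange_big.
  apply: eq_bigr => j _; rewrite !mxE rmorphM rmorph_sum mulr_suml; apply: eq_bigr => i _.
  by rewrite !mxE rmorphM /=; ring.
under [RHS]eq_bigr do rewrite /formF mulr_sumr.
rewrite exchange_big; apply: eq_bigr => i _.
under [RHS]eq_bigr do rewrite mulr_sumr.
rewrite exchange_big; apply: eq_bigr => j _.
rewrite summxE !mulr_suml; apply: eq_bigr => l _.
by rewrite !mxE !mulrA.
Qed.

Lemma ext_cup_trivial (A : 'M[F]_n) :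
  (exists eta : G -> F, forall g g' : G, formF A g.1 g'.1 = eta g + eta g' - eta (g * g')%g) <->
  in_span BF (A - A^T).
Proof.
split=> [[eta etaE]|[c cE]].
  have split_eta v w : eta (v, w) = eta (v, 0) + eta (0, w).
    have := etaE (v, 0) (0, w); rewrite ext_mulE /= pairing0r !addr0 add0r.
    by rewrite formF0r => /esym/eqP; rewrite subr_eq0 => /eqP.
  have etaD v w : eta (0, v + w) = eta (0, v) + eta (0, w).
    have := etaE (0, v) (0, w); rewrite ext_mulE /= pairing0r !addr0.
    by rewrite formF0r => /esym/eqP; rewrite subr_eq0 => /eqP.
  pose L l := eta (0, delta_mx ord0 l).
  (* [eta] is additive on the centre, with coefficients [L]. Antisymmetrizing its equation on basis
     vectors leaves only the central terms, which double since [B] is antisymmetric. *)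
  exists (fun l => - (L l *+ 2)); apply/matrixP => i j; rewrite summxE !mxE.
  have Aij k k' : A k k' = eta (delta_mx ord0 k, 0) + eta (delta_mx ord0 k', 0) -
      eta (delta_mx ord0 k + delta_mx ord0 k', 0) - \sum_l L l * (B l k k')%:~R.
    rewrite -formF_delta (etaE (delta_mx ord0 k, 0) (delta_mx ord0 k', 0)) ext_mulE /=.
    rewrite !add0r [eta (_ + _, _)]split_eta opprD addrA (additive_row_int etaD).
    by congr (_ - _); apply: eq_bigr => l _; rewrite [X in X%:~R](pairing_delta k k').
  rewrite (Aij i j) (Aij j i) [delta_mx _ j + _]addrC [eta (delta_mx _ j, _) + _]addrC.
  rewrite opprB addrC addrA subrK -sumrB; apply: eq_bigr => l _.
  by rewrite !mxE Banti rmorphN mulNr mulrN mulr2n mulrDl opprD.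
(* The quadratic part contributes the symmetric half of A. The linear part on the centre contributes
   half of the form of [B] with coefficients c, which is the antisymmetric half. *)
exists (fun g : G => - (formF A g.1 g.1 + \sum_l c l * (g.2 ord0 l)%:~R) / 2) => -[v w] [v' w'] /=.
have h : formF A v v' - formF A v' v = \sum_l c l * (pairing B v v' ord0 l)%:~R.
  rewrite -formF_comb -cE -[X in _ - X]formF_tr /formF -sumrB; apply: eq_bigr => i _.
  rewrite -sumrB; apply: eq_bigr => j _.
  by rewrite !mxE !mulrBl.
rewrite formF_Dl !formF_Dr.
have -> : \sum_l c l * ((w + w' + pairing B v v') ord0 l)%:~R = \sum_l c l * (w ord0 l)%:~R +
    \sum_l c l * (w' ord0 l)%:~R + (formF A v v' - formF A v' v).
  rewrite h -!big_split; apply: eq_bigr => l _.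
  by rewrite [X in X%:~R]mxE [X in X + _]mxE !rmorphD !mulrDr.
by field.
Qed.

End CentralExtensionCohomology.

(** * Relations between cup products *)

Section CupTriviality.
Variables (R : realType) (X : topologicalType).
Local Notation C := R[i].
Local Notation E := (singular_complex R X).
Local Notation cochain := (singular_cochain R X).

Section Family.
Variables (n : nat) (x : 'I_n -> cochain 1).

Definition cup_comb (A : 'M[C]_n) : cochain 2 :=
  fun s => \sum_i \sum_j A i j * cup (x i) (x j) s.

Definition cup_trivial (A : 'M[C]_n) := exists h : cochain 1, singular_coboundary h = cup_comb A.

Lemma cup_comb_tri A (V : normedModType R) (F : continuousType V X) a b c :
  cup_comb A (tri F a b c) = \sum_i \sum_j A i j * (x i (seg F a b) * x j (seg F b c)).
Proof. by apply: eq_bigr => i _; apply: eq_bigr => j _; rewrite cup_tri. Qed.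

Lemma eq_on_triangles (w w' : cochain 2) :
  (forall F : continuousType (R^o * R^o)%type X,
    w (tri F (0, 0) (1, 0) (1, 1)) = w' (tri F (0, 0) (1, 0) (1, 1))) -> w = w'.
Proof. by move=> ww; apply/funext => s; rewrite -(tri_mapE s). Qed.

Lemma cup_trivial_comb m (c : 'I_m -> C) (A : 'I_m -> 'M[C]_n) :
  (forall l, cup_trivial (A l)) -> cup_trivial (\sum_l c l *: A l).
Proof.
move=> /choice[h hA]; exists (fun s => \sum_l c l * h l s); apply: eq_on_triangles => F.
rewrite coboundary_tri cup_comb_tri -sumrB -big_split /=.
under eq_bigr do rewrite -mulrBr -mulrDr -coboundary_tri hA cup_comb_tri mulr_sumr.
rewrite exchange_big; apply: eq_bigr => i _.
under eq_bigr do rewrite mulr_sumr.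
rewrite exchange_big; apply: eq_bigr => j _.
rewrite summxE mulr_suml; apply: eq_bigr => l _.
by rewrite mxE mulrA.
Qed.

Lemma cup_trivialZ c A : cup_trivial A -> cup_trivial (c *: A).
Proof.
move=> tA; have := @cup_trivial_comb 1 (fun=> c) (fun=> A) (fun=> tA).
by rewrite big_ord1.
Qed.

Lemma cup_trivialD A A' : cup_trivial A -> cup_trivial A' -> cup_trivial (A + A').
Proof.
move=> tA tA'; have := @cup_trivial_comb 2 (fun=> 1)
  (fun i => if val i == 0%N then A else A').
rewrite !big_ord_recl big_ord0 /= addr0 !scale1r; apply=> l; by case: ifP.
Qed.

Hypothesis dx : forall i, singular_coboundary (x i) = 0.

(** For closed f and g, the coboundary of the pointwise product of f and g is minus the sum of the
    cup products fg and gf. *)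
Lemma cup_trivial_sym A : cup_trivial (A + A^T).
Proof.
exists (fun s => - \sum_i \sum_j A i j * (x i s * x j s)); apply: eq_on_triangles => F.
rewrite coboundary_tri cup_comb_tri opprK.
transitivity (\sum_i \sum_j A i j * (x i (seg F (0, 0) (1, 0)) * x j (seg F (1, 0) (1, 1)) +
    x j (seg F (0, 0) (1, 0)) * x i (seg F (1, 0) (1, 1)))).
  rewrite -!sumrN -!big_split; apply: eq_bigr => i _.
  rewrite -!sumrN -!big_split; apply: eq_bigr => j _.
  rewrite -(closed_seg F (0, 0) (1, 0) (1, 1) (dx i)) -(closed_seg F (0, 0) (1, 0) (1, 1) (dx j)).
  move: (A i j) (x i _ : C) (x i _ : C) (x j _ : C) (x j _ : C) => a p q r s /=.
  ring.
rewrite (eq_bigr (fun i => \sum_j A i j * (x i (seg F (0, 0) (1, 0)) * x j (seg F (1, 0) (1, 1))) +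
    \sum_j A i j * (x j (seg F (0, 0) (1, 0)) * x i (seg F (1, 0) (1, 1))))); last first.
  by move=> i _; rewrite -big_split; apply: eq_bigr => j _; rewrite mulrDr.
rewrite big_split /= [X in _ + X]exchange_big -big_split; apply: eq_bigr => i _.
by rewrite -big_split; apply: eq_bigr => j _; rewrite !mxE mulrDl.
Qed.

Lemma cup_trivial_anti A : cup_trivial A <-> cup_trivial (A - A^T).
Proof.
split=> tA.
  have -> : A - A^T = 2 *: A + (-1) *: (A + A^T).
    by apply/matrixP => i j; rewrite !mxE; ring.
  by apply: cup_trivialD; apply: cup_trivialZ => //; exact: cup_trivial_sym.
have -> : A = 2^-1 *: ((A - A^T) + (A + A^T)).
  by apply/matrixP => i j; rewrite !mxE; field.
by apply: cup_trivialZ; apply: cup_trivialD => //; exact: cup_trivial_sym.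
Qed.

Lemma cup_primitive_normalized A h : singular_coboundary h = cup_comb A -> normalized h.
Proof.
have x0 i y : x i (const_seg R y) = 0.
  by apply: normalized_const; exact: closed_normalized.
move=> hA V F a b c ab; rewrite hA cup_comb_tri big1// => i _; rewrite big1// => j _.
by case: ab => ->; rewrite x0 ?mul0r !mulr0.
Qed.

End Family.

Lemma cocycle_sumE n (a : 'I_n -> C) (x : 'I_n -> cocycle E 1) s :
  (val (\sum_i a i *: x i) : cochain 1) s = \sum_i a i * (val (x i) : cochain 1) s.
Proof.
have -> : val (\sum_i a i *: x i) = \sum_i a i *: val (x i) by rewrite raddf_sum.
by apply: (big_ind2 (fun (f : E 1) (u : C) => (f : cochain 1) s = u)) => // f u g v <- <-.
Qed.

Lemma class_sumE n (a : 'I_n -> C) (x : 'I_n -> cocycle E 1) :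
  \sum_i a i *: cocycle_class (x i) = cocycle_class (\sum_i a i *: x i).
Proof. by rewrite linear_sum; apply: eq_bigr => i _; rewrite linearZ. Qed.

Lemma left_mul_comb_eq0 n (x : 'I_n -> cocycle E 1) (a b : 'I_n -> C) :
  left_mul (\sum_i a i *: cocycle_class (x i) : singular_cohomology R X 1)
           (\sum_i b i *: cocycle_class (x i) : singular_cohomology R X 1) = 0 <->
  cup_trivial (fun i => val (x i)) (\matrix_(i, j) (a i * b j)).
Proof.
rewrite !class_sumE left_mul_eq0 /cup_trivial.
have -> // : cup (val (\sum_i a i *: x i)) (val (\sum_i b i *: x i)) =
  cup_comb (fun i => val (x i)) (\matrix_(i, j) (a i * b j)).
apply: eq_on_triangles => F; rewrite cup_comb_tri cup_tri !cocycle_sumE mulr_suml.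
apply: eq_bigr => i _; rewrite mulr_sumr; apply: eq_bigr => j _.
by rewrite mxE mulrACA.
Qed.

Definition mk_cocycle (f : cochain 1) (df : singular_coboundary f = 0) : cocycle E 1 :=
  exist (fun f : E 1 => f \in @is_cocycle C E 1) f (introT eqP df).

End CupTriviality.

(** * Rational classes and integral relations of the complex *)

Section RationalStructure.
Variables (R : realType) (M : topologicalType) (S : cw_structure R M).
Local Notation C := R[i].
Local Notation E := (singular_complex R M).
Local Notation cochain := (singular_cochain R M).
Local Notation H1 := (singular_cohomology R M 1).

Lemma rat_linearD (F : numFieldType) (l : F -> rat) : rat_linear l ->
  forall x y, l (x + y) = l x + l y.
Proof. by move=> ll x y; have := ll 1 x y; rewrite rmorph1 !mul1r. Qed.

Lemma rat_linearN (F : numFieldType) (l : F -> rat) : rat_linear l ->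
  forall x, l (- x) = - l x.
Proof.
move=> ll x; have := ll (- 1) x 0; rewrite rmorphN1 !mulN1r !addr0 => ->.
by rewrite rat_linear0// addr0.
Qed.

Lemma rat_linearM (F : numFieldType) (l : F -> rat) : rat_linear l ->
  forall q x, l (x * ratr q) = q * l x.
Proof. by move=> ll q x; have := ll q x 0; rewrite rat_linear0// !addr0 mulrC. Qed.

Lemma rat_linear_sum (F : numFieldType) (l : F -> rat) (I : finType) (f : I -> F) :
  rat_linear l -> l (\sum_i f i) = \sum_i l (f i).
Proof.
move=> ll; apply: (big_morph l); [exact: rat_linearD|exact: rat_linear0].
Qed.

Definition edge (e : cell S 1) : singular_simplex R M 1 :=
  seg (@chic R M S (existT _ 1%N e)) (const_mx (-1)) (const_mx 1).

Lemma exact_edges (f : cochain 1) : singular_coboundary f = 0 ->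
  (forall e, f (edge e) = 0) -> exists g, singular_coboundary g = f.
Proof.
move=> df f0; apply: (exact_of_edges (S := S)) => // -[k e] /= k1.
by subst k; exact: f0.
Qed.

Definition rational_cochain (f : cochain 1) := forall s, exists q, f s = ratr q.

Lemma closed_rat_part (f : cochain 1) (l : C -> rat) : rat_linear l ->
  singular_coboundary f = 0 ->
  singular_coboundary ((fun s => ratr (l (f s))) : cochain 1) = 0.
Proof.
move=> ll df; apply/closedP => F a b c.
by rewrite -rmorphD -rat_linearD// closed_seg.
Qed.

Hypothesis fin1 : finite_set [set: cell S 1].

(** By [exact_edges], a cocycle that vanishes on the edges has class 0. Hence the number of edges
    bounds independent families, and identities between classes may be checked on the edges. *)
Lemma rational_basis : exists n (x : 'I_n -> cocycle E 1),
  [/\ forall i, rational_cochain (val (x i)),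
      independent (fun i => cocycle_class (x i) : H1) &
      forall w : H1, in_span (fun i => cocycle_class (x i) : H1) w].
Proof.
have [s sE] : exists s : seq {classic (cell S 1)}, [set: {classic (cell S 1)}] = [set` s].
  exact/finite_seqP.
have s_all (e : cell S 1) : (e : {classic (cell S 1)}) \in s.
  by have : [set: {classic (cell S 1)}] e by []; rewrite sE.
have exact0 (y : cocycle E 1) : (forall e, (val y : cochain 1) (edge e) = 0) ->
    cocycle_class y = 0 :> H1.
  move=> y0; apply/cocycle_class_eq0; apply: exact_edges y0.
  by have /eqP := valP y.
pose P (w : H1) := exists2 y : cocycle E 1, rational_cochain (val y) & w = cocycle_class y.
have [n [v [/choice[x xP] iv sv]]] : exists n (v : 'I_n -> H1),
    [/\ forall i, exists y : cocycle E 1, rational_cochain (val y) /\ v i = cocycle_class y,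
        independent v & forall w, P w -> in_span v w].
  have [|n [v [Pv iv sv]]] := @maximal_independent _ H1 P (size s).
    move=> k v Pv iv.
    have /choice[y yP] : forall i, exists y : cocycle E 1, v i = cocycle_class y.
      by move=> i; have [y _ vy] := Pv i; exists y.
    apply: (@independent_le C (size s) k
      (fun i => \row_j (val (y i) : cochain 1) (edge (tnth (in_tuple s) j)))).
    move=> a a0; apply: iv; under eq_bigr do rewrite yP.
    rewrite class_sumE; apply: exact0 => e; rewrite cocycle_sumE.
    have /tnthP[j ->] : (e : {classic (cell S 1)}) \in in_tuple s by exact: s_all.
    have := congr1 (fun r : 'rV[C]_(size s) => r ord0 j) a0.
    rewrite summxE mxE => a0j; rewrite -[RHS]a0j; apply: eq_bigr => i _.
    by rewrite !mxE.
  exists n, v; split=> // i; have [y ry vy] := Pv i; by exists y.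
exists n, x; split=> [i|a a0|w].
- exact: (xP i).1.
- by apply: iv; rewrite -[RHS]a0; apply: eq_bigr => i _; rewrite (xP i).2.
have vx : v = (fun i => cocycle_class (x i) : H1) by apply/funext => i; exact: (xP i).2.
rewrite -vx -[w]cocycle_reprK; move: (cocycle_repr w) => {w} f.
have df : singular_coboundary (val f : cochain 1) = 0 by have /eqP := valP f.
(* Composing f with the functionals [l i] gives rational cocycles, and f agrees on the edges with
   their combination with coefficients [b i]. *)
have [m [b [l [ll lE]]]] := rational_coordinates [seq (val f : cochain 1) (edge e) | e <- s].
pose y (i : 'I_m) : cocycle E 1 := mk_cocycle (closed_rat_part (ll i) df).
have -> : cocycle_class f = \sum_(i < m) b i *: (cocycle_class (y i) : H1).
  apply/eqP; rewrite -subr_eq0; apply/eqP.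
  rewrite (class_sumE (fun i : 'I_m => b i) y) -raddfB; apply: exact0 => e.
  rewrite raddfB /=.
  rewrite -[LHS]/((val f : cochain 1) (edge e) -
    (val (\sum_(i < m) b i *: y i) : cochain 1) (edge e)) cocycle_sumE.
  rewrite [X in X - _]lE; last first.
    exact: (map_f (fun e : {classic (cell S 1)} => (val f : cochain 1) (edge e)) (s_all e)).
  by apply/eqP; rewrite subr_eq0; apply/eqP; apply: eq_bigr => i _; rewrite mulrC.
apply: in_span_comb => i; apply: sv; exists (y i) => // t.
by exists (l i ((val f : cochain 1) t)).
Qed.

Lemma integral_relations n (x : 'I_n -> cochain 1) :
  (forall i, rational_cochain (x i)) -> (forall i, singular_coboundary (x i) = 0) ->
  exists m (B : 'I_m -> 'M[int]_n),
    [/\ forall l i j, B l j i = - B l i j,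
        independent (fun l => map_mx intr (B l) : 'M[C]_n) &
        forall A : 'M[C]_n, cup_trivial x A <->
          in_span (fun l => map_mx intr (B l) : 'M[C]_n) (A - A^T)].
Proof.
move=> xrat dx.
(* Integrality is built into [P], so that the matrices found can define a group law; what has to be
   shown is that they span the complex relations too. *)
pose P (W : 'M[C]_n) := exists Z : 'M[int]_n,
  [/\ forall i j, Z j i = - Z i j, W = map_mx intr Z & cup_trivial x W].
have [|m [v [/choice[B BP] iv sv]]] := @maximal_independent _ 'M[C]_n P (n * n)%N.
  move=> k v _ iv; apply: (@independent_le C (n * n) k (fun i => mxvec (v i))) => a a0.
  apply: iv; apply: (can_inj mxvecK); rewrite linear0 -[RHS]a0 linear_sum.
  by apply: eq_bigr => i _; rewrite linearZ.
have vB : v = (fun l => map_mx intr (B l) : 'M[C]_n).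
  by apply/funext => l; have [] := BP l.
exists m, B; rewrite -vB; split=> // [l i j|A]; first by have [] := BP l.
rewrite (cup_trivial_anti dx A).
have : (A - A^T)^T = - (A - A^T) by rewrite linearB /= trmxK opprB.
move: (A - A^T) => {}A At; split=> [[h hA]|[c ->]]; last first.
  by apply: cup_trivial_comb => l; have [_ _] := BP l.
pose s := [seq A ij.1 ij.2 | ij <- enum {: 'I_n * 'I_n}].
(* Applying a rational functional l to a primitive of a complex relation A gives a
   primitive of the rational relation l(A), since the x i are rational-valued. *)
have [k [b [l [ll lE]]]] := rational_coordinates s.
have AE : A = \sum_(t < k) b t *: (\matrix_(i, j) ratr (l t (A i j))).
  apply/matrixP => i j; rewrite summxE.
  have /lE {1}-> : A i j \in s by apply/mapP; exists (i, j); rewrite ?mem_enum.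
  by apply: eq_bigr => t _; rewrite !mxE mulrC.
rewrite AE; apply: in_span_comb => t.
(* Clearing denominators turns the rational relation into an integral one, to which maximality
   applies. *)
have [d d0 dE] := common_denominator [seq l t q | q <- s].
have /choice[z zE] : forall ij : 'I_n * 'I_n, exists z : int,
    d%:~R * l t (A ij.1 ij.2) = z%:~R.
  by move=> ij; apply: dE; apply: map_f; apply/mapP; exists ij; rewrite ?mem_enum.
have dC : (d%:~R : C) != 0 by rewrite intr_eq0.
pose Z : 'M[int]_n := \matrix_(i, j) z (i, j).
have ZE : \matrix_(i, j) ratr (l t (A i j)) = (d%:~R)^-1 *: (map_mx intr Z : 'M[C]_n).
  apply/matrixP => i j; rewrite !mxE.
  have -> : (z (i, j))%:~R = d%:~R * ratr (l t (A i j)) :> C.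
    by rewrite -(ratr_int _ (z (i, j))) -zE rmorphM /= ratr_int.
  by rewrite mulrA (mulVf dC) mul1r.
have tA : cup_trivial x (\matrix_(i, j) ratr (l t (A i j))).
  exists (fun u => ratr (l t (h u))); apply: eq_on_triangles => F.
  rewrite coboundary_tri -rmorphB -rmorphD -(rat_linearN (ll t)) -!(rat_linearD (ll t)).
  rewrite -coboundary_tri hA !cup_comb_tri rat_linear_sum// rmorph_sum.
  apply: eq_bigr => i _; rewrite rat_linear_sum// rmorph_sum; apply: eq_bigr => j _.
  have [p ->] := xrat i (seg F (0, 0) (1, 0)).
  have [q ->] := xrat j (seg F (1, 0) (1, 1)).
  rewrite -rmorphM rat_linearM// mxE /=.
  by rewrite [LHS]rmorphM /= mulrC.
have PZ : P (map_mx intr Z).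
  exists Z; split=> // [i j|].
    apply: (@intr_inj rat); rewrite rmorphN !mxE /=.
    rewrite -(zE (j, i)) -(zE (i, j)) /= -mulrN -rat_linearN//.
    by congr (_ * l t _); move/matrixP: At => /(_ i j); rewrite !mxE.
  have -> : map_mx intr Z = d%:~R *: (\matrix_(i, j) ratr (l t (A i j))) :> 'M[C]_n.
    by rewrite ZE scalerA (mulfV dC) scale1r.
  exact: cup_trivialZ.
have [c cE] := sv _ PZ; exists (fun i => (d%:~R)^-1 * c i).
rewrite ZE cE scaler_sumr; apply: eq_bigr => i _.
by rewrite scalerA.
Qed.

End RationalStructure.

(** * Degree 1 classes and relations on a space with fundamental group G *)

Section GroupModel.
Variables (R : realType) (N : topologicalType) (x0 : N).
Local Notation C := R[i].
Local Notation E := (singular_complex R N).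
Local Notation cochain := (singular_cochain R N).
Local Notation H1 := (singular_cohomology R N 1).
Variables (n m : nat) (B : 'I_m -> 'M[int]_n).
Local Notation BC := (fun l => map_mx intr (B l) : 'M[C]_n).
Hypotheses (pathN : forall x y : N, exists p : continuousType R^o N, p 0 = x /\ p 1 = y)
  (Banti : forall l i j, B l j i = - B l i j) (Bi : independent BC).

(** The cocycles are the coordinates of the holonomy in Z^n. Primitives of relations go from the
    space to the group by [L] and back by [rho], which reduces the last item to
    [ext_cup_trivial]. *)
Lemma group_basis : pi1_isomorphic R x0 (central_ext B) ->
  exists y : 'I_n -> cocycle E 1,
    [/\ independent (fun i => cocycle_class (y i) : H1),
        forall w : H1, in_span (fun i => cocycle_class (y i) : H1) w &
        forall A : 'M[C]_n, cup_trivial (fun i => val (y i)) A <-> in_span BC (A - A^T)].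
Proof.
move=> /(holonomy pathN)[rho [L [Lloop rhoM rho_all rhoL Lmul]]].
pose f i : cochain 1 := fun s => ((rho s).1 ord0 i)%:~R.
have df i : singular_coboundary (f i) = 0.
  apply: eq_on_triangles => F; rewrite coboundary_tri /f rhoM ext_mulE mxE rmorphD.
  by rewrite opprD addrCA subrr addr0 addNr.
pose y i : cocycle E 1 := mk_cocycle (df i).
pose coord i (g : central_ext B) : C := (g.1 ord0 i)%:~R.
have coordM i a b : coord i (a * b)%g = coord i a + coord i b.
  by rewrite /coord ext_mulE mxE rmorphD.
have fL i g : f i (L g) = coord i g := rhoL _ (coordM i) g.
exists y; split.
- move=> a; rewrite class_sumE => /cocycle_class_eq0[u uE] i.
  (* A coboundary vanishes on the loops [L g]; lifts of the basis vectors then single out the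
     coefficients. *)
  have a0 g : \sum_i a i * coord i g = 0.
    rewrite -[RHS](Lloop (u \o @point R N) g) -cochain0P uE cocycle_sumE.
    by apply: eq_bigr => j _; rewrite -fL.
  rewrite -[RHS](a0 (delta_mx ord0 i, 0)) (bigD1 i)//= big1 => [|j ji].
    by rewrite addr0 /coord mxE !eqxx mulr1.
  by rewrite /coord mxE (negbTE ji) andbF mulr0.
- move=> w; rewrite -[w]cocycle_reprK; move: (cocycle_repr w) => {w} c.
  have dc : singular_coboundary (val c : cochain 1) = 0 by have /eqP := valP c.
  have [phi [u [phiM cE]]] := rho_all _ dc.
  have [a aE] := ext_hom Banti Bi phiM.
  exists a; rewrite class_sumE; apply/eqP; rewrite -subr_eq0 -raddfB; apply/eqP.
  apply/cocycle_class_eq0; exists (cochain0 u); rewrite raddfB /=.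
  apply/funext => s; rewrite -[RHS]/((val c : cochain 1) s -
    (val (\sum_i a i *: y i) : cochain 1) s) cocycle_sumE cE.
  by rewrite -[RHS]/(phi (rho s) + _ - _) aE addrAC subrr add0r.
- move=> A; rewrite -(ext_cup_trivial Banti); split=> [[h hA]|[eta etaE]].
    (* [h] is not closed, but it is normalized, so on the concatenation of [L g] and [L g'] it takes
       the same value as on the loop [L (g * g')]. *)
    exists (h \o L) => g g'; have nh := cup_primitive_normalized df hA.
    have [F [a [b [c [Fg Fg' Fgg']]]]] := Lmul h nh g g'.
    have := coboundary_tri F h a b c; rewrite hA cup_comb_tri Fg Fg' Fgg' => e.
    transitivity (h (L g') - h (L (g * g')%g) + h (L g)); last by rewrite /= addrC addrA.
    rewrite -e.
    apply: eq_bigr => i _; apply: eq_bigr => j _.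
    by rewrite -mulrA -[val (y i)]/(f i) -[val (y j)]/(f j) !fL.
  exists (fun s => eta (rho s)); apply: eq_on_triangles => F.
  rewrite coboundary_tri cup_comb_tri rhoM addrC addrA -etaE.
  by apply: eq_bigr => i _; apply: eq_bigr => j _; rewrite -mulrA.
Qed.

End GroupModel.

Local Close Scope ring_scope.

(* The resonance varieties of G are those of any K(G,1). *)
Theorem mainTheorem7 (R : realType) (M : topologicalType)
    (cwM : cw_structure R M) :
  connected_space M -> finite_1skeleton cwM ->
  exists G : groupType,
    [/\ finitely_generated G, two_step_nilpotent G, torsion_free G &
        forall N : topologicalType, eilenberg_maclane1 R G N ->
          exists phi : {linear singular_cohomology R N 1 ->
                               singular_cohomology R M 1},
            bijective phi /\
            forall k : nat, (0 < k)%N ->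
              phi @` resonance R N 1 k = resonance R M 1 k].
Proof.
move=> [[m0 _] connM] [_ fin1].
have [n [x [xrat ix sx]]] := rational_basis fin1.
have dx i : singular_coboundary (val (x i) : singular_cochain R M 1) = 0%R.
  by have /eqP := valP (x i).
have [m [B [Banti Bi Bspan]]] := integral_relations xrat dx.
exists (central_ext B : groupType); split.
- exact: ext_finitely_generated.
- exact: ext_two_step.
- exact: ext_torsion_free.
move=> N [[cwN] [[n0 _] connN] [x0 [pi1N _]]].
have pathM := cw_path_connected cwM connM.
have pathN := cw_path_connected cwN connN.
have [y [iy sy yA]] := group_basis pathN Banti Bi pi1N.
have [phi [bphi phiE]] := basis_linear_bij iy sy ix sx.
exists phi; split=> // k _; apply: (resonance_transport n0 m0) => // z w.
(* In the bases y and x, both products vanish under the same condition on the matrix of the products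
   [a i * b j]: its antisymmetric part lies in the span of [B]. *)
have [a ->] := sy z; have [b ->] := sy w.
by rewrite !phiE !left_mul_comb_eq0 yA Bspan.
Qed.
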